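(* Let $G$ be a finite simple indecomposable graph whose block graph $B(G)$ is a path of length $l-1$ (i.e. on $l$ vertices) for some $l\geq 3$; denote the blocks of $G$, in the order in which they appear along this path, by $B_1,\dots,B_l$. Assume that $B_1=K_{m_1}$ with $m_1\geq 2$, that $B_l=K_{m_l}$ with $m_l\geq 3$, that $B_2=B_{l-1}=C_4$, and that for each $3\leq i\leq l-2$ the block $B_i$ is either $C_4$ or a complete graph on at least $3$ vertices. Further assume that each block of $G$ that is a $C_4$ contains exactly two cut vertices of $G$, and that these two cut vertices are adjacent. Let $\mathbb{K}$ be a field, $S=\mathbb{K}[x_v,y_v:v\in V(G)]$, and let $J_G\subset S$ be the binomial edge ideal of $G$. Then \[\operatorname{reg}(S/J_G)=2\,c_4(G)+c'(G),\] where $c_4(G)$ is the number of blocks of $G$ that are $C_4$, and $c'(G)$ is the number of maximal cliques of $G$ other than the edges of these $C_4$'s.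
   Context: For a graph $G$ on $[n]=\{1,\dots,n\}$, the binomial edge ideal is $J_G=\langle x_iy_j-x_jy_i : \{i,j\}\in E(G)\rangle\subset S=\mathbb{K}[x_1,\dots,x_n,y_1,\dots,y_n]$, where $S$ is standard graded and $\mathbb{K}$ is an arbitrary field. For a finitely generated graded $S$-module $M$ with graded Betti numbers $\beta_{i,j}(M)=\dim_{\mathbb{K}}\operatorname{Tor}_i^S(M,\mathbb{K})_j$, the Castelnuovo–Mumford regularity is $\operatorname{reg}(M)=\max\{j:\beta_{i,i+j}(M)\neq 0 \text{ for some } i\}$. $K_m$ is the complete graph on $m$ vertices and $C_4$ is the cycle on $4$ vertices; equalities such as $B_2=C_4$ mean isomorphism of graphs. A cut vertex of $G$ is a vertex $v$ such that $G\setminus v$ has more connected components than $G$. A block of $G$ is a maximal connected subgraph of $G$ that has no cut vertex (of its own). The block graph $B(G)$ has the blocks of $G$ as vertices, two blocks being adjacent whenever they have a common cut vertex of $G$. A vertex is simplicial in a graph if it lies in exactly one maximal clique of that graph. A graph $G$ is decomposable if it can be written as $G=G_1\cup_v G_2$, meaning $G_1,G_2$ are subgraphs (neither a single vertex) with $V(G)=V(G_1)\cup V(G_2)$, $E(G)=E(G_1)\cup E(G_2)$, $V(G_1)\cap V(G_2)=\{v\}$, where $v$ is a simplicial vertex of both $G_1$ and $G_2$; otherwise $G$ is indecomposable. *)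

(* Defs.v *)
From HB Require Import structures.
From mathcomp Require Import all_boot all_order all_algebra.
From mathcomp Require Import mpoly.

Set Implicit Arguments.
Unset Strict Implicit.
Unset Printing Implicit Defensive.

Import GRing.Theory.
Local Open Scope ring_scope.

(* A graph living on vertices taken from V: a vertex set together with a set of
   edges, an edge being the two-element set of its endpoints.  This one type
   serves both for the ambient graph and for its (not necessarily induced)
   subgraphs; [simple_graph] is the well-formedness condition. *)
Definition pregraph (V : finType) : Type := ({set V} * {set {set V}})%type.
HB.instance Definition _ (V : finType) := Finite.on (pregraph V).

Section Graphs.
Variable V : finType.
Implicit Types G H : pregraph V.

Definition verts G : {set V} := G.1.
Definition edges G : {set {set V}} := G.2.

Definition simple_graph G : bool :=
  [forall A in edges G, (#|A| == 2)%N && (A \subset verts G)].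

(* Irreflexive for simple graphs, since [set u; u] is not a two-element set. *)
Definition adj G : rel V := fun u v => [set u; v] \in edges G.

Definition subgraph H G : bool :=
  [&& simple_graph H, verts H \subset verts G & edges H \subset edges G].

Definition del_vertex G (v : V) : pregraph V :=
  (verts G :\ v, [set A in edges G | v \notin A]).

Definition num_components G : nat := n_comp (adj G) (verts G).

Definition connected_graph G : bool := num_components G == 1%N.

Definition cut_vertex G (v : V) : bool :=
  (v \in verts G) && (num_components G < num_components (del_vertex G v))%N.

Definition nonseparable G : bool :=
  connected_graph G && [forall v, ~~ cut_vertex G v].

Definition is_block G H : bool :=
  [&& subgraph H G, nonseparable H &
      [forall H' : pregraph V,
         [&& subgraph H' G, nonseparable H' & subgraph H H'] ==> (H' == H)]].

Definition block_adj G H1 H2 : bool :=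
  (H1 != H2) &&
  [exists v, [&& cut_vertex G v, v \in verts H1 & v \in verts H2]].

(* The block graph of G is a path on l vertices, traversed as B 1, ..., B l;
   the values of B outside 1..l are irrelevant. *)
Definition block_path G (l : nat) (B : nat -> pregraph V) : Prop :=
  [/\ forall i, (1 <= i <= l)%N -> is_block G (B i),
      forall i j, (1 <= i <= l)%N -> (1 <= j <= l)%N -> B i = B j -> i = j,
      forall H, is_block G H -> exists2 i, (1 <= i <= l)%N & H = B i
    & forall i j, (1 <= i <= l)%N -> (1 <= j <= l)%N ->
        block_adj G (B i) (B j) = (j == i.+1) || (i == j.+1)].

Definition clique G (C : {set V}) : bool :=
  (C \subset verts G) &&
  [forall u in C, forall v in C, (u != v) ==> adj G u v].

Definition maximal_clique G (C : {set V}) : bool := maxset (clique G) C.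

Definition simplicial G (v : V) : bool :=
  (v \in verts G) &&
  (#|[set C : {set V} | maximal_clique G C & v \in C]| == 1%N).

Definition decomposable G : Prop :=
  exists (G1 G2 : pregraph V) (v : V),
    [/\ simple_graph G1 && simple_graph G2,
        (#|verts G1| != 1%N) && (#|verts G2| != 1%N),
        verts G = verts G1 :|: verts G2 /\ edges G = edges G1 :|: edges G2,
        verts G1 :&: verts G2 = [set v]
      & simplicial G1 v && simplicial G2 v].

End Graphs.

(* Isomorphism of a graph G on T with a graph H on V; only the restriction of
   f to the vertices of G matters. *)
Definition graph_iso (T V : finType) (G : pregraph T) (H : pregraph V) : bool :=
  [exists f : {ffun T -> V},
    [&& dinjectiveb f (mem (verts G)),
        f @: verts G == verts H &
        [forall u in verts G, forall v in verts G,
           adj G u v == adj H (f u) (f v)]]].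

Definition complete_graph (m : nat) : pregraph 'I_m :=
  ([set: 'I_m], [set A : {set 'I_m} | #|A| == 2]).

(* The cycle 0, 1, ..., m - 1, 0, for m >= 3. *)
Definition cycle_graph (m : nat) : pregraph 'I_m :=
  ([set: 'I_m], [set [set i; ordS i] | i : 'I_m]).

Definition is_complete (V : finType) (H : pregraph V) (m : nat) : bool :=
  graph_iso (complete_graph m) H.

Definition is_C4 (V : finType) (H : pregraph V) : bool :=
  graph_iso (cycle_graph 4) H.

Definition c4 (V : finType) (G : pregraph V) : nat :=
  #|[set H : pregraph V | is_block G H & is_C4 H]|.

Definition c' (V : finType) (G : pregraph V) : nat :=
  #|[set C : {set V} | maximal_clique G C &
       ~~ [exists H : pregraph V,
             [&& is_block G H, is_C4 H & C \in edges H]]]|.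

(* A polynomial that is zero or homogeneous of degree d; d is allowed to be
   negative, in which case p = 0. *)
Definition homog_deg (K : fieldType) (n : nat) (p : {mpoly K[n]}) (d : int) :
  Prop := forall m : 'X_{1..n}, m \in msupp p -> (mdeg m)%:Z = d.

Section Resolutions.
Variables (K : fieldType) (n : nat).
Notation S := {mpoly K[n]}.

(* Data ... -> F_2 -> F_1 -> F_0 -> S/J of graded free modules of finite rank.
   F_i consists of row vectors; its basis element e_a has degree gfdeg i a
   (so F_i is the direct sum of the S(- gfdeg i a)).  gfdiff i : F_(i+1) -> F_i
   acts by right multiplication, and gfaug lists lifts to S of the images of
   the basis elements of F_0 in S/J. *)
Record graded_free_complex : Type := GradedFreeComplex {
  gfrank : nat -> nat;
  gfdeg : forall i, 'I_(gfrank i) -> int;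
  gfdiff : forall i, 'M[S]_(gfrank i.+1, gfrank i);
  gfaug : 'cV[S]_(gfrank 0) }.

Definition graded_maps (F : graded_free_complex) : Prop :=
  (forall a, homog_deg (gfaug F a 0) (gfdeg (g:=F) (i:=0) a)) /\
  (forall i a b, homog_deg (gfdiff F i a b)
     (gfdeg (g:=F) (i:=i.+1) a - gfdeg (g:=F) (i:=i) b)).

(* F is a graded free resolution of S/J; each equivalence is exactness at one
   term, the backward direction saying that consecutive maps compose to 0. *)
Definition resolves (J : S -> Prop) (F : graded_free_complex) : Prop :=
  [/\ graded_maps F,
      forall p : S, exists u : 'rV[S]_(gfrank F 0),
        J (p - (u *m gfaug F) 0 0),
      forall u : 'rV[S]_(gfrank F 0),
        J ((u *m gfaug F) 0 0) <-> exists w, u = w *m gfdiff F 0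
    & forall i (u : 'rV[S]_(gfrank F i.+1)),
        u *m gfdiff F i = 0 <-> exists w, u = w *m gfdiff F i.+1].

(* The differentials of F (x)_S K, where K = S/(variables): constant terms. *)
Definition diff_K (F : graded_free_complex) i :
    'M[K]_(gfrank F i.+1, gfrank F i) :=
  map_mx (mcoeff 0%MM) (gfdiff F i).

(* The degree j component of F_i (x)_S K. *)
Definition degree_part (F : graded_free_complex) i (j : int) :
    'M[K]_(gfrank F i) :=
  diag_mx (\row_a (gfdeg (g:=F) (i:=i) a == j)%:R).

Definition cycles_K (F : graded_free_complex) i : 'M[K]_(gfrank F i) :=
  match i with
  | 0 => 1%:M
  | i'.+1 => kermx (diff_K F i')
  end.

(* dim_K of the degree j component of H_i(F (x)_S K), as the dimension of the
   cycles minus that of the boundaries. *)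
Definition homology_dim (F : graded_free_complex) i (j : int) : nat :=
  (\rank (cycles_K F i :&: degree_part F i j)%MS
   - \rank (diff_K F i :&: degree_part F i j)%MS)%N.

(* b = dim_K Tor_i^S(S/J, K)_j: Tor is the homology of F (x)_S K for a graded
   free resolution F of S/J. *)
Definition graded_betti (J : S -> Prop) (i : nat) (j : int) (b : nat) : Prop :=
  exists2 F : graded_free_complex, resolves J F & b = homology_dim F i j.

(* reg(S/J) = r, the maximum of the j with beta_(i,i+j)(S/J) != 0 for some i. *)
Definition regularity (J : S -> Prop) (r : int) : Prop :=
  (exists i b, graded_betti J i (i%:Z + r) b /\ b <> 0%N) /\
  (forall i j b, graded_betti J i (i%:Z + j) b -> b <> 0%N -> (j <= r)%R).

End Resolutions.

Section BinomialEdgeIdeal.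
Variables (K : fieldType) (V : finType).

(* The polynomial ring K[x_v, y_v : v in V]. *)
Definition xyring := {mpoly K[#|{: V + V}|]}.

Definition xvar (v : V) : xyring := 'X_(enum_rank (inl v : V + V)%type).
Definition yvar (v : V) : xyring := 'X_(enum_rank (inr v : V + V)%type).

(* Each edge is listed in both orientations, giving opposite generators. *)
Definition binomial_edge_ideal (G : pregraph V) (p : xyring) : Prop :=
  exists c : V * V -> xyring,
    p = \sum_(e | adj G e.1 e.2)
          c e * (xvar e.1 * yvar e.2 - xvar e.2 * yvar e.1).

End BinomialEdgeIdeal.

(* Main.v *)
Require Import Defs.
From HB Require Import structures.
From mathcomp Require Import all_boot all_order all_algebra.
From mathcomp Require Import mpoly.
From mathcomp Require Import zify ring.
From Stdlib Require Import Classical ClassicalEpsilon.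

Set Implicit Arguments.
Unset Strict Implicit.
Unset Printing Implicit Defensive.

Import Order.TTheory GRing.Theory Num.Theory.
Local Open Scope ring_scope.

(* Order the vertices along a Hamiltonian path that runs through the blocks in
   order and traverses every C4 between its two cut vertices a, b the long way,
   a, d, c, b.  The linear forms x_1, x_2 - y_1, ..., x_n - y_(n-1), y_n turn out
   to be a regular sequence on S/J_G, so the regularity is the top degree of the
   Artinian quotient.  Both facts follow by induction along short exact sequences
   0 -> S/(I : f) (-deg f) -> S/I -> S/(I, f) -> 0, for which regularity of the
   sequence at the two ends passes to the middle.  For a C4 one takes f = f_db,
   whose colon ideal belongs to the graph without a and c (with the neighbourhood
   of b completed), and then, once the chord db is present, f = f_ac, whose colon
   ideal belongs to the graph without b and d; the last quotient replaces the C4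
   by a K4.  The same linear forms fit all these graphs because the removed
   vertices cut the path into intervals.  Chains of complete graphs are handled
   by peeling off vertices from the left with f = y_v after killing x_v. *)

(** A C4 counts 2 because of the degree of f_ac: in the step with the chord db present, the maximum
    of 2 + t' and t is attained by the colon side. Removing b and d leaves the values to the right
    unchanged: a following clique with at least 3 vertices loses b and still has an edge, worth 1,
    and a following C4 becomes a path with two edges, worth 1 + 1. This is where the bound 3 on the
    later cliques enters. In the step with f_db the quotient attains the maximum, so its colon side
    only has to be bounded. The 4-cycles are treated from left to right. Completing the
    neighbourhood of b keeps cliques and puts a chord into a following C4, so at most one chorded
    block occurs, directly after a part made of cliques and gaps. An ideal J' containing J with f J'
    inside J equals J : f once f is a nonzerodivisor modulo J'. This is tested modulo forms of the
    regular sequence, where f becomes, up to sign, a product of two variables. The definition of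
    regularity allows arbitrary graded resolutions, so for any given one the homology modulo T is
    followed while T grows from zero to the maximal ideal. *)

(* Membership in explicit sequences of polynomials by position; comparing the
   entries would be costly. *)
Section ExplicitMembership.
Variable T : eqType.
Implicit Types (x a b c d e : T) (s : seq T).

Lemma mem_at (k : nat) x s : onth s k = Some x -> x \in s.
Proof.
elim: s k => [|a s IH] [|k] //= h; rewrite inE; last by rewrite (IH k) ?orbT.
by case: h => ->; rewrite eqxx.
Qed.

Lemma mem_from (k : nat) x s : x \in iter k behead s -> x \in s.
Proof. by elim: k => //= k IH /mem_behead. Qed.

Lemma mem_cons5 x a b c d e s :
  x \in [:: a, b, c, d, e & s] -> x \in [:: a, b, c, d & s] \/ x = e.
Proof.
rewrite !inE; do 4![case/predU1P => [->|]; first by left; rewrite eqxx ?orbT].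
by case/predU1P => [->|->]; [right|left; rewrite !orbT].
Qed.

Lemma mem_cons6 x a b c d e y s :
  (x \in [:: y, a, b, c, d, e & s]) = (x \in [:: e, y, a, b, c, d & s]).
Proof.
by rewrite !inE; case: (x == e); rewrite ?orbT ?orbF.
Qed.

Lemma mem_k4 x a b c d e y s :
  (x \in [:: a, b, c, d, e, y & s]) = (x \in [:: b, a, d, y, c, e & s]).
Proof.
rewrite !inE; case: (x == a); rewrite ?orbT //=; case: (x == b) => //=.
by case: (x == c); rewrite ?orbT //=; case: (x == d) => //=; case: (x == y); rewrite ?orbT ?orbF.
Qed.

End ExplicitMembership.

(** * Ideals and regular sequences *)

Section Ideals.
Variable S : comNzRingType.
Implicit Types (s t ls : seq S) (p q a b f g l : S).

Fixpoint idl s p : Prop :=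
  if s is g :: s' then exists a, idl s' (p - a * g) else p = 0.

Lemma idl0 s : idl s 0.
Proof. by elim: s => //= g s IH; exists 0; rewrite mul0r subr0. Qed.

Lemma idlD s p q : idl s p -> idl s q -> idl s (p + q).
Proof.
elim: s p q => [|g s IH] p q /=; first by move=> -> ->; rewrite addr0.
move=> [a ha] [b hb]; exists (a + b).
suff -> : p + q - (a + b) * g = (p - a * g) + (q - b * g) by apply: IH.
by ring.
Qed.

Lemma idlM s a p : idl s p -> idl s (a * p).
Proof.
elim: s p => [|g s IH] p /=; first by move=> ->; rewrite mulr0.
move=> [b hb]; exists (a * b).
suff -> : a * p - a * b * g = a * (p - b * g) by apply: IH.
by ring.
Qed.

Lemma idlN s p : idl s p -> idl s (- p).
Proof. by move=> h; rewrite -mulN1r; apply: idlM. Qed.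

Lemma idlB s p q : idl s p -> idl s q -> idl s (p - q).
Proof. by move=> hp hq; apply: idlD => //; apply: idlN. Qed.

Lemma idl_consr s g p : idl s p -> idl (g :: s) p.
Proof. by move=> h; exists 0; rewrite mul0r subr0. Qed.

Lemma idl_mem s g : g \in s -> idl s g.
Proof.
elim: s => [//|h s IH]; rewrite inE => /orP [/eqP ->|/IH]; last exact: idl_consr.
by exists 1; rewrite mul1r subrr; apply: idl0.
Qed.

Lemma idl_least (P : S -> Prop) s p :
  P 0 -> (forall q r, P q -> P r -> P (q + r)) ->
  (forall a q, P q -> P (a * q)) -> (forall g, g \in s -> P g) ->
  idl s p -> P p.
Proof.
move=> P0 PD PM; elim: s p => [|g s IH] p hs /=; first by move=> ->.
move=> [a ha]; rewrite -(subrK (a * g) p); apply: PD.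
  by apply: IH ha => h hh; apply: hs; rewrite inE hh orbT.
by apply/PM/hs; rewrite mem_head.
Qed.

Lemma idl_sub s t p : (forall g, g \in s -> idl t g) -> idl s p -> idl t p.
Proof.
move=> h; apply: idl_least => //; [exact: idl0|by move=> *; apply: idlD|].
by move=> *; apply: idlM.
Qed.

Lemma idl_subseq s t p : {subset s <= t} -> idl s p -> idl t p.
Proof. by move=> h; apply: idl_sub => g /h; apply: idl_mem. Qed.

Lemma idl_consP s g p : idl (g :: s) p <-> exists a i, idl s i /\ p = a * g + i.
Proof.
split=> [[a ha]|[a [i [hi ->]]]].
  by exists a, (p - a * g); split=> //; ring.
by exists a; rewrite addrAC subrr add0r.
Qed.

Definition equi s t := forall p, idl s p <-> idl t p.

Lemma equi_gen s t : (forall g, g \in s -> idl t g) ->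
  (forall g, g \in t -> idl s g) -> equi s t.
Proof. by move=> h1 h2 p; split; apply: idl_sub. Qed.

Lemma equi_mem s t : s =i t -> equi s t.
Proof. by move=> h; apply: equi_gen => g; rewrite (h, =^~ h); apply: idl_mem. Qed.

Lemma equi_mid s t a b : equi (s ++ a :: b :: t) (a :: b :: s ++ t).
Proof.
apply: equi_mem => x; rewrite !(inE, mem_cat).
by case: (x \in s); case: (x == a); case: (x == b).
Qed.

Lemma equi_mid' r s t a b : equi (r ++ s ++ a :: b :: t) (b :: r ++ a :: s ++ t).
Proof.
apply: equi_mem => x; rewrite !(inE, mem_cat).
by case: (x \in r); case: (x \in s); case: (x == a); case: (x == b).
Qed.

Lemma equi_mid4 s t a b c d :
  equi (s ++ a :: b :: c :: d :: t) (d :: c :: a :: b :: s ++ t).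
Proof.
apply: equi_mem => x; rewrite !(inE, mem_cat).
by case: (x \in s); case: (x == a); case: (x == b); case: (x == c); case: (x == d).
Qed.

Lemma equi_swap s a b : equi (a :: b :: s) (b :: a :: s).
Proof. by apply: equi_mem => x; rewrite !inE orbCA. Qed.

Lemma equi_sym s t : equi s t -> equi t s.
Proof. by move=> h p; rewrite h. Qed.

Lemma equi_cons s t g : equi s t -> equi (g :: s) (g :: t).
Proof. by move=> h p /=; split=> -[a /h ha]; exists a. Qed.

Lemma equi_cong s l l' : idl s (l - l') -> equi (l :: s) (l' :: s).
Proof.
move=> h; apply: equi_gen => g; rewrite inE => /orP [/eqP ->|hg];
  try by apply/idl_consr/idl_mem.
- by exists 1; rewrite mul1r.
- by exists 1; rewrite mul1r -opprB; apply: idlN.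
Qed.

Definition nzd s l := forall p, idl s (l * p) -> idl s p.

(** Properness of the ideals is left out here; it is supplied by [top], which exhibits an element
    outside the final ideal. *)
Fixpoint regseq s ls : Prop :=
  if ls is l :: ls' then nzd s l /\ regseq (l :: s) ls' else True.

Lemma nzd_equi s t l : equi s t -> nzd s l -> nzd t l.
Proof. by move=> h hn p /h /hn /h. Qed.

Lemma regseq_equi s t ls : equi s t -> regseq s ls -> regseq t ls.
Proof.
elim: ls s t => [//|l ls IH] s t h /= [hn hr]; split; first exact: nzd_equi hn.
by apply: IH hr; apply: equi_cons.
Qed.

Lemma nzd_cong s l l' : idl s (l - l') -> nzd s l -> nzd s l'.
Proof.
move=> h hn p hp; apply: hn.
rewrite (_ : l * p = p * (l - l') + l' * p); last by ring.
by apply: idlD => //; apply: idlM.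
Qed.

Lemma nzdN s l : nzd s l -> nzd s (- l).
Proof. by move=> h p; rewrite mulNr => /idlN; rewrite opprK => /h. Qed.

Lemma equiN s l : equi (- l :: s) (l :: s).
Proof.
apply: equi_gen => g; rewrite inE => /orP [/eqP ->|hg];
  try by apply/idl_consr/idl_mem.
- by apply/idlN/idl_mem; rewrite mem_head.
- by rewrite -(opprK l); apply/idlN/idl_mem; rewrite opprK mem_head.
Qed.

Lemma regseq_cong s l l' ls :
  idl s (l - l') -> regseq s (l :: ls) -> regseq s (l' :: ls).
Proof.
move=> h [h1 h2]; split; first exact: nzd_cong h1.
by apply: regseq_equi h2; apply: equi_cong.
Qed.

Lemma regseq_congN s l l' ls :
  idl s (l + l') -> regseq s (l :: ls) -> regseq s (l' :: ls).
Proof.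
move=> h [h1 h2]; have h' : idl s (- l - l') by rewrite -opprD; apply: idlN.
apply: regseq_cong h' _; split; first exact: nzdN.
by apply: regseq_equi h2; apply/equi_sym/equiN.
Qed.

Lemma nzdM s a b : nzd s a -> nzd s b -> nzd s (a * b).
Proof. by move=> ha hb p; rewrite -mulrA => /ha /hb. Qed.

(** From a p = c b + i, regularity of b modulo a gives c = r a + j, and then a (p - r b) lies in the
    ideal of [s]. *)
Lemma nzd_swap s a b : nzd s a -> nzd (a :: s) b -> nzd (b :: s) a.
Proof.
move=> ha hb p /idl_consP [c [i [hi e]]].
have /hb /idl_consP [r [j [hj ec]]] : idl (a :: s) (b * c).
  by apply/idl_consP; exists p, (- i); split; [apply: idlN|rewrite (mulrC p) e; ring].
apply/idl_consP; exists r, (p - r * b); split; last by ring.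
apply: ha; rewrite (_ : a * _ = b * j + i).
  by apply: idlD => //; apply: idlM.
by rewrite mulrBr e ec; ring.
Qed.

Lemma regseq_cat s ls ks :
  regseq s (ls ++ ks) <-> regseq s ls /\ regseq (catrev ls s) ks.
Proof.
elim: ls s => [|l ls IH] s /=; first by split=> // -[].
by rewrite IH; split=> [[? []]|[[]]].
Qed.

Lemma equi_catrev s t ls : equi s t -> equi (catrev ls s) (catrev ls t).
Proof. by elim: ls s t => //= l ls IH s t h; apply/IH/equi_cons. Qed.

(* The two ends of 0 -> S/s' --f--> S/s -> S/(f, s) -> 0 share a regular
   sequence, hence so does the middle, and the sequence stays exact modulo it. *)
Lemma regseq_filt s s' f ls :
  (forall p, idl s (f * p) <-> idl s' p) ->
  regseq s' ls -> regseq (f :: s) ls ->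
  regseq s ls /\ forall p, idl (catrev ls s) (f * p) <-> idl (catrev ls s') p.
Proof.
elim: ls s s' => [//|l ls IH] s s' hc /= [hn' hr'] [hnf hrf].
have hn : nzd s l.
  move=> p hp; have /hnf /idl_consP [q [i [hi e]]] := idl_consr f hp.
  rewrite e; apply: idlD => //; rewrite mulrC; apply/hc/hn'/hc.
  rewrite (_ : f * (l * q) = l * p - l * i); last by rewrite e; ring.
  by apply: idlB => //; apply: idlM.
have hc' p : idl (l :: s) (f * p) <-> idl (l :: s') p.
  split=> [/idl_consP [q [i [hi e]]]|/idl_consP [q [i [hi e]]]]; last first.
    apply/idl_consP; exists (f * q), (f * i); split; first exact/hc.
    by rewrite e; ring.
  have /hnf /idl_consP [r [j [hj eq]]] : idl (f :: s) (l * q).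
    by apply/idl_consP; exists p, (- i); split; [apply: idlN|rewrite (mulrC p) e; ring].
  apply/idl_consP; exists r, (p - r * l); split; last by ring.
  apply/hc; rewrite mulrBr e eq (_ : _ - _ = l * j + i); last by ring.
  by apply: idlD => //; apply: idlM.
have hrf' : regseq (f :: l :: s) ls.
  apply: regseq_equi hrf; apply: equi_mem => x; rewrite !inE.
  by rewrite orbCA.
by have [h1 h2] := IH _ _ hc' hr' hrf'.
Qed.

(** Reduces the computation of a colon ideal to inclusions between generators and one nonzerodivisor
    test modulo the candidate. *)
Lemma idl_colon s s' f : (forall g, g \in s' -> idl s (f * g)) ->
  (forall g, g \in s -> idl s' g) -> nzd s' f ->
  forall p, idl s (f * p) <-> idl s' p.
Proof.
move=> h1 h2 h3 p; split=> [h|]; first by apply: h3; apply: idl_sub h.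
elim/idl_least => [|a b|a b|//]; first by rewrite mulr0; apply: idl0.
  by rewrite mulrDr; apply: idlD.
by rewrite mulrCA; apply: idlM.
Qed.

End Ideals.

(** * Homogeneous regular sequences *)

Section Homogeneous.
Variables (K : fieldType) (n : nat).
Notation S := {mpoly K[n]}.
Implicit Types (s t ls : seq S) (p q a b f g l : S) (d e : int).

(* Homogeneous components are indexed by [int], as are the degrees of the free
   modules in a resolution; those of negative degree are zero. *)
Definition hcomp d p : S := if d is Posz k then pihomog mdeg k p else 0.

Lemma hcomp_linear d : linear (hcomp d).
Proof. by case: d => k c p q /=; rewrite ?scaler0 ?addr0 // linearP. Qed.
HB.instance Definition _ d := GRing.isLinear.Build K S S _ (hcomp d) (hcomp_linear d).

Lemma hcompX d (m : 'X_{1..n}) :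
  hcomp d 'X_[m] = if (mdeg m)%:Z == d then 'X_[m] else 0.
Proof. by case: d => k //=; rewrite pihomogX eqz_nat. Qed.

Lemma homog_degX (m : 'X_{1..n}) : homog_deg ('X_[m] : S) (mdeg m)%:Z.
Proof. by move=> m'; rewrite msuppX inE => /eqP ->. Qed.

Lemma homog_deg0 d : homog_deg (0 : S) d.
Proof. by move=> m; rewrite msupp0. Qed.

Lemma homog_degC (c : K) : homog_deg (c%:MP : S) 0.
Proof.
by move=> m; rewrite msuppC; case: eqP => // _; rewrite inE => /eqP ->; rewrite mdeg0.
Qed.

Lemma homog_degZ (c : K) d p : homog_deg p d -> homog_deg (c *: p) d.
Proof. by move=> h m /msuppZ_le /h. Qed.

Lemma homog_degD d p q : homog_deg p d -> homog_deg q d -> homog_deg (p + q) d.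
Proof. by move=> hp hq m /msuppD_le; rewrite mem_cat => /orP [/hp|/hq]. Qed.

Lemma homog_degN d p : homog_deg p d -> homog_deg (- p) d.
Proof. by rewrite -scaleN1r; apply: homog_degZ. Qed.

Lemma homog_degB d p q : homog_deg p d -> homog_deg q d -> homog_deg (p - q) d.
Proof. by move=> hp /homog_degN; apply: homog_degD. Qed.

Lemma homog_deg_sum (I : Type) (r : seq I) (P : pred I) (F : I -> S) d :
  (forall i, P i -> homog_deg (F i) d) -> homog_deg (\sum_(i <- r | P i) F i) d.
Proof.
move=> h; elim/big_ind: _ => //; [exact: homog_deg0|exact: homog_degD].
Qed.

Lemma homog_degM d e p q :
  homog_deg p d -> homog_deg q e -> homog_deg (p * q) (d + e).
Proof.
move=> hp hq m /msuppM_le /allpairsP [[m1 m2] /= [/hp <- /hq <- ->]].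
by rewrite mdegD PoszD.
Qed.

Lemma hcomp_homog d p : homog_deg (hcomp d p) d.
Proof.
case: d => k /=; last exact: homog_deg0.
by have /dhomogP h := pihomogP mdeg k p; move=> m /h ->.
Qed.

Lemma hcomp_id d p : homog_deg p d -> hcomp d p = p.
Proof.
case: d => k h /=.
  by apply: pihomog_dE; apply/dhomogP => m /h [].
apply/esym/eqP; rewrite -msupp_eq0; case E: (msupp p) => [//|m r].
by have := h m; rewrite E mem_head => /(_ isT).
Qed.

Lemma hcomp_neq0 d e p : homog_deg p d -> d != e -> hcomp e p = 0.
Proof.
case: d => k; last by move=> /hcomp_id <- _; rewrite linear0.
case: e => j //= h ne; apply: pihomog_ne0 ne _.
by apply/dhomogP => m /h [].
Qed.

Lemma homog_deg_neg k p : homog_deg p (Negz k) -> p = 0.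
Proof. by move/hcomp_id. Qed.

(** Holds for every integer d: for d < e both sides vanish, so later degree shifts need no case
    distinction. *)
Lemma hcompM d e f q : homog_deg f e -> hcomp d (f * q) = f * hcomp (d - e) q.
Proof.
move=> hf; elim/mpolyind: q => [|c m q _ _ IH]; first by rewrite !(mulr0, linear0).
rewrite mulrDr !linearD /= IH mulrDr -scalerAr !linearZ /= hcompX -scalerAr; congr (_ *: _ + _).
have h : homog_deg (f * 'X_[m]) (e + (mdeg m)%:Z) by apply: homog_degM => //; apply: homog_degX.
case: eqP => [E|/eqP NE].
  by apply: hcomp_id; rewrite (_ : d = e + (mdeg m)%:Z) // E; ring.
rewrite mulr0; apply: hcomp_neq0 h _; apply: contra NE => /eqP <-.
by rewrite addrC addrA addNr add0r.
Qed.

Lemma hcomp_sum p : exists k : nat, p = \sum_(d < k) hcomp d%:Z p.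
Proof. by exists (msize p); rewrite -pihomog_partitionE. Qed.

Arguments hcomp : simpl never.

Definition hseq s := forall g, g \in s -> exists d, homog_deg g d.

Lemma hseq_cons g s d : homog_deg g d -> hseq s -> hseq (g :: s).
Proof. by move=> hg hs h; rewrite inE => /orP [/eqP ->|/hs //]; exists d. Qed.

Lemma hseq_behead g s : hseq (g :: s) -> hseq s.
Proof. by move=> h x hx; apply: h; rewrite inE hx orbT. Qed.

Lemma hseq_catrev s t : hseq s -> hseq t -> hseq (catrev s t).
Proof. by move=> hs ht g; rewrite catrevE mem_cat mem_rev => /orP [/hs|/ht]. Qed.

Lemma idl_hcomp s d p : hseq s -> idl s p -> idl s (hcomp d p).
Proof.
elim: s p => [|g s IH] p hs /=; first by move=> ->; rewrite linear0.
move=> [a ha]; have [e he] := hs g (mem_head _ _).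
exists (hcomp (d - e) a); rewrite mulrC -(hcompM _ _ he) -linearB /= mulrC.
by apply: IH ha; apply: hseq_behead hs.
Qed.

Lemma idl_homog_cons s l d e p : hseq s -> homog_deg l e -> homog_deg p d ->
  idl (l :: s) p -> exists a i, [/\ homog_deg a (d - e), idl s i & p = a * l + i].
Proof.
move=> hs hl hp /idl_consP [a [i [hi E]]].
exists (hcomp (d - e) a), (hcomp d i); split; [exact: hcomp_homog|exact: idl_hcomp|].
by rewrite -{1}(hcomp_id hp) E linearD /= (mulrC a) (hcompM _ _ hl) mulrC.
Qed.

Lemma nzd_homog s f e : hseq s -> homog_deg f e ->
  (forall d p, homog_deg p d -> idl s (f * p) -> idl s p) -> nzd s f.
Proof.
move=> hs hf h p hp; have [k ->] := hcomp_sum p.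
elim/big_ind: _ => [|*|d _]; [exact: idl0|exact: idlD|].
apply: h (@hcomp_homog _ _) _.
by have := idl_hcomp (d%:Z + e) hs hp; rewrite (hcompM _ _ hf) addrK.
Qed.

(* Graded Nakayama; this is what makes homogeneous regular sequences
   permutable. *)
Lemma nzd_mod s l f e : hseq s -> homog_deg l 1 -> nzd s l ->
  homog_deg f e -> nzd (l :: s) f -> nzd s f.
Proof.
move=> hs hl nl hf nf; apply: (nzd_homog hs hf) => d.
(* Induction on the degree: p = a l + i with a of degree one less, and f a lies in the ideal again
   because l is a nonzerodivisor. *)
suff H (k : nat) : forall d p, d < k%:Z -> homog_deg p d -> idl s (f * p) -> idl s p.
  by move=> p hp hfp; apply: (H (absz (d + 1)) _ _ _ hp hfp); lia.
elim: k {d} => [|k IH] d p hd hp hfp.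
  by case: d hd hp => // j _ /homog_deg_neg ->; apply: idl0.
have [a [i [ha hi E]]] := idl_homog_cons hs hl hp (nf _ (idl_consr _ hfp)).
rewrite E; apply: idlD => //; rewrite mulrC; apply: idlM.
apply: (IH (d - 1)) => //; first lia.
apply: nl; rewrite (_ : l * (f * a) = f * p - f * i); last by rewrite E; ring.
by apply: idlB => //; apply: idlM.
Qed.

Lemma nzd_regseq s ls f e : hseq s -> (forall l, l \in ls -> homog_deg l 1) ->
  regseq s ls -> homog_deg f e -> nzd (catrev ls s) f -> nzd s f.
Proof.
elim: ls s => [//|l ls IH] s hs hl /= [h1 h2] hf hn.
have hl1 : homog_deg l 1 by apply: hl; rewrite mem_head.
apply: (nzd_mod hs hl1 h1 hf); apply: IH hn => //; first exact: hseq_cons hl1 hs.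
by move=> x hx; apply: hl; rewrite inE hx orbT.
Qed.

Definition top s (t : nat) : Prop :=
  (forall d p, t%:Z < d -> homog_deg p d -> idl s p) /\
  exists2 p, homog_deg p t%:Z & ~ idl s p.

Definition good s ls (t : nat) := regseq s ls /\ top (catrev ls s) t.

Lemma top_equi s s' (t : nat) : equi s s' -> top s t -> top s' t.
Proof.
move=> h [h1 [p hp h2]]; split=> [d q hd hq|]; first exact/h/h1/hq.
by exists p => // /h.
Qed.

Lemma good_equi s s' ls (t : nat) : equi s s' -> good s ls t -> good s' ls t.
Proof.
move=> h [h1 h2]; split; first exact: regseq_equi h1.
by apply: top_equi h2; apply: equi_catrev.
Qed.

Lemma good_cong s l l' ls (t : nat) :
  idl s (l - l') -> good s (l :: ls) t -> good s (l' :: ls) t.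
Proof.
move=> h [h1 h2]; split; first exact: regseq_cong h1.
by apply: top_equi h2; apply: (@equi_catrev _ (l :: s) (l' :: s)); apply: equi_cong.
Qed.

Lemma good_congN s l l' ls (t : nat) :
  idl s (l + l') -> good s (l :: ls) t -> good s (l' :: ls) t.
Proof.
move=> h [h1 h2]; split; first exact: regseq_congN h1.
apply: top_equi h2; apply: (@equi_catrev _ (l :: s) (l' :: s)) => p.
have h' : idl s (- l - l') by rewrite -opprD; apply: idlN.
by rewrite -(equiN s l) (equi_cong h').
Qed.

Lemma good_cons s l ls (t : nat) : nzd s l -> good (l :: s) ls t -> good s (l :: ls) t.
Proof. by move=> h [h1 h2]; split. Qed.

(** Modulo [ls] the sequence 0 -> S/s' (-k) -> S/s -> S/(f, s) -> 0 stays exact, so the top degree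
    of the middle is the larger of those of the ends, the left one shifted by k. The witness is a
    lift from the right end or f times one from the left. *)
Lemma good_filt s s' f (k : nat) ls (t t' : nat) :
  hseq s -> (forall l, l \in ls -> homog_deg l 1) ->
  homog_deg f k%:Z -> (forall p, idl s (f * p) <-> idl s' p) ->
  good s' ls t' -> good (f :: s) ls t -> good s ls (maxn (k + t') t).
Proof.
move=> hs hl hf hc [r1 [u1 [p1 h1 n1]]] [r2 [u2 [p2 h2 n2]]].
have [r hc'] := regseq_filt hc r1 r2; split=> //.
have E : equi (catrev ls (f :: s)) (f :: catrev ls s).
  by apply: equi_mem => x; rewrite !catrevE inE !mem_cat inE orbCA.
have hs' : hseq (catrev ls s) by apply: hseq_catrev => // l /hl ?; exists 1.
split=> [d p hd hp|].
  have /E h := u2 d p ltac:(lia) hp.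
  have [a [i [ha hi ->]]] := idl_homog_cons hs' hf hp h.
  apply: idlD => //; rewrite mulrC; apply/hc'/(u1 (d - k%:Z)) => //; lia.
case: (leqP (k + t') t) => hm.
  by exists p2 => // h; apply/n2/E/idl_consr.
by exists (f * p1); [rewrite PoszD; apply: homog_degM|move/hc'].
Qed.

End Homogeneous.

Arguments hcomp {K n} d p : simpl never.

(** * Substitutions, and variables as nonzerodivisors *)

Section Substitutions.
Variables (K : fieldType) (N : nat).
Notation S := {mpoly K[N]}.
Implicit Types (s : seq S) (p q l g : S) (h : 'I_N -> S) (k : 'I_N).

Definition subst h p : S := p \mPo [tuple h i | i < N].
HB.instance Definition _ h := GRing.RMorphism.copy (subst h) (comp_mpoly [tuple h i | i < N]).

Lemma substZ h c p : subst h (c *: p) = c *: subst h p.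
Proof. exact: comp_mpolyZ. Qed.

Lemma substX h k : subst h 'X_k = h k.
Proof. by rewrite /subst comp_mpolyXU -tnth_nth tnth_mktuple. Qed.

Lemma subst_cong s h : (forall k, idl s ('X_k - h k)) ->
  forall p, idl s (p - subst h p).
Proof.
move=> hs p; elim/mpolyind: p => [|c m q _ _ IH].
  by rewrite rmorph0 subrr; apply: idl0.
rewrite rmorphD /= substZ.
rewrite (_ : _ - _ = c%:MP * ('X_[m] - subst h 'X_[m]) + (q - subst h q)); last first.
  by rewrite -!mul_mpolyC; ring.
apply: idlD => //; apply: idlM; rewrite mpolyXE_id rmorph_prod /=.
have hM a a' b b' : idl s (a - a') -> idl s (b - b') -> idl s (a * b - a' * b').
  move=> h1 h2; rewrite (_ : _ - _ = a * (b - b') + b' * (a - a')); last by ring.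
  by apply: idlD; apply: idlM.
elim/big_ind2: _ => [|*|k _]; [by rewrite subrr; apply: idl0|exact: hM|].
rewrite rmorphXn /= substX; elim: (m k) => [|j IHj]; first by rewrite !expr0 subrr; apply: idl0.
by rewrite !exprS; apply: hM.
Qed.

(* [l p] in the ideal is a combination of the generators; subtracting its image
   under a substitution that kills l and fixes the generators leaves l times
   such a combination. *)
Lemma nzd_subst s h l : l != 0 -> subst h l = 0 ->
  (forall g, g \in s -> subst h g = g) ->
  (forall k, idl [:: l] ('X_k - h k)) -> nzd s l.
Proof.
move=> l0 hl hs hX p hp.
have hd q : exists a, q - subst h q = a * l.
  by have [a /= /eqP] := subst_cong hX q; rewrite subr_eq0 => /eqP; exists a.
have [] : idl s (subst h (l * p)) /\ exists2 q, l * p - subst h (l * p) = q * l & idl s q.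
  elim/idl_least: hp => [|q r [h1 [a ha a1]] [h2 [b hb b1]]|a q [h1 [b hb b1]]|g hg].
  - by rewrite rmorph0; split; [apply: idl0|exists 0; [ring|apply: idl0]].
  - rewrite rmorphD; split; first exact: idlD.
    by exists (a + b); [rewrite mulrDl -ha -hb; ring|apply: idlD].
  - have [c hc] := hd a; rewrite rmorphM; split; first exact: idlM.
    exists (c * q + subst h a * b); last first.
      apply: idlD; apply: idlM => //.
      rewrite -(subrK (subst h q) q) hb; apply: idlD => //.
      by rewrite mulrC; apply: idlM.
    by rewrite mulrDl -mulrA [q * l]mulrC mulrA -hc -mulrA -hb; ring.
  - rewrite hs // subrr; split; first exact: idl_mem.
    by exists 0; [ring|apply: idl0].
rewrite rmorphM /= hl mul0r subr0 => _ [q]; rewrite mulrC => /(mulIf l0) ->.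
by [].
Qed.

Definition kill k : 'I_N -> S := fun j => if j == k then 0 else 'X_j.

Lemma mpolyXU_neq0 k : 'X_k != 0 :> S.
Proof. by rewrite -msupp_eq0 msuppX. Qed.

Lemma nzd_var s k : (forall g, g \in s -> subst (kill k) g = g) -> nzd s 'X_k.
Proof.
move=> hs; apply: (@nzd_subst s (kill k)) => // [| |j]; first exact: mpolyXU_neq0.
  by rewrite substX /kill eqxx.
rewrite /kill; case: eqP => [->|_].
  by rewrite subr0; apply: idl_mem; rewrite mem_head.
by rewrite subrr; apply: idl0.
Qed.

Lemma idl_max s p : (forall k, idl s 'X_k) -> p@_0%MM = 0 -> idl s p.
Proof.
move=> hs h0; rewrite [p]mpolyE big_seq; elim/big_ind: _ => [|*|m hm]; [exact: idl0|exact: idlD|].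
have : m != 0%MM by apply: contraTneq hm => ->; rewrite mcoeff_msupp h0 eqxx.
rewrite -mdeg_eq0 mdegE sum_nat_eq0 => /forallPn [k]; rewrite implyTb -lt0n => hk.
have -> : m = (U_(k) + (m - U_(k)))%MM.
  by rewrite addmC submK //; rewrite lep1mP -lt0n.
by rewrite mpolyXD mulrC -mul_mpolyC mulrA; apply: idlM.
Qed.

Lemma idl_const s p : (forall g, g \in s -> g@_0%MM = 0) -> idl s p -> p@_0%MM = 0.
Proof.
move=> hs; elim/idl_least => //; first exact: mcoeff0.
  by move=> q r; rewrite mcoeffD => -> ->; rewrite addr0.
by move=> a q h; rewrite rmorphM /= h mulr0.
Qed.

Lemma homog_deg_const p d : d != 0 -> homog_deg p d -> p@_0%MM = 0.
Proof.
move=> hd hp; apply: memN_msupp_eq0; apply: contra hd => /hp <-.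
by rewrite mdeg0.
Qed.

End Substitutions.

(** * Chains of complete graphs and 4-cycles *)

(* A word describes a graph on consecutive vertices p, p+1, ... with some
   vertices removed, read from left to right:
   - the empty word is a single vertex;
   - [LN]: p is joined to p+1 only, by an edge forming a new clique;
   - [LE]: p joins the clique through p+1 that starts the rest of the word;
   - [LI]: p has no neighbour on its right, p+1 is removed, the rest starts at p+2;
   - [LC]: the 4-cycle p, p+1, p+2, p+3, and the rest starts at p+3;
   - [LD]: the same with the chord {p+1, p+3}.
   So K_m is LE^(m-2) LN. *)
Inductive letter := LN | LE | LI | LC | LD.

Definition lsize a : nat :=
  match a with LN => 1 | LE => 1 | LI => 2 | LC => 3 | LD => 3 end.

Fixpoint wsize (w : seq letter) : nat :=
  if w is a :: w' then lsize a + wsize w' else 0.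

(** Any letter other than [LN] and [LE], or the end of the word, closes the clique at p. Hence
    replacing the final [LN] of a clique by [LI] deletes its last vertex. *)
Fixpoint cl (p : nat) (w : seq letter) : seq nat :=
  match w with
  | LN :: _ => [:: p; p.+1]
  | LE :: w' => p :: cl p.+1 w'
  | _ => [:: p]
  end.

Lemma wsize_cat u w : wsize (u ++ w) = (wsize u + wsize w)%N.
Proof. by elim: u => //= a u ->; rewrite addnA. Qed.

Lemma mem_cl p w : p \in cl p w.
Proof. by case: w => [|[]] *; rewrite /= ?inE eqxx. Qed.

Lemma cl_bounds p w j : j \in cl p w -> (p <= j <= p + wsize w)%N.
Proof.
elim: w p => [|a w IH] p /=; first by rewrite inE => /eqP ->; lia.
by case: a => /=; rewrite ?inE => H; (case/orP: H => [/eqP ->|/IH]; lia) ||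
  (case/orP: H => /eqP ->; lia) || (move/eqP: H => ->; lia).
Qed.

Section Words.
Variables (K : fieldType) (N n : nat) (xi yi : nat -> 'I_N).
Notation S := {mpoly K[N]}.
Hypothesis xi_inj : forall i j, (i < n)%N -> (j < n)%N -> xi i = xi j -> i = j.
Hypothesis yi_inj : forall i j, (i < n)%N -> (j < n)%N -> yi i = yi j -> i = j.
Hypothesis xi_yi : forall i j, (i < n)%N -> (j < n)%N -> xi i <> yi j.
Hypothesis xi_yi_full : forall k, exists2 i, (i < n)%N & k = xi i \/ k = yi i.
Implicit Types (s : seq S) (p i j : nat) (w : seq letter).

Definition X i : S := 'X_(xi i).
Definition Y i : S := 'X_(yi i).
Definition fm i j : S := X i * Y j - X j * Y i.

Fixpoint gens p w : seq S :=
  match w with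
  | [::] => [::]
  | LN :: w' => fm p p.+1 :: gens p.+1 w'
  | LE :: w' => [seq fm p j | j <- cl p.+1 w'] ++ gens p.+1 w'
  | LI :: w' => X p.+1 :: Y p.+1 :: gens p.+2 w'
  | LC :: w' => [:: fm p p.+1; fm p.+1 p.+2; fm p.+2 p.+3; fm p p.+3] ++ gens p.+3 w'
  | LD :: w' => [:: fm p p.+1; fm p.+1 p.+2; fm p.+2 p.+3; fm p p.+3; fm p.+1 p.+3]
                ++ gens p.+3 w'
  end.

(* [ls p k] is the regular sequence X_p, X_{p+1} - Y_p, ..., Y_{p+k} attached to
   k + 1 vertices; [kl p] kills the vertices before p. *)
Fixpoint lt p k : seq S :=
  if k is k'.+1 then (X p.+1 - Y p) :: lt p.+1 k' else [:: Y p].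

Definition ls p k := X p :: lt p k.

Fixpoint kl p : seq S := if p is p'.+1 then X p' :: Y p' :: kl p' else [::].

Lemma homogX i : homog_deg (X i) 1.
Proof. by have := @homog_degX K N U_(xi i)%MM; rewrite mdeg1. Qed.

Lemma homogY i : homog_deg (Y i) 1.
Proof. by have := @homog_degX K N U_(yi i)%MM; rewrite mdeg1. Qed.

Lemma homog_fm i j : homog_deg (fm i j) 2.
Proof.
have h : homog_deg (fm i j) (1 + 1).
  exact: homog_degB (homog_degM (@homogX i) (@homogY j)) (homog_degM (@homogX j) (@homogY i)).
exact: h.
Qed.

Lemma homog_lt p k l : l \in lt p k -> homog_deg l 1.
Proof.
elim: k p => [|k IH] p /=; rewrite inE; first by move/eqP ->; apply: homogY.
case/orP => [/eqP ->|/IH //].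
by apply: homog_degB; [apply: homogX|apply: homogY].
Qed.

Lemma homog_ls p k l : l \in ls p k -> homog_deg l 1.
Proof. by rewrite inE => /orP [/eqP ->|/homog_lt //]; apply: homogX. Qed.

Lemma hseq_cat s s' : hseq s -> hseq s' -> hseq (s ++ s').
Proof. by move=> h h' g; rewrite mem_cat => /orP [/h|/h']. Qed.

Lemma hseq_fm (r : seq nat) i : hseq [seq fm i j | j <- r].
Proof. by move=> g /mapP [j _ ->]; exists 2; apply: homog_fm. Qed.

Lemma hseq_gens p w : hseq (gens p w).
Proof.
have h2 i j s : hseq s -> hseq (fm i j :: s) by apply: hseq_cons; apply: homog_fm.
elim: w p => [|[] w IH] p; first by []; cbn [gens cat].
- exact/h2/IH.
- by apply: hseq_cat; [apply: hseq_fm|apply: IH].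
- apply: (hseq_cons (@homogX _)); apply: (hseq_cons (@homogY _)); exact: IH.
- by do 4!apply: (h2); apply: IH.
- by do 5!apply: (h2); apply: IH.
Qed.

Lemma hseq_kl p : hseq (kl p).
Proof.
elim: p => [|p IH] //=.
by apply: (hseq_cons (@homogX _)); apply: (hseq_cons (@homogY _)).
Qed.

Lemma fm_anti i j : fm j i = - fm i j.
Proof. by rewrite /fm; ring. Qed.

Lemma fmXX s i j : idl s (X i) -> idl s (X j) -> idl s (fm i j).
Proof. by move=> hi hj; rewrite /fm ![X _ * _]mulrC; apply: idlB; apply: idlM. Qed.

Lemma fm_killl s i j : idl s (X i) -> idl s (Y i) -> idl s (fm i j).
Proof. by move=> hi hj; rewrite /fm [X i * _]mulrC; apply: idlB; apply: idlM. Qed.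

Lemma fm_killr s i j : idl s (X i) -> idl s (Y i) -> idl s (fm j i).
Proof. by move=> hi hj; rewrite fm_anti; apply/idlN/fm_killl. Qed.

Lemma gens_cl p w i j : i \in cl p w -> j \in cl p w -> idl (gens p w) (fm i j).
Proof.
have h0 s k : idl s (fm k k) by rewrite /fm subrr; apply: idl0.
elim: w p i j => [|a w IH] p i j; first by rewrite !inE => /eqP -> /eqP ->.
case: a; cbn [cl gens]; rewrite ?inE; try by move=> /eqP -> /eqP ->; apply: h0.
- have h : idl (fm p p.+1 :: gens p.+1 w) (fm p p.+1) by apply: idl_mem; rewrite mem_head.
  move=> /orP [] /eqP -> /orP [] /eqP ->; try exact: h0; first exact: h.
  by rewrite (fm_anti p); apply: idlN.
- have h k : k \in cl p.+1 w -> idl ([seq fm p j | j <- cl p.+1 w] ++ gens p.+1 w) (fm p k).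
    by move=> hk; apply: idl_mem; rewrite mem_cat map_f.
  move=> /orP [/eqP ->|hi] /orP [/eqP ->|hj]; [exact: h0|exact: h| |].
    by rewrite (fm_anti p); apply/idlN/h.
  by apply: idl_subseq (IH _ _ _ hi hj) => g; rewrite mem_cat orbC => ->.
Qed.

Lemma subst_fm h i j : subst h (X i) = X i -> subst h (Y i) = Y i ->
  subst h (X j) = X j -> subst h (Y j) = Y j -> subst h (fm i j) = fm i j.
Proof. by move=> h1 h2 h3 h4; rewrite /fm rmorphB !rmorphM /= h1 h2 h3 h4. Qed.

Lemma subst_gens h p w :
  (forall i, (p <= i <= p + wsize w)%N -> subst h (X i) = X i /\ subst h (Y i) = Y i) ->
  forall g, g \in gens p w -> subst h g = g.
Proof.
elim: w p => [//|a w IH] p hp.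
have fmh i j : (p <= i <= p + wsize (a :: w))%N -> (p <= j <= p + wsize (a :: w))%N ->
    subst h (fm i j) = fm i j.
  by move=> /hp [? ?] /hp [? ?]; apply: subst_fm.
case: a hp fmh => /= hp fmh g; rewrite ?mem_cat ?inE -?orbA.
- case/orP => [/eqP ->|]; first by apply: fmh; lia.
  by apply: IH => i hi; apply: hp; lia.
- case/orP => [/mapP [j /cl_bounds hj ->]|]; first by apply: fmh; lia.
  by apply: IH => i hi; apply: hp; lia.
- case/or3P => [/eqP ->|/eqP ->|]; first by case: (hp p.+1 ltac:(lia)).
    by case: (hp p.+1 ltac:(lia)).
  by apply: IH => i hi; apply: hp; lia.
- do 4![case/orP => [/eqP ->|]; first by apply: fmh; lia].
  by apply: IH => i hi; apply: hp; lia.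
- do 5![case/orP => [/eqP ->|]; first by apply: fmh; lia].
  by apply: IH => i hi; apply: hp; lia.
Qed.

Lemma mem_kl p g : g \in kl p -> exists2 i, (i < p)%N & g = X i \/ g = Y i.
Proof.
elim: p => [//|p IH] /=; rewrite !inE => /or3P [/eqP ->|/eqP ->|/IH [i hi hg]].
- by exists p; [|left].
- by exists p; [|right].
- by exists i => //; lia.
Qed.

Lemma kl_mem p i : (i < p)%N -> (X i \in kl p) && (Y i \in kl p).
Proof.
elim: p => [//|p IH]; rewrite ltnS leq_eqVlt => /orP [/eqP ->|/IH /andP [h1 h2]] /=.
  by rewrite !inE !eqxx !orbT.
by rewrite !inE h1 h2 !orbT.
Qed.

Lemma killxX i j : (i < n)%N -> (j < n)%N -> i != j -> subst (kill K (xi i)) (X j) = X j.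
Proof.
by move=> hi hj /eqP ne; rewrite substX /kill; case: eqP => // /xi_inj e; case: ne; rewrite e.
Qed.

Lemma killyY i j : (i < n)%N -> (j < n)%N -> i != j -> subst (kill K (yi i)) (Y j) = Y j.
Proof.
by move=> hi hj /eqP ne; rewrite substX /kill; case: eqP => // /yi_inj e; case: ne; rewrite e.
Qed.

Lemma killxY i j : (i < n)%N -> (j < n)%N -> subst (kill K (xi i)) (Y j) = Y j.
Proof.
by move=> hi hj; rewrite substX /kill; case: eqP => // e; case: (xi_yi hi hj).
Qed.

Lemma killyX i j : (i < n)%N -> (j < n)%N -> subst (kill K (yi i)) (X j) = X j.
Proof.
by move=> hi hj; rewrite substX /kill; case: eqP => // e; case: (xi_yi hj hi).
Qed.

(* The pairs (sum_j c_j X_j, sum_j c_j Y_j), j in r. *)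
Fixpoint combs (r : seq nat) (a b : S) : Prop :=
  if r is j :: r' then exists c, combs r' (a - c * X j) (b - c * Y j)
  else a = 0 /\ b = 0.

(** The coefficients of the edges at v enter only through the two sums a and b, which is what allows
    them to be changed in [nzd_join]. *)
Lemma idl_fm_cat s r v q :
  idl ([seq fm v j | j <- r] ++ s) q <->
  exists a b, combs r a b /\ idl s (q - (X v * b - Y v * a)).
Proof.
elim: r q => [|j r IH] q /=.
  split=> [h|[a [b [[-> ->]]]]]; last by rewrite !mulr0 !subr0.
  by exists 0, 0; rewrite !mulr0 !subr0.
split=> [[c /IH [a [b [hab h]]]]|[a [b [[c hab] h]]]].
  exists (a + c * X j), (b + c * Y j); split.
    by exists c; rewrite !addrK.
  by congr idl: h; rewrite /fm; ring.
exists c; apply/IH; exists (a - c * X j), (b - c * Y j); split=> //.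
by congr idl: h; rewrite /fm; ring.
Qed.

Lemma combs_subst h r a b : (forall j, j \in r -> subst h (X j) = X j /\ subst h (Y j) = Y j) ->
  combs r a b -> combs r (subst h a) (subst h b).
Proof.
elim: r a b => [|j r IH] a b hr /=; first by move=> [-> ->]; rewrite rmorph0.
move=> [c hc]; exists (subst h c); have [e1 e2] := hr j (mem_head _ _).
rewrite -{1}e1 -{1}e2 -!rmorphM -!rmorphB; apply: IH hc => i hi.
by apply: hr; rewrite inE hi orbT.
Qed.

Lemma combs_subst_sub h r a b l :
  (forall j, j \in r -> subst h (X j) = X j /\ subst h (Y j) = Y j) ->
  (forall q, exists c, q - subst h q = c * l) ->
  combs r a b -> exists a' b', [/\ combs r a' b', a - subst h a = a' * l & b - subst h b = b' * l].
Proof.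
move=> hr hl; elim: r a b hr => [|j r IH] a b hr /=.
  by move=> [-> ->]; exists 0, 0; rewrite rmorph0 subrr mul0r.
move=> [c hc]; have [d hd] := hl c; have [e1 e2] := hr j (mem_head _ _).
have [|a' [b' [h1 h2 h3]]] := IH _ _ _ hc.
  by move=> i hi; apply: hr; rewrite inE hi orbT.
exists (a' + d * X j), (b' + d * Y j); split.
- by exists d; rewrite !addrK.
- move: h2; rewrite rmorphB rmorphM /= e1 mulrDl => <-.
  by rewrite mulrAC -hd; ring.
- move: h3; rewrite rmorphB rmorphM /= e2 mulrDl => <-.
  by rewrite mulrAC -hd; ring.
Qed.

Lemma combs_fm s r u a b : (forall j, j \in r -> idl s (fm u j)) ->
  combs r a b -> idl s (X u * b - Y u * a).
Proof.
elim: r a b => [|j r IH] a b hr /=; first by move=> [-> ->]; rewrite !mulr0 subrr; apply: idl0.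
move=> [c hc]; have := IH _ _ _ hc.
rewrite (_ : X u * b - Y u * a =
  (X u * (b - c * Y j) - Y u * (a - c * X j)) + c * fm u j); last by rewrite /fm; ring.
move=> h; apply: idlD.
  by apply: h => i hi; apply: hr; rewrite inE hi orbT.
by apply: idlM; apply: hr; rewrite mem_head.
Qed.

(* Joining a new vertex v to a clique r of a graph: the variable X_v is a
   nonzerodivisor. If X_v p = X_v b - Y_v a with (a, b) = sum_j c_j (X_j, Y_j),
   setting X_v = 0 gives sum_j c_j X_j = 0 at X_v = 0, so also
   sum_j c_j Y_j = 0 there because X_u Y_j = X_j Y_u; hence one may replace c_j
   by (c_j - c_j(X_v = 0)) / X_v. *)
Lemma nzd_join s r v u : (v < n)%N ->
  (forall g, g \in s -> subst (kill K (xi v)) g = g) ->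
  (forall g, g \in s -> subst (kill K (yi v)) g = g) ->
  (forall j, j \in r -> (j < n)%N /\ j != v) ->
  (forall j, j \in r -> idl s (fm u j)) -> nzd s (X u) ->
  nzd ([seq fm v j | j <- r] ++ s) (X v).
Proof.
move=> hv hx hy hr hf hu p /idl_fm_cat [a [b [hab h]]].
pose sg := subst (kill K (xi v)).
have hl q : exists c, q - sg q = c * X v.
  have hX k : idl [:: X v] ('X_k - kill K (xi v) k).
    rewrite /kill; case: eqP => [->|_]; last by rewrite subrr; apply: idl0.
    by rewrite subr0; apply: idl_mem; rewrite mem_head.
  by have [c /= /eqP] := subst_cong hX q; rewrite subr_eq0 => /eqP; exists c.
have hr' j : j \in r -> sg (X j) = X j /\ sg (Y j) = Y j.
  move=> /hr [h1 h2]; split; first by apply: killxX => //; rewrite eq_sym.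
  exact: killxY.
have sgI q : idl s q -> idl s (sg q).
  elim/idl_least => [|q1 q2|c q1|g hg]; first by rewrite /sg rmorph0; apply: idl0.
  - by rewrite /sg rmorphD; apply: idlD.
  - by rewrite /sg rmorphM; apply: idlM.
  - by rewrite /sg hx //; apply: idl_mem.
have ny : nzd s (Y v) by apply: nzd_var.
have nx : nzd s (X v) by apply: nzd_var.
have h0 : idl s (sg a).
  apply: ny; have := sgI _ h; rewrite /sg !(rmorphB, rmorphM) /= substX /kill eqxx killxY //.
  by rewrite !mul0r !sub0r opprK.
have h1 : idl s (sg b).
  apply: hu; rewrite -(subrK (Y u * sg a) (X u * _)); apply: idlD; last exact: idlM.
  by apply: combs_fm hf _; apply: combs_subst hab.
have [a' [b' [hab' ha hb]]] := combs_subst_sub hr' hl hab.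
apply/idl_fm_cat; exists a', b'; split=> //; apply: nx.
have -> : X v * (p - (X v * b' - Y v * a')) =
    (X v * p - (X v * b - Y v * a)) + (X v * sg b - Y v * sg a).
  have {}ha : a = a' * X v + sg a by rewrite -ha subrK.
  have {}hb : b = b' * X v + sg b by rewrite -hb subrK.
  by move: ha hb; move: (sg a) (sg b) => A B -> ->; ring.
by apply: idlD => //; apply: idlB; apply: idlM.
Qed.

(** Killing the variables of all vertices before p keeps the graph on the remaining vertices in one
    polynomial ring, so the induction along the path never changes rings. *)
Definition U p w := gens p w ++ kl p.

Lemma subst_kl h p : (forall i, (i < p)%N -> subst h (X i) = X i /\ subst h (Y i) = Y i) ->
  forall g, g \in kl p -> subst h g = g.
Proof. by move=> hp g /mem_kl [i /hp [h1 h2] [] ->]. Qed.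

Section Fixed.
Variables (p q : nat) (w : seq letter).
Hypotheses (hpq : (p < q)%N) (hq : (q + wsize w < n)%N).
Let s := gens q w ++ kl p.

Lemma killx_s g : g \in s -> subst (kill K (xi p)) g = g.
Proof.
rewrite mem_cat => /orP [].
  by apply: subst_gens => i hi; split; [apply: killxX|apply: killxY]; lia.
by apply: subst_kl => i hi; split; [apply: killxX|apply: killxY]; lia.
Qed.

Lemma killy_s g : g \in s -> subst (kill K (yi p)) g = g.
Proof.
rewrite mem_cat => /orP [].
  by apply: subst_gens => i hi; split; [apply: killyX|apply: killyY]; lia.
by apply: subst_kl => i hi; split; [apply: killyX|apply: killyY]; lia.
Qed.

Lemma killy_X (r : seq nat) g : (forall j, j \in r -> (j < n)%N) ->
  g \in [seq X j | j <- r] -> subst (kill K (yi p)) g = g.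
Proof. by move=> hr /mapP [j /hr hj ->]; apply: killyX; lia. Qed.

(** [s] does not involve X_p and Y_p, so these form a regular sequence on its quotient, and
    permutability moves l in front of them. *)
Lemma nzd_free l : homog_deg l 1 -> nzd (X p :: Y p :: s) l -> nzd s l.
Proof.
move=> hl h; apply: (@nzd_regseq _ _ s [:: Y p; X p] l 1) => //.
- by apply: hseq_cat; [apply: hseq_gens|apply: hseq_kl].
- by move=> g; rewrite !inE => /orP [] /eqP ->; [apply: homogY|apply: homogX].
- split; last split=> //; apply: nzd_var => g; first exact: killy_s.
  by rewrite inE => /orP [/eqP ->|/killx_s //]; apply: killxY; lia.
Qed.

End Fixed.

Lemma idl_X_cat (r : seq nat) s j : j \in r -> idl ([seq X j | j <- r] ++ s) (X j).
Proof. by move=> hj; apply: idl_mem; rewrite mem_cat map_f. Qed.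

Lemma idl_catr s s' g : idl s' g -> idl (s ++ s') g.
Proof. by apply: idl_subseq => x; rewrite mem_cat orbC => ->. Qed.

Lemma idl_catl s s' g : idl s g -> idl (s ++ s') g.
Proof. by apply: idl_subseq => x; rewrite mem_cat => ->. Qed.

(* A vertex p joined to a clique r of the graph on p+1, p+2, ...: modulo X_p,
   the ideal is filtered by Y_p. *)
Lemma good_join p w r t t' : (p.+1 + wsize w < n)%N ->
  p.+1 \in r -> (forall j, j \in r -> (p < j < n)%N) ->
  (forall i j, i \in r -> j \in r -> idl (gens p.+1 w) (fm i j)) ->
  good (U p.+1 w) (ls p.+1 (wsize w)) t ->
  good ([seq X j | j <- r] ++ U p.+1 w) (lt p.+1 (wsize w)) t' ->
  let s := [seq fm p j | j <- r] ++ gens p.+1 w ++ kl p in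
  good s (ls p (wsize w).+1) (maxn t'.+1 t) /\
  good ([seq X j | j <- p :: r] ++ s) (lt p (wsize w).+1) t'.
Proof.
move=> hn hpr hr hcl hA hB s.
pose s0 := gens p.+1 w ++ kl p.
have hs0 : hseq s0 by apply: hseq_cat; [apply: hseq_gens|apply: hseq_kl].
have hs : hseq s by apply: hseq_cat => //; apply: hseq_fm.
have eU : equi (U p.+1 w) (X p :: Y p :: s0).
  exact: equi_mid.
(* This is the colon ideal of (X_p) + s by Y_p, and at the same time the ideal of the second claim,
   with X killed on the enlarged clique. *)
pose s' := [seq X j | j <- r] ++ X p :: s0.
have hY : nzd s' (Y p).
  apply: nzd_var => g; rewrite mem_cat inE => /or3P [hg|/eqP ->|hg].
  - by apply: (@killy_X p p.+1 w _ _ r) => // j /hr; lia.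
  - by apply: killyX; lia.
  - by apply: (@killy_s p p.+1 w).
have hB' : good s' (lt p (wsize w).+1) t'.
  (* Since p+1 belongs to r, X_(p+1) lies in [s'], and the form X_(p+1) - Y_p reduces to Y_p up to
     sign. *)
  rewrite [lt _ _]/=; apply: (@good_congN _ _ _ (Y p)).
    by rewrite addrCA subrr addr0; apply: idl_X_cat.
  by apply: good_cons => //; apply: good_equi hB; apply: equi_mid'.
have sub_s' g : g \in s -> idl s' g.
  rewrite !mem_cat => /or3P [/mapP [j hj ->]|hg|hg].
  - by apply: fmXX; [apply/idl_catr/idl_mem; rewrite mem_head|apply: idl_X_cat].
  - by apply/idl_mem; rewrite /s' mem_cat inE mem_cat hg !orbT.
  - by apply/idl_mem; rewrite /s' mem_cat inE mem_cat hg !orbT.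
split; last first.
  apply: good_equi hB'; apply: equi_gen => g.
    rewrite mem_cat inE => /or3P [hg|/eqP ->|hg].
    - by apply/idl_mem; rewrite mem_cat inE hg orbT.
    - by apply/idl_mem; rewrite mem_cat inE eqxx.
    - by apply/idl_mem; rewrite !mem_cat -mem_cat hg !orbT.
  rewrite mem_cat inE => /orP [/orP [/eqP ->|hg]|/sub_s' //].
    by apply/idl_mem; rewrite mem_cat mem_head orbT.
  by apply/idl_mem; rewrite mem_cat hg.
have hX : nzd s (X p).
  apply: (@nzd_join s0 r p p.+1) => //; first lia.
  - by move=> g; apply: killx_s; lia.
  - by move=> g; apply: killy_s; lia.
  - by move=> j /hr; lia.
  - by move=> j hj; apply/idl_catl/hcl.
  - apply: (@nzd_free p p.+1 w) => //; [exact: homogX|].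
    by apply: (nzd_equi eU); case: hA => -[].
apply: good_cons => //; rewrite -add1n.
apply: (@good_filt _ _ _ s' (Y p) 1) => //.
- exact: hseq_cons (@homogX _) hs.
- by move=> l; apply: homog_lt.
- exact: homogY.
- move=> q; split=> [h|].
    apply: hY; apply: idl_sub h => g; rewrite inE => /orP [/eqP ->|/sub_s' //].
    by apply/idl_mem; rewrite mem_cat mem_head orbT.
  elim/idl_least => [|a b|a b|g]; first by rewrite mulr0; apply: idl0.
  - by rewrite mulrDr; apply: idlD.
  - by rewrite mulrCA; apply: idlM.
  rewrite mem_cat inE => /or3P [/mapP [j hj ->]|/eqP ->|hg].
  - rewrite (_ : Y p * X j = Y j * X p - fm p j); last by rewrite /fm; ring.
    apply: idlB; first by apply/idlM/idl_mem; rewrite mem_head.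
    by apply/idl_consr/idl_catl/idl_mem; rewrite map_f.
  - by apply/idlM/idl_mem; rewrite mem_head.
  - by apply/idlM/idl_consr/idl_catr/idl_mem.
(* Modulo Y_p the same form reduces to X_(p+1), with which the sequence of the smaller graph
   begins. *)
rewrite [lt _ _]/=; apply: (@good_cong _ _ _ (X p.+1)).
  by rewrite opprB addrCA subrr addr0; apply/idl_mem; rewrite mem_head.
apply: good_equi hA; apply: equi_gen => g.
  move=> /idl_mem /eU; apply: idl_sub => x; rewrite !inE => /or3P [/eqP ->|/eqP ->|hx].
  - by apply/idl_mem; rewrite !inE eqxx orbT.
  - by apply/idl_mem; rewrite !inE eqxx.
  - by apply/idl_mem; rewrite !inE mem_cat hx !orbT.
have hk x : x \in kl p.+1 -> idl (U p.+1 w) x by move=> hx; apply/idl_catr/idl_mem.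
have hXp : idl (U p.+1 w) (X p) by apply: hk; rewrite /= inE eqxx.
have hYp : idl (U p.+1 w) (Y p) by apply: hk; rewrite /= !inE eqxx orbT.
rewrite !inE mem_cat => /or4P [/eqP -> //|/eqP -> //|/mapP [j _ ->]|].
  exact: fm_killl.
rewrite mem_cat => /orP [hg|hg]; first by apply/idl_catl/idl_mem.
by apply: hk; rewrite /= !inE hg !orbT.
Qed.

(* Top degrees of the Artinian reductions of U and of U plus the variables X of
   the first clique. *)
Fixpoint tops (w : seq letter) : nat * nat :=
  match w with
  | LN :: w' => ((tops w').1.+1, (tops w').1)
  | LE :: w' => (maxn (tops w').2.+1 (tops w').1, (tops w').2)
  | _ :: w' => ((tops w').1, (tops w').1)
  | [::] => (0, 0)
  end.

Definition isNEI (a : letter) := match a with LN | LE | LI => true | _ => false end.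

(** Only the last vertex is left and the sequence kills its two variables: the quotient is K, with
    top degree 0. *)
Lemma good_nil p : p.+1 = n -> good (kl p) [:: X p; Y p] 0.
Proof.
move=> hn; have hx : nzd (kl p) (X p).
  apply: nzd_var; apply: subst_kl => i hi.
  by split; [apply: killxX|apply: killxY]; lia.
have hy : nzd (X p :: kl p) (Y p).
  apply: nzd_var => g; rewrite inE => /orP [/eqP ->|]; first by apply: killyX; lia.
  by apply: subst_kl => i hi; split; [apply: killyX|apply: killyY]; lia.
split; first by split=> //; split.
have hall k : idl (catrev [:: X p; Y p] (kl p)) 'X_k.
  have [i hi] := xi_yi_full k; have : (i < p.+1)%N by lia.
  move=> /kl_mem /andP [h1 h2] hk; apply/idl_mem.
  move: h1 h2; rewrite /= !inE; case: hk => ->; rewrite -/(X i) -/(Y i) => h1 h2.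
    by rewrite orbCA.
  by rewrite orbCA.
split=> [d q hd hq|].
  by apply: idl_max => //; apply: homog_deg_const hq; lia.
exists 1; first exact: homog_degC.
move=> /idl_const h; have /eqP : (1 : S)@_0%MM = 0.
  apply: h => g; rewrite /= !inE => hg.
  have : g \in kl p.+1 by rewrite /= !inE orbCA.
  by move=> /mem_kl [i _ [] ->]; rewrite mcoeffX mnm1_eq0.
by rewrite mcoeff1 eqxx oner_eq0.
Qed.

Lemma good_NEI w p : all isNEI w -> (p + wsize w).+1 = n ->
  good (U p w) (ls p (wsize w)) (tops w).1 /\
  good ([seq X j | j <- cl p w] ++ U p w) (lt p (wsize w)) (tops w).2.
Proof.
elim: w p => [|a w IH] p /=.
  rewrite addn0 => _ hn; have h := good_nil hn; split=> //.
  by case: h => -[h1 h2] h3; split.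
case: a => //= hw hn.
- have [|hA hB] := IH p.+1 hw; first lia.
  (* For an edge the clique that p joins is {p+1}, and X_(p+1) is the first form of the smaller
     sequence anyway; so both ends have the same top degree. *)
  have [||||||h1 h2] := @good_join p w [:: p.+1] (tops w).1 (tops w).1.
  + lia.
  + by rewrite mem_head.
  + by move=> j; rewrite inE => /eqP ->; lia.
  + by move=> i j; rewrite !inE => /eqP -> /eqP ->; rewrite /fm subrr; apply: idl0.
  + by [].
  + by case: hA => -[? ?] ?; split.
  by split=> //; rewrite (maxn_idPl (leqnSn _)) in h1.
- have [|hA hB] := IH p.+1 hw; first lia.
  have [||||||h1 h2] := @good_join p w (cl p.+1 w) (tops w).1 (tops w).2 => //.
  + lia.
  + exact: mem_cl.
  + by move=> j /cl_bounds; lia.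
  + by move=> i j; apply: gens_cl.
  by rewrite /U /= -!catA; split.
(* With p+1 removed, X_(p+1) - Y_p and X_(p+2) - Y_(p+1) reduce to Y_p, up to sign, and X_(p+2): the
   sequence restarts at p+2. *)
- have [|hA _] := IH p.+2 hw; first lia.
  pose s := U p (LI :: w).
  have fix_s h : (forall i, (i != p) -> (i < n)%N -> subst h (X i) = X i /\ subst h (Y i) = Y i) ->
      forall g, g \in s -> subst h g = g.
    move=> hh g; rewrite /s /U /= !inE mem_cat => /or4P [/eqP ->|/eqP ->||].
    - by case: (hh p.+1) => //; lia.
    - by case: (hh p.+1) => //; lia.
    - by apply: subst_gens => i hi; apply: hh; lia.
    - by apply: subst_kl => i hi; apply: hh; lia.
  have hX : nzd s (X p).
    apply: nzd_var; apply: fix_s => i hi hi'.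
    by split; [apply: killxX|apply: killxY] => //; lia.
  have hB : good (X p :: s) (lt p (2 + wsize w)) (tops w).1.
    rewrite [lt _ _]/=; apply: (@good_congN _ _ _ (Y p)).
      rewrite addrCA subrr addr0; apply/idl_consr/idl_mem.
      by rewrite mem_head.
    apply: good_cons.
      apply: nzd_var => g; rewrite inE => /orP [/eqP ->|]; first by apply: killyX; lia.
      apply: fix_s => i hi hi'.
      by split; [apply: killyX|apply: killyY] => //; lia.
    apply: (@good_cong _ _ _ (X p.+2)).
      rewrite opprB addrCA subrr addr0; do 2!apply/idl_consr.
      by apply/idl_mem; rewrite !inE eqxx orbT.
    by apply: good_equi hA; apply: equi_mid4.
  by split=> //; apply: good_cons.
Qed.

(** * Comparing the generators of words with a common prefix *)

Definition lgens p a (r : seq nat) : seq S :=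
  match a with
  | LN => [:: fm p p.+1]
  | LE => [seq fm p j | j <- r]
  | LI => [:: X p.+1; Y p.+1]
  | LC => [:: fm p p.+1; fm p.+1 p.+2; fm p.+2 p.+3; fm p p.+3]
  | LD => [:: fm p p.+1; fm p.+1 p.+2; fm p.+2 p.+3; fm p p.+3; fm p.+1 p.+3]
  end.

(** Isolates the only way in which a letter depends on the rest of the word: [LE] looks at the
    clique that follows. *)
Lemma gens_cons p a w :
  gens p (a :: w) = lgens p a (cl p.+1 w) ++ gens (lsize a + p) w.
Proof. by case: a. Qed.

Lemma gens_suffix L p w g : g \in gens (wsize L + p) w -> g \in gens p (L ++ w).
Proof.
elim: L p => [|a L IH] p //; rewrite cat_cons gens_cons mem_cat => h.
by apply/orP; right; apply: IH; rewrite addnA (addnC (wsize L)).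
Qed.

Lemma cl_prefix (Q : nat -> Prop) L p w w' :
  (forall j, j \in cl (wsize L + p) w' -> j \in cl (wsize L + p) w \/ Q j) ->
  forall j, j \in cl p (L ++ w') -> j \in cl p (L ++ w) \/ Q j.
Proof.
elim: L p => [|a L IH] p //; case: a => h j; try by left.
rewrite /= !inE => /orP [->|hj]; first by left.
have [|->|] := IH p.+1 _ j hj; [|by rewrite orbT; left|by right].
by rewrite addnS.
Qed.

(* Generators are compared through a predicate P because they are compared both
   directly and after multiplication by a fixed polynomial. *)
Lemma gens_prefix (P : S -> Prop) L p w w' :
  (forall j, j \in cl (wsize L + p) w' ->
     j \in cl (wsize L + p) w \/ forall i, P (fm i j)) ->
  (forall g, g \in gens p (L ++ w) -> P g) ->
  (forall g, g \in gens (wsize L + p) w' -> P g) ->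
  forall g, g \in gens p (L ++ w') -> P g.
Proof.
elim: L p => [|a L IH] p // h hw hw' g; rewrite cat_cons gens_cons mem_cat.
have e : (wsize (a :: L) + p = wsize L + (lsize a + p))%N by rewrite /=; lia.
rewrite e in h hw'; case/orP => hg; last first.
  apply: (IH (lsize a + p)%N) hg => // x hx; apply: hw.
  by rewrite cat_cons gens_cons mem_cat hx orbT.
have hl x : x \in lgens p a (cl p.+1 (L ++ w)) -> P x.
  by move=> hx; apply: hw; rewrite cat_cons gens_cons mem_cat hx.
case: a h hg hl {e hw hw'} => h hg hl; try exact: hl hg.
case/mapP: hg => j /(@cl_prefix _ L p.+1 w w' h) [hj|hj] ->; last exact: hj.
by apply/hl/map_f.
Qed.

(** A prefix not ending in [LE] completes its last clique by itself, so its generators are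
    independent of the suffix. The default [LN] makes the empty prefix closed. *)
Definition closed_word L := if last LN L is LE then false else true.

Lemma gens_prefix_closed (P : S -> Prop) L p w w' : closed_word L ->
  (forall g, g \in gens p (L ++ w) -> P g) ->
  (forall g, g \in gens (wsize L + p) w' -> P g) ->
  forall g, g \in gens p (L ++ w') -> P g.
Proof.
case/lastP: L => [|L a] //.
rewrite /closed_word last_rcons !cat_rcons -cats1 wsize_cat /= addn0 => ha hw hw'.
apply: (@gens_prefix _ _ _ (a :: w)) => //.
  by move=> j hj; left; case: a ha {hw hw'} hj.
move=> g; rewrite gens_cons mem_cat => /orP [hg|hg]; last first.
  by apply: hw'; rewrite -addnA addnCA.
apply/hw/gens_suffix; rewrite gens_cons mem_cat; apply/orP; left.
by case: a ha {hw hw'} hg.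
Qed.

(** * Nonzerodivisors from three consecutive linear forms *)

Lemma lt_split p k m : exists2 pre, lt p (k + m) = pre ++ lt (k + p) m &
  forall l, l \in pre -> homog_deg l 1.
Proof.
elim: k p => [|k IH] p; first by exists [::].
have [pre h1 h2] := IH p.+1; exists ((X p.+1 - Y p) :: pre).
  by rewrite addSn /= h1 addnS.
move=> l; rewrite inE => /orP [/eqP ->|/h2 //].
by apply: homog_degB; [apply: homogX|apply: homogY].
Qed.

(* By permutability it suffices to test f modulo the forms that precede three
   given consecutive ones. *)
Lemma nzd_window s k m f e : hseq s -> homog_deg f e ->
  regseq s (ls 0 (k + m.+3)) ->
  (forall M, (forall g, idl s g -> idl M g) -> hseq M ->
     regseq M [:: X k.+1 - Y k; X k.+2 - Y k.+1; X k.+3 - Y k.+2] -> nzd M f) ->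
  nzd s f.
Proof.
move=> hs hf hr h; rewrite /ls in hr.
have [pre e1 hpre] := lt_split 0 k m.+3; rewrite e1 -cat_cons addn0 in hr.
have [hr1 hr2] := (regseq_cat _ _ _).1 hr.
have hp l : l \in X 0 :: pre -> homog_deg l 1.
  by rewrite inE => /orP [/eqP ->|/hpre //]; apply: homogX.
apply: (nzd_regseq hs hp hr1 hf); apply: h.
- by move=> g; apply: idl_subseq => x hx; rewrite catrevE mem_cat hx orbT.
- by apply: hseq_catrev => // l /hp hl; exists 1.
- by case: hr2 => [? [? [? _]]].
Qed.

(** Here k, ..., k+3 are a, d, c, b, with a and c removed. The three forms reduce to X_d, Y_d, X_b,
    and modulo X_d the binomial f_db is - X_b Y_d, a product of nonzerodivisors. *)
Lemma nzd_windowC k s : hseq s ->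
  idl s (Y k) -> idl s (X k.+2) -> idl s (Y k.+2) ->
  regseq s [:: X k.+1 - Y k; X k.+2 - Y k.+1; X k.+3 - Y k.+2] ->
  nzd s (fm k.+1 k.+3).
Proof.
move=> hs h1 h2 h3 hr.
have {hr} /= [r1 [r2 [r3 _]]] : regseq s [:: X k.+1; Y k.+1; X k.+3].
  move: hr; set l2 := _ - Y k.+1; set l3 := _ - Y k.+2 => hr.
  have {}hr : regseq s [:: X k.+1; l2; l3].
    by apply: regseq_cong hr; rewrite addrAC subrr add0r; apply: idlN.
  case: hr => r1 hr; split; first exact: r1.
  have {}hr : regseq (X k.+1 :: s) [:: Y k.+1; l3].
    by apply: (@regseq_congN _ _ l2 _ [:: l3] _ hr); rewrite /l2 subrK; apply: idl_consr.
  case: hr => r2 hr; split; first exact: r2.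
  apply: (@regseq_cong _ _ l3 _ [::] _ hr); rewrite /l3 addrAC subrr add0r.
  by apply/idlN/idl_consr/idl_consr.
have hs1 : hseq (X k.+1 :: s) := hseq_cons (@homogX _) hs.
apply: (nzd_mod hs (@homogX _) r1 (@homog_fm _ _)).
have h : nzd (X k.+1 :: s) (- (X k.+3 * Y k.+1)).
  by apply/nzdN/nzdM/r2; apply: (nzd_mod hs1 (@homogY _) r2 (@homogX _)).
apply: nzd_cong h; rewrite (_ : _ - _ = - Y k.+3 * X k.+1); last by rewrite /fm; ring.
by apply/idlM/idl_mem; rewrite mem_head.
Qed.

(** Here k, ..., k+3 are a, d, c, b, with d and b removed. The forms reduce to Y_a, X_c, Y_c. Since
    f_ac is - X_c Y_a modulo Y_c, the last form first has to be permuted to the front. *)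
Lemma nzd_windowD k s : hseq s ->
  idl s (X k.+1) -> idl s (Y k.+1) -> idl s (X k.+3) ->
  regseq s [:: X k.+1 - Y k; X k.+2 - Y k.+1; X k.+3 - Y k.+2] ->
  nzd s (fm k k.+2).
Proof.
move=> hs h1 h2 h3 hr.
have {hr} /= [r1 [r2 [r3 _]]] : regseq s [:: Y k; X k.+2; Y k.+2].
  move: hr; set l2 := _ - Y k.+1; set l3 := _ - Y k.+2 => hr.
  have {}hr : regseq s [:: Y k; l2; l3] by apply: regseq_congN hr; rewrite subrK.
  case: hr => r1 hr; split; first exact: r1.
  have {}hr : regseq (Y k :: s) [:: X k.+2; l3].
    apply: (@regseq_cong _ _ l2 _ [:: l3] _ hr); rewrite /l2 addrAC subrr add0r.
    by apply/idlN/idl_consr.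
  case: hr => r2 hr; split; first exact: r2.
  by apply: (@regseq_congN _ _ l3 _ [::] _ hr); rewrite /l3 subrK; do 2!apply: idl_consr.
have hs1 : hseq (Y k :: s) := hseq_cons (@homogY _) hs.
have hs2 : hseq (Y k.+2 :: s) := hseq_cons (@homogY _) hs.
have r13 := nzd_mod hs1 (@homogX _) r2 (@homogY _) r3.
have r30 := nzd_mod hs (@homogY _) r1 (@homogY _) r13.
have r1' := nzd_swap r1 r13.
have r2' : nzd (Y k.+2 :: s) (X k.+2).
  apply: (nzd_mod hs2 (@homogY _) r1' (@homogX _)).
  exact: (nzd_equi (equi_swap s (Y k.+2) (Y k)) (nzd_swap r2 r3)).
apply: (nzd_mod hs (@homogY _) r30 (@homog_fm _ _)).
apply: nzd_cong (nzdN (nzdM r2' r1')); 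
rewrite (_ : _ - _ = - X k * Y k.+2); last by rewrite /fm; ring.
by apply/idlM/idl_mem; rewrite mem_head.
Qed.

Definition goodw w (t : nat) := good (gens 0 w) (ls 0 (wsize w)) t.

(* Completing the neighbourhood of the first vertex. *)
Definition hat w := if w is LC :: w' then LD :: w' else w.

(* Removing the first vertex. *)
Definition back w :=
  match w with
  | LC :: w' => [:: LN, LN & w']
  | _ :: w' => w'
  | [::] => [::]
  end.

Lemma wsize_hat w : wsize (hat w) = wsize w.
Proof. by case: w => [|[]]. Qed.

Lemma idlX_fm s k i j : idl s (fm k i) -> idl s (fm k j) -> idl s (fm i j * X k).
Proof.
move=> hi hj; rewrite (_ : _ * _ = X i * fm k j - X j * fm k i); last by rewrite /fm; ring.
by apply: idlB; apply: idlM.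
Qed.

Lemma idlY_fm s k i j : idl s (fm k i) -> idl s (fm k j) -> idl s (fm i j * Y k).
Proof.
move=> hi hj; rewrite (_ : _ * _ = Y i * fm k j - Y j * fm k i); last by rewrite /fm; ring.
by apply: idlB; apply: idlM.
Qed.

(** For two neighbours i, j of k, both X_k f_ij and Y_k f_ij lie in the ideal, hence so does f_hk
    f_ij. This puts the completed neighbourhood of b into the colon ideal by f_db. *)
Lemma idlfm_fm s k h i j : idl s (fm k i) -> idl s (fm k j) -> idl s (fm h k * fm i j).
Proof.
move=> hi hj; have -> : fm h k * fm i j = X h * (fm i j * Y k) - Y h * (fm i j * X k).
  by set F := fm i j; rewrite /fm; ring.
by apply: idlB; apply: idlM; [apply: idlY_fm|apply: idlX_fm].
Qed.

(* A C4 block a, d, c, b (at positions k+1, ..., k+4 with k = wsize L): the colon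
   ideal by f_db is that of the graph without a and c, with the neighbourhood of
   b completed. *)
Lemma goodw_C L w t' t : (wsize (L ++ [:: LN, LC & w])).+1 = n ->
  goodw (L ++ [:: LI, LI & hat w]) t' -> goodw (L ++ [:: LN, LD & w]) t ->
  goodw (L ++ [:: LN, LC & w]) (maxn (2 + t') t).
Proof.
rewrite /goodw !wsize_cat => hn h1 h2.
set c := wsize L in hn h1 h2 *.
pose w1 := L ++ [:: LI, LI & hat w]; pose w2 := L ++ [:: LN, LC & w].
pose w3 := L ++ [:: LN, LD & w]; pose f := fm c.+2 c.+4.
rewrite -/w1 in h1; rewrite -/w3 in h2; rewrite -/w2.
have hs1 : hseq (gens 0 w1) := @hseq_gens 0 w1.
have suf g u v : g \in gens c v -> u = L ++ v -> g \in gens 0 u.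
  by move=> hg ->; apply: gens_suffix; rewrite addn0.
have m1 g : g \in gens c [:: LI, LI & hat w] -> idl (gens 0 w1) g.
  by move=> hg; apply/idl_mem/(suf _ _ _ hg).
have m2 g : g \in gens c [:: LN, LC & w] -> idl (gens 0 w2) g.
  by move=> hg; apply/idl_mem/(suf _ _ _ hg).
have m3 g : g \in gens c [:: LN, LD & w] -> idl (gens 0 w3) g.
  by move=> hg; apply/idl_mem/(suf _ _ _ hg).
(* The vertices a and c are common neighbours of d and b, which puts their variables into the colon
   ideal; the only new edge is the chord of a following 4-cycle, and it joins two neighbours of
   b. *)
have F1 : forall g, g \in gens 0 w1 -> idl (gens 0 w2) (f * g).
  apply: (@gens_prefix _ _ _ [:: LN, LC & w]); rewrite ?addn0.
  - by move=> j; rewrite /= !inE => ->; left.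
  - by move=> g hg; apply/idlM/idl_mem.
  have e12 : idl (gens 0 w2) (fm c.+1 c.+2) by apply: m2; apply: (@mem_at _ 1).
  have e23 : idl (gens 0 w2) (fm c.+2 c.+3) by apply: m2; apply: (@mem_at _ 2).
  have e34 : idl (gens 0 w2) (fm c.+3 c.+4) by apply: m2; apply: (@mem_at _ 3).
  have e14 : idl (gens 0 w2) (fm c.+1 c.+4) by apply: m2; apply: (@mem_at _ 4).
  have e32 : idl (gens 0 w2) (fm c.+3 c.+2) by rewrite fm_anti; apply: idlN.
  have mw g : g \in gens c.+4 w -> idl (gens 0 w2) g.
    by move=> hg; apply: m2; apply: (@mem_from _ 5).
  move=> g; cbn [gens]; do 4!rewrite in_cons.
  case/predU1P => [->|]; first exact: idlX_fm.
  case/predU1P => [->|]; first exact: idlY_fm.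
  case/predU1P => [->|]; first exact: idlX_fm.
  case/predU1P => [->|hg]; first exact: idlY_fm.
  suff [hg'|[i [j [-> hi hj]]]] : g \in gens c.+4 w \/ exists i j,
      [/\ g = fm i j, idl (gens 0 w2) (fm c.+4 i) & idl (gens 0 w2) (fm c.+4 j)].
  - by apply/idlM/mw.
  - exact: idlfm_fm.
  case: w @w1 @w2 @w3 hg mw {h1 h2 hs1 suf m1 m2 m3 e12 e23 e34 e14 e32 hn} => [|[] w] w1 w2 w3 hg mw;
    try by left.
  case: (mem_cons5 hg) => [|->]; first by left.
  right; exists c.+4.+1, c.+4.+3; split=> //; apply: mw.
    by apply: (@mem_at _ 0).
  by apply: (@mem_at _ 3).
have F2 : forall g, g \in gens 0 w2 -> idl (gens 0 w1) g.
  have x1 : idl (gens 0 w1) (X c.+1) by apply: m1; apply: (@mem_at _ 0).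
  have y1 : idl (gens 0 w1) (Y c.+1) by apply: m1; apply: (@mem_at _ 1).
  have x3 : idl (gens 0 w1) (X c.+3) by apply: m1; apply: (@mem_at _ 2).
  have y3 : idl (gens 0 w1) (Y c.+3) by apply: m1; apply: (@mem_at _ 3).
  apply: (@gens_prefix _ _ _ [:: LI, LI & hat w]); rewrite ?addn0.
  - move=> j; rewrite /= !inE => /orP [->|/eqP ->]; first by left.
    by right=> i; apply: fm_killr.
  - by move=> g; apply: idl_mem.
  move=> g; cbn [gens cat]; do 5!rewrite in_cons.
  case/predU1P => [->|]; first exact: fm_killr.
  case/predU1P => [->|]; first exact: fm_killl.
  case/predU1P => [->|]; first exact: fm_killr.
  case/predU1P => [->|]; first exact: fm_killl.
  case/predU1P => [->|hg]; first exact: fm_killl.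
  apply: m1; apply: (@mem_from _ 4); case: (w) hg => [|[] w'] //.
  change (g \in lgens c.+4 LC [::] ++ gens c.+4.+3 w' ->
          g \in lgens c.+4 LD [::] ++ gens c.+4.+3 w').
  rewrite !mem_cat => /orP [hg|->]; last by rewrite orbT.
  apply/orP; left; move: hg; rewrite /lgens; move: (fm _ _) (fm _ _) (fm _ _) (fm _ _) (fm _ _).
  by move=> x1' x2' x3' x4' x5'; rewrite !inE => /or4P [] ->; rewrite ?orbT.
have F3 : equi (gens 0 w3) (f :: gens 0 w2).
  have e g : (g \in gens c [:: LN, LD & w]) = (g \in f :: gens c [:: LN, LC & w]).
    exact (mem_cons6 g (fm c.+1 c.+2) (fm c.+2 c.+3) (fm c.+3 c.+4) (fm c.+1 c.+4) f
      (fm c c.+1) (gens c.+4 w)).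
  apply: equi_gen.
    apply: (@gens_prefix _ _ _ [:: LN, LC & w]); rewrite ?addn0.
    - by move=> j; rewrite /= !inE => ->; left.
    - by move=> g hg; apply/idl_consr/idl_mem.
    move=> g; rewrite e in_cons => /predU1P [->|/m2]; last exact: idl_consr.
    by apply/idl_mem; rewrite mem_head.
  move=> g; rewrite in_cons => /predU1P [->|]; first by apply: m3; rewrite e mem_head.
  move: g; apply: (@gens_prefix _ _ _ [:: LN, LD & w]); rewrite ?addn0.
  - by move=> j; rewrite /= !inE => ->; left.
  - by move=> g; apply: idl_mem.
  by move=> g hg; apply: m3; rewrite e in_cons hg orbT.
have hf : homog_deg f 2 := @homog_fm _ _.
have e : (c + wsize [:: LI, LI & hat w] = c + wsize [:: LN, LC & w])%N.
  by rewrite /= wsize_hat; lia.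
rewrite e in h1.
apply: (good_filt (k := 2) (s' := gens 0 w1) (f := f)) => //.
- exact: hseq_gens.
- by move=> l; apply: homog_ls.
- apply: idl_colon => //; case: h1 => h1 _.
  (* The window starts at the first removed vertex, one position after the common prefix, because of
     the letter [LN] in between. *)
  have e' : (c + wsize [:: LN, LC & w] = c.+1 + (wsize w).+3)%N by rewrite /=; lia.
  rewrite e' in h1; apply: (nzd_window hs1 hf h1) => M hM hsM; apply: nzd_windowC => //; apply: hM.
  + by apply: m1; apply: (@mem_at _ 1).
  + by apply: m1; apply: (@mem_at _ 2).
  + by apply: m1; apply: (@mem_at _ 3).
- exact: (good_equi F3 h2).
Qed.

(** The words on which [back] deletes exactly one position. *)
Definition extends w := if w is (LN | LE | LC) :: _ then true else false.

Lemma wsize_back w : extends w -> (wsize w = 1 + wsize (back w))%N.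
Proof. by case: w => [|[]]. Qed.

(* The same block with the chord db: the colon ideal by f_ac is that of the
   graph without b and d. *)
Lemma goodw_D L w t' t : closed_word L -> (wsize (L ++ LD :: w)).+1 = n ->
  extends w ->
  goodw (L ++ [:: LI, LI & back w]) t' -> goodw (L ++ [:: LE, LE, LN & w]) t ->
  goodw (L ++ LD :: w) (maxn (2 + t') t).
Proof.
rewrite /goodw !wsize_cat => hL hn hw h1 h2.
have sb := wsize_back hw.
set c := wsize L in hn h1 h2 *.
pose w1 := L ++ [:: LI, LI & back w]; pose w2 := L ++ LD :: w.
pose w3 := L ++ [:: LE, LE, LN & w]; pose f := fm c c.+2.
rewrite -/w1 in h1; rewrite -/w3 in h2; rewrite -/w2.
have hs1 : hseq (gens 0 w1) := @hseq_gens 0 w1.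
have suf g u v : g \in gens c v -> u = L ++ v -> g \in gens 0 u.
  by move=> hg ->; apply: gens_suffix; rewrite addn0.
have m1 g : g \in gens c [:: LI, LI & back w] -> idl (gens 0 w1) g.
  by move=> hg; apply/idl_mem/(suf _ _ _ hg).
have m2 g : g \in gens c (LD :: w) -> idl (gens 0 w2) g.
  by move=> hg; apply/idl_mem/(suf _ _ _ hg).
have m3 g : g \in gens c [:: LE, LE, LN & w] -> idl (gens 0 w3) g.
  by move=> hg; apply/idl_mem/(suf _ _ _ hg).
have F1 : forall g, g \in gens 0 w1 -> idl (gens 0 w2) (f * g).
  apply: (@gens_prefix_closed _ _ _ (LD :: w) _ hL); rewrite ?addn0.
    by move=> g hg; apply/idlM/idl_mem.
  have e01 : idl (gens 0 w2) (fm c c.+1) by apply: m2; apply: (@mem_at _ 0).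
  have e12 : idl (gens 0 w2) (fm c.+1 c.+2) by apply: m2; apply: (@mem_at _ 1).
  have e23 : idl (gens 0 w2) (fm c.+2 c.+3) by apply: m2; apply: (@mem_at _ 2).
  have e03 : idl (gens 0 w2) (fm c c.+3) by apply: m2; apply: (@mem_at _ 3).
  have e10 : idl (gens 0 w2) (fm c.+1 c) by rewrite fm_anti; apply: idlN.
  have e32 : idl (gens 0 w2) (fm c.+3 c.+2) by rewrite fm_anti; apply: idlN.
  have e30 : idl (gens 0 w2) (fm c.+3 c) by rewrite fm_anti; apply: idlN.
  have mw g : g \in gens c.+3 w -> idl (gens 0 w2) g.
    by move=> hg; apply: m2; apply: (@mem_from _ 5).
  move=> g; cbn [gens]; do 4!rewrite in_cons.
  case/predU1P => [->|]; first exact: idlX_fm.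
  case/predU1P => [->|]; first exact: idlY_fm.
  case/predU1P => [->|]; first exact: idlX_fm.
  case/predU1P => [->|hg]; first exact: idlY_fm.
  apply/idlM/mw; case: (w) hw hg => [|[] w'] // _ hg.
  - by apply: (@mem_from _ 1).
  - by cbn [gens]; rewrite mem_cat hg orbT.
  - change (g \in [:: fm c.+3 c.+4; fm c.+4 c.+4.+1; fm c.+4.+1 c.+4.+2; fm c.+3 c.+4.+2]
                 ++ gens c.+4.+2 w').
    change (is_true (g \in [:: fm c.+4 c.+4.+1; fm c.+4.+1 c.+4.+2] ++ gens c.+4.+2 w')) in hg.
    rewrite mem_cat in hg; rewrite mem_cat; case/orP: hg => hg; apply/orP; [left|by right].
    move: hg; rewrite in_cons mem_seq1 => /orP [] /eqP ->.
      by apply: (@mem_at _ 1).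
    by apply: (@mem_at _ 2).
have F2 : forall g, g \in gens 0 w2 -> idl (gens 0 w1) g.
  have x1 : idl (gens 0 w1) (X c.+1) by apply: m1; apply: (@mem_at _ 0).
  have y1 : idl (gens 0 w1) (Y c.+1) by apply: m1; apply: (@mem_at _ 1).
  have x3 : idl (gens 0 w1) (X c.+3) by apply: m1; apply: (@mem_at _ 2).
  have y3 : idl (gens 0 w1) (Y c.+3) by apply: m1; apply: (@mem_at _ 3).
  apply: (@gens_prefix_closed _ _ _ [:: LI, LI & back w] _ hL); rewrite ?addn0.
    by move=> g; apply: idl_mem.
  move=> g; cbn [gens cat]; do 5!rewrite in_cons.
  case/predU1P => [->|]; first exact: fm_killr.
  case/predU1P => [->|]; first exact: fm_killl.
  case/predU1P => [->|]; first exact: fm_killr.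
  case/predU1P => [->|]; first exact: fm_killr.
  case/predU1P => [->|hg]; first exact: fm_killl.
  have mb : g \in gens c.+4 (back w) -> idl (gens 0 w1) g.
    by move=> h; apply: m1; apply: (@mem_from _ 4).
  case: (w) hw hg mb => [|[] w'] // _ hg mb.
  - move: hg; cbn [gens]; rewrite in_cons => /predU1P [->|//].
    exact: fm_killl.
  - move: hg; cbn [gens]; rewrite mem_cat => /orP [/mapP [j _ ->]|//].
    exact: fm_killl.
  - move: hg; cbn [gens cat]; do 4!rewrite in_cons.
    case/predU1P => [->|]; first exact: fm_killl.
    case/predU1P => [e|]; first by apply: mb; rewrite e; apply: (@mem_at _ 0).
    case/predU1P => [e|]; first by apply: mb; rewrite e; apply: (@mem_at _ 1).
    case/predU1P => [->|h]; first exact: fm_killl.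
    by apply: mb; apply: (@mem_from _ 2).
have F3 : equi (gens 0 w3) (f :: gens 0 w2).
  have e g : (g \in gens c [:: LE, LE, LN & w]) = (g \in f :: gens c (LD :: w)).
    exact (mem_k4 g (fm c c.+1) f (fm c c.+3) (fm c.+1 c.+2) (fm c.+1 c.+3)
      (fm c.+2 c.+3) (gens c.+3 w)).
  apply: equi_gen.
    apply: (@gens_prefix_closed _ _ _ (LD :: w) _ hL); rewrite ?addn0.
      by move=> g hg; apply/idl_consr/idl_mem.
    move=> g; rewrite e in_cons => /predU1P [->|/m2]; last exact: idl_consr.
    by apply/idl_mem; rewrite mem_head.
  move=> g; rewrite in_cons => /predU1P [->|]; first by apply: m3; rewrite e mem_head.
  move: g; apply: (@gens_prefix_closed _ _ _ [:: LE, LE, LN & w] _ hL); rewrite ?addn0.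
    by move=> g; apply: idl_mem.
  by move=> g hg; apply: m3; rewrite e in_cons hg orbT.
have hf : homog_deg f 2 := @homog_fm _ _.
have e : (c + wsize [:: LI, LI & back w] = c + wsize (LD :: w))%N.
  by rewrite /= sb; lia.
rewrite e in h1.
apply: (good_filt (k := 2) (s' := gens 0 w1) (f := f)) => //.
- exact: hseq_gens.
- by move=> l; apply: homog_ls.
- apply: idl_colon => //; case: h1 => h1 _.
  apply: (nzd_window hs1 hf h1) => M hM hsM; apply: nzd_windowD => //; apply: hM.
  + by apply: m1; apply: (@mem_at _ 0).
  + by apply: m1; apply: (@mem_at _ 1).
  + by apply: m1; apply: (@mem_at _ 2).
- exact: (good_equi F3 h2).
Qed.

Definition letters_le (x y : nat * nat) := (x.1 <= y.1)%N && (x.2 <= y.2)%N.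

Lemma tops_mono L w w' : letters_le (tops w) (tops w') ->
  letters_le (tops (L ++ w)) (tops (L ++ w')).
Proof.
move=> h; elim: L => // a L; rewrite /letters_le => /andP [h1 h2].
by case: a => /=; rewrite ?h1 ?h2 ?ltnS ?h1 // geq_max !leq_max !ltnS h2 h1 orbT.
Qed.

(** Letters for cliques and gaps combine the two numbers only by maxima and successors, so a common
    shift passes through them. *)
Lemma tops_shift L w w' k : all isNEI L ->
  tops w' = ((tops w).1 + k, (tops w).2 + k)%N ->
  tops (L ++ w') = ((tops (L ++ w)).1 + k, (tops (L ++ w)).2 + k)%N.
Proof.
move=> hL h; elim: L hL => [|a L IH] //= /andP [ha hL]; rewrite IH //=.
by case: a ha => //= _; rewrite addn_maxl.
Qed.

Lemma tops_clique k : tops (nseq k LE ++ [:: LN]) = (1, 0)%N.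
Proof. by elim: k => //= k ->. Qed.

Inductive block := BK (m : nat) | BC.

Definition bword (b : block) : seq letter :=
  if b is BK m then nseq (m - 2) LE ++ [:: LN] else [:: LC].

Definition words bs := flatten (map bword bs).

Definition bvalue (b : block) : nat := if b is BK _ then 1 else 2.

Definition values bs := sumn (map bvalue bs).

Definition large b := if b is BK m then (3 <= m)%N else true.

(** By the default value the empty list qualifies, which closes the induction when no block is left
    after a clique. *)
Definition ends_clique bs := if last (BK 3) bs is BC then false else true.

Lemma ends_clique_cons b bs :
  ends_clique (b :: bs) -> ends_clique bs.
Proof. by case: bs. Qed.

Lemma isNEI_nseq k : all isNEI (nseq k LE).
Proof. by elim: k. Qed.

Lemma goodw_NEI w t : all isNEI w -> (wsize w).+1 = n -> (tops w).1 = t -> goodw w t.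
Proof.
move=> h1 h2 <-; have [] := @good_NEI w 0 h1 h2.
by rewrite /U /= cats0.
Qed.

Lemma words_BK m bs L : L ++ words (BK m :: bs) = (L ++ nseq (m - 2) LE) ++ LN :: words bs.
Proof. by rewrite /words /= -!catA. Qed.

(** [L] is the part where no 4-cycle is left; the second claim starts from a block that already has
    its chord. The claims feed each other: adding the chord db leads from the first to the second,
    and replacing a chorded block by K4 leads back. Completing the neighbourhood of b consumes two
    blocks at once, so the induction is on a bound for the size. *)
Lemma goodw_blocks k bs : (size bs <= k)%N -> all large bs -> ends_clique bs ->
  (forall L, all isNEI L -> (wsize (L ++ LN :: words bs)).+1 = n ->
     goodw (L ++ LN :: words bs) ((tops (L ++ [:: LN])).1 + values bs)) /\
  (forall L, bs <> [::] -> all isNEI L -> closed_word L ->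
     (wsize (L ++ LD :: words bs)).+1 = n ->
     goodw (L ++ LD :: words bs) ((tops L).1 + (2 + values bs))).
Proof.
elim: k bs => [|k IH] [|b bs] //=.
- by move=> *; split=> // L hL hn; apply: goodw_NEI; rewrite ?all_cat ?hL ?addn0.
- by move=> *; split=> // L hL hn; apply: goodw_NEI; rewrite ?all_cat ?hL ?addn0.
rewrite ltnS => hk /andP [hb hbs] he; have he' := ends_clique_cons he.
have [IHA IHB] := IH bs hk hbs he'.
have hA L : all isNEI L -> (wsize (L ++ LN :: words (b :: bs))).+1 = n ->
    goodw (L ++ LN :: words (b :: bs)) ((tops (L ++ [:: LN])).1 + values (b :: bs)).
  move=> hL; case: b hb he => [m|] hb he.
    rewrite -[LN :: words _]/([:: LN] ++ words _) catA words_BK -[(L ++ _) ++ nseq _ _]catA => hn.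
    have -> : ((tops (L ++ [:: LN])).1 + values (BK m :: bs))%N =
        ((tops ((L ++ [:: LN] ++ nseq (m - 2) LE) ++ [:: LN])).1 + values bs)%N.
      rewrite -catA (@tops_shift L [:: LN] (([:: LN] ++ nseq (m - 2) LE) ++ [:: LN]) 1) //=; first by rewrite /values /=; lia.
      by rewrite tops_clique.
    by apply: IHA => //; rewrite !all_cat hL /= isNEI_nseq.
  have hbs0 : bs <> [::] by move=> e; rewrite e in he.
  rewrite -[words (BC :: bs)]/(LC :: words bs) => hn.
  (* An upper bound for the colon side suffices: the chorded quotient reaches 2 more than this
     bound. *)
  have [t' ht' g1] : exists2 t', (t' <= (tops (L ++ [:: LN])).1 + values bs)%N &
      goodw (L ++ [:: LI, LI & hat (words bs)]) t'.
    have hn' : (wsize (L ++ [:: LI, LI & hat (words bs)])).+1 = n.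
      by rewrite -hn !wsize_cat /= wsize_hat; lia.
    case: (bs) hk hbs he' hbs0 hn' => [//|b' bs'] hk' /= /andP [hb' hbs'] he1 _ hn'.
    have [A' B'] := IH bs' (ltnW hk') hbs' (ends_clique_cons he1).
    case: b' hb' hn' hk' he1 => [m|] hb' hn' hk' he1.
      have e : L ++ [:: LI, LI & hat (words (BK m :: bs'))] =
          (L ++ [:: LI, LI & nseq (m - 2) LE]) ++ LN :: words bs'.
        rewrite -catA /= -[nseq _ _ ++ _](words_BK m bs' [::]) /words /=.
        by case: (m - 2)%N.
      rewrite e in hn' *; eexists; last by apply: A' => //; rewrite all_cat hL /= isNEI_nseq.
      rewrite -catA [values (_ :: _)]/= addnA leq_add2r.
      have := @tops_mono L ([:: LI, LI & nseq (m - 2) LE] ++ [:: LN]) [:: LN; LN].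
      rewrite (@tops_shift L [:: LN] [:: LN; LN] 1) //= tops_clique => /(_ isT) /andP [].
      by rewrite /=.
    have e : L ++ [:: LI, LI & hat (words (BC :: bs'))] = (L ++ [:: LI; LI]) ++ LD :: words bs'.
      by rewrite -catA.
    rewrite e in hn' *; eexists; last first.
      apply: B' => //; first by move=> e1; rewrite e1 in he1.
        by rewrite all_cat hL.
      by rewrite /closed_word last_cat.
    rewrite [values (_ :: _)]/= leq_add2r.
    by have /andP [] := @tops_mono L [:: LI; LI] [:: LN] isT.
  have g2 := IHB (L ++ [:: LN]) hbs0; rewrite all_cat hL /closed_word last_cat /= -catA /= in g2.
  have {}g2 := g2 isT isT _.
  rewrite (_ : _ + _ = maxn (2 + t') ((tops (L ++ [:: LN])).1 + (2 + values bs)))%N; last first.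
    by rewrite /values /= -/(values bs); lia.
  by apply: goodw_C => //; apply: g2; rewrite -hn !wsize_cat.
split=> // L _ hL hLc hn; have hext : extends (words (b :: bs)).
  by case: (b) => // m; rewrite /words /=; case: (m - 2)%N.
have hLE : all isNEI (L ++ [:: LE; LE]) by rewrite all_cat hL.
have g2 := hA _ hLE; rewrite -!catA /= in g2.
(* The colon side attains the maximum: over [L] and the later blocks it adds 2, whereas the K4 adds
   at most 1. *)
rewrite (_ : _ + _ = maxn (2 + ((tops L).1 + values (b :: bs)))
  ((tops (L ++ [:: LE; LE; LN])).1 + values (b :: bs)))%N; last first.
  have /andP [h1 _] := @tops_mono L [:: LE; LE; LN] [:: LI; LN] isT.
  rewrite (@tops_shift L [::] [:: LI; LN] 1 hL erefl) cats0 /= in h1.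
  by lia.
apply: goodw_D => //; last 1 first.
  by apply: g2; rewrite -hn !wsize_cat /=; lia.
have hn' : (wsize (L ++ [:: LI, LI & back (words (b :: bs))])).+1 = n.
  by rewrite -hn !wsize_cat /= (wsize_back hext); lia.
case: b hb he hn hn' {hA g2 hext} => [m|] hb he hn hn'.
  (* The clique loses b; since m is at least 3 it keeps an edge and thus its value 1. *)
  have e : L ++ [:: LI, LI & back (words (BK m :: bs))] =
      (L ++ [:: LI, LI & nseq (m - 3) LE]) ++ LN :: words bs.
    rewrite -catA /= -/(cat _ _) /words /= (_ : m - 2 = (m - 3).+1)%N //=; last by move: hb => /=; lia.
    by rewrite -catA.
  rewrite e; have -> : ((tops L).1 + values (BK m :: bs))%N =
      ((tops ((L ++ [:: LI, LI & nseq (m - 3) LE]) ++ [:: LN])).1 + values bs)%N.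
    rewrite -catA -[in LHS](cats0 L) (@tops_shift L [::] ([:: LI, LI & nseq (m - 3) LE] ++ [:: LN]) 1) //=; first by rewrite /values /=; lia.
    by rewrite tops_clique.
  apply: IHA; first by rewrite all_cat hL /= isNEI_nseq.
  by rewrite -e.
(* A 4-cycle without b is a path with two edges, again of value 2. *)
have e : L ++ [:: LI, LI & back (words (BC :: bs))] = (L ++ [:: LI; LI; LN]) ++ LN :: words bs.
  by rewrite -catA.
rewrite e; have -> : ((tops L).1 + values (BC :: bs))%N =
    ((tops ((L ++ [:: LI; LI; LN]) ++ [:: LN])).1 + values bs)%N.
  by rewrite -catA -[in LHS](cats0 L) (@tops_shift L [::] [:: LI; LI; LN; LN] 2) //=; rewrite /values /=; lia.
apply: IHA; first by rewrite all_cat hL.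
by rewrite -e.
Qed.

Lemma goodw_words m bs : all large bs -> ends_clique bs ->
  (wsize (words (BK m :: bs))).+1 = n ->
  goodw (words (BK m :: bs)) (values (BK m :: bs)).
Proof.
move=> hbs he; have [hA _] := goodw_blocks (leqnn (size bs)) hbs he.
rewrite -[words (BK m :: bs)]cat0s words_BK cat0s => hn.
have := hA _ (isNEI_nseq (m - 2)) hn; by rewrite tops_clique.
Qed.

(** * Completing the linear forms to generators of the maximal ideal *)

Definition ks k : seq S := [seq Y i | i <- iota 0 k].

Lemma mem_lt p k g : g \in lt p k ->
  g = Y (p + k) \/ exists2 i, (p <= i < p + k)%N & g = X i.+1 - Y i.
Proof.
elim: k p => [|k IH] p /=; first by rewrite inE addn0 => /eqP ->; left.
rewrite in_cons => /predU1P [->|/IH [->|[i hi ->]]].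
- by right; exists p => //; lia.
- by left; rewrite addSnnS.
- by right; exists i => //; lia.
Qed.

Lemma lt_mem p k : Y (p + k) \in lt p k /\
  forall i, (p <= i < p + k)%N -> X i.+1 - Y i \in lt p k.
Proof.
elim: k p => [|k IH] p /=.
  by rewrite addn0 mem_head; split=> // i; lia.
have [h1 h2] := IH p.+1; split; first by rewrite in_cons -addSnnS h1 orbT.
move=> i hi; have [->|ne] := eqVneq i p; first by rewrite mem_head.
by rewrite in_cons h2 ?orbT //; lia.
Qed.

Definition upd (k : 'I_N) (q : S) (h : 'I_N -> S) : 'I_N -> S :=
  fun x => if x == k then q else h x.

(** The hypothesis on [T] expresses that it involves only X_0, ..., X_p and Y_0, ..., Y_(p-1). In
    this form it passes to [T] with X_(p+1) - Y_p added, and that form is killed by X_(p+1) :=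
    Y_p. *)
Lemma regseq_lt p k T : (p + k).+1 = n ->
  (forall h, (forall i, (i <= p)%N -> h (xi i) = X i) -> (forall i, (i < p)%N -> h (yi i) = Y i) ->
     forall g, g \in T -> subst h g = g) ->
  regseq T (lt p k).
Proof.
elim: k p T => [|k IH] p T hn hT /=.
  split=> //; apply: nzd_var; apply: hT => i hi; rewrite /kill; case: eqP => // e.
    by case: (@xi_yi i p) => //; lia.
  by have := yi_inj _ _ e; lia.
have hp : (p.+1 < n)%N by lia.
pose h := upd (xi p.+1) (Y p) (fun x => 'X_x).
have hx i : (i <= p)%N -> h (xi i) = X i.
  by move=> hi; rewrite /h /upd; case: eqP => // /xi_inj e; have := e _ _; lia.
have hy i : (i < n)%N -> h (yi i) = Y i.
  by move=> hi; rewrite /h /upd; case: eqP => // e; case: (@xi_yi p.+1 i).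
have e1 : subst h (X p.+1) = Y p by rewrite substX /h /upd eqxx.
split.
  apply: (@nzd_subst _ _ T h).
  - apply/eqP => /(congr1 (mcoeff U_(xi p.+1)%MM)).
    rewrite mcoeffB mcoeff0 !mcoeffXU eqxx; case: eqP => [e|_]; last first.
      by rewrite subr0 => /eqP; rewrite oner_eq0.
    by case: (@xi_yi p.+1 p) => //; lia.
  - by rewrite rmorphB /= e1 [subst h (Y p)]substX hy ?subrr //; lia.
  - by apply: hT => i hi; [apply: hx|apply: hy; lia].
  - move=> j; rewrite /h /upd; case: eqP => [->|_]; last by rewrite subrr; apply: idl0.
    by apply: idl_mem; rewrite mem_head.
apply: IH => [|h' hx' hy' g]; first lia.
rewrite in_cons => /predU1P [->|hg].
  by rewrite rmorphB /= [subst h' (X _)]substX [subst h' (Y _)]substX hx' // hy'.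
by apply: hT hg => i hi; [apply: hx'|apply: hy']; lia.
Qed.

Lemma regseq_ls k : k.+1 = n -> regseq [::] (ls 0 k).
Proof.
move=> hn; split; first by apply: nzd_var.
by apply: regseq_lt => // h hx _ g; rewrite inE => /eqP ->; rewrite substX hx.
Qed.

(** The two sequences have k+2 and k members, together as many as there are variables for k+1
    vertices. *)
Lemma regseq_ls_ks k : k.+1 = n -> regseq [::] (ls 0 k ++ ks k).
Proof.
move=> hn; apply/regseq_cat; split; first exact: regseq_ls.
suff H m j T : (j + m)%N = k ->
    (forall g, g \in T -> (exists2 i, (i <= k)%N && ((i < j) || (i == k))%N & g = Y i) \/
       g = X 0 \/ exists2 i, (i < k)%N & g = X i.+1 - Y i) ->
    regseq T [seq Y i | i <- iota j m].
  apply: (H k 0%N) => // g; rewrite catrevE cats0 mem_rev in_cons => /predU1P [->|/mem_lt [->|[i hi ->]]].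
  - by right; left.
  - by left; exists k => //; rewrite leqnn eqxx orbT.
  - by right; right; exists i.
elim: m j T => [//|m IH] j T hj hT /=; split; last first.
  apply: IH => [|g]; first by rewrite addSnnS.
  rewrite in_cons => /predU1P [->|/hT [[i hi ->]|h]]; last by right.
    by left; exists j => //; lia.
  by left; exists i => //; lia.
(* Y_j goes to 0, and X_(j+1) to X_(j+1) - Y_j in order to fix the difference X_(j+1) - Y_j. *)
pose h := upd (yi j) 0 (upd (xi j.+1) (X j.+1 - Y j) (fun x => 'X_x)).
have hx i : (i < n)%N -> i != j.+1 -> h (xi i) = X i.
  move=> hi /eqP ne; rewrite /h /upd; case: eqP => [e|_].
    by case: (@xi_yi i j) => //; lia.
  by case: eqP => // /xi_inj e; case: ne; apply: e => //; lia.
have hxj : h (xi j.+1) = X j.+1 - Y j.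
  rewrite /h /upd eqxx; case: eqP => // e.
  by case: (@xi_yi j.+1 j) => //; lia.
have hy i : (i < n)%N -> i != j -> h (yi i) = Y i.
  move=> hi /eqP ne; rewrite /h /upd; case: eqP => [/yi_inj e|_]; first by case: ne; apply: e => //; lia.
  by case: eqP => // e; case: (@xi_yi j.+1 i) => //; lia.
have hyj : h (yi j) = 0 by rewrite /h /upd eqxx.
apply: (@nzd_subst _ _ T h); first exact: mpolyXU_neq0; first by rewrite substX.
- move=> g /hT [[i hi ->]|[->|[i hi ->]]].
  + by rewrite substX hy //; lia.
  + by rewrite substX hx //; lia.
  + rewrite rmorphB /= [subst h (X _)]substX [subst h (Y _)]substX.
    have [->|ne] := eqVneq i j; first by rewrite hxj hyj subr0.
    by rewrite hx ?hy //; lia.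
- have hY : idl [:: Y j] (Y j) by apply: idl_mem; rewrite mem_head.
  move=> i; rewrite /h /upd; case: eqP => [->|_]; first by rewrite subr0.
  case: eqP => [->|_]; last by rewrite subrr; apply: idl0.
  by rewrite opprB addrC subrK.
Qed.

Lemma idl_ls_ks k : k.+1 = n -> forall x, idl (ls 0 k ++ ks k) 'X_x.
Proof.
move=> hn x; have [h1 h2] := lt_mem 0 k.
have hy j : (j < n)%N -> idl (ls 0 k ++ ks k) (Y j).
  move=> hj; apply: idl_mem; rewrite mem_cat in_cons; have [->|ne] := eqVneq j k.
    by rewrite h1 orbT.
  by apply/orP; right; apply: map_f; rewrite mem_iota; lia.
have [[|j] hj [->|->]] := xi_yi_full x; try exact: hy.
  by apply: idl_mem; rewrite mem_head.
rewrite -/(X j.+1) -(subrK (Y j) (X j.+1)); apply: idlD; last by apply: hy; lia.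
by apply: idl_mem; rewrite mem_cat in_cons h2 ?orbT //; lia.
Qed.

Lemma homog_ls_ks k l : l \in ls 0 k ++ ks k -> homog_deg l 1.
Proof.
rewrite mem_cat => /orP [/homog_ls //|/mapP [j _ ->]]; exact: homogY.
Qed.

(** Meant for the words that describe a given graph; [LI] and [LD] arise only inside the reductions
    and get the empty list as a default. *)
Fixpoint wedges p w : seq (nat * nat) :=
  match w with
  | [::] => [::]
  | LN :: w' => (p, p.+1) :: wedges p.+1 w'
  | LE :: w' => [seq (p, j) | j <- cl p.+1 w'] ++ wedges p.+1 w'
  | LC :: w' => [:: (p, p.+1); (p.+1, p.+2); (p.+2, p.+3); (p, p.+3)] ++ wedges p.+3 w'
  | _ => [::]
  end.

Definition isNEC (a : letter) := match a with LN | LE | LC => true | _ => false end.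

Lemma gens_wedges p w : all isNEC w -> gens p w = [seq fm e.1 e.2 | e <- wedges p w].
Proof.
elim: w p => [//|a w IH] p /= /andP [ha hw]; case: a ha => //= _; rewrite ?map_cat ?IH //.
by rewrite -map_comp.
Qed.

End Words.

(** * Regularity from a regular sequence *)

Section VectorIdeals.
Variables (K : fieldType) (N : nat).
Notation S := {mpoly K[N]}.
Implicit Types (T : seq S).

Definition vin T r (v : 'rV[S]_r) : Prop := forall a, idl T (v 0 a).

Lemma vinD T r (v w : 'rV[S]_r) : vin T v -> vin T w -> vin T (v + w).
Proof. by move=> hv hw a; rewrite mxE; apply: idlD. Qed.

Lemma vinN T r (v : 'rV[S]_r) : vin T v -> vin T (- v).
Proof. by move=> hv a; rewrite mxE; apply: idlN. Qed.

Lemma vinB T r (v w : 'rV[S]_r) : vin T v -> vin T w -> vin T (v - w).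
Proof. by move=> hv hw; apply: vinD => //; apply: vinN. Qed.

Lemma vin0 T r : vin T (0 : 'rV[S]_r).
Proof. by move=> a; rewrite mxE; apply: idl0. Qed.

Lemma vinZ T r (v : 'rV[S]_r) c : vin T v -> vin T (c *: v).
Proof. by move=> hv a; rewrite mxE; apply: idlM. Qed.

Lemma vinM T r q (v : 'rV[S]_r) (A : 'M[S]_(r, q)) : vin T v -> vin T (v *m A).
Proof.
move=> hv a; rewrite mxE; elim/big_ind: _ => [|*|b _]; [exact: idl0|exact: idlD|].
by rewrite mulrC; apply: idlM.
Qed.

Lemma vin_consr T l r (v : 'rV[S]_r) : vin T v -> vin (l :: T) v.
Proof. by move=> hv a; apply: idl_consr. Qed.

Lemma vin_consl T l r (v : 'rV[S]_r) : vin (l :: T) (l *: v).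
Proof. by move=> a; rewrite mxE mulrC; apply/idlM/idl_mem; rewrite mem_head. Qed.

Lemma vin_cons T l r (v : 'rV[S]_r) : vin (l :: T) v ->
  exists y z : 'rV[S]_r, vin T z /\ v = l *: y + z.
Proof.
move=> hv; have /fin_all_exists [y hy] a : exists y, idl T (v 0 a - y * l) by exact: hv.
exists (\row_a y a), (v - l *: \row_a y a); split; last by rewrite addrC subrK.
by move=> a; rewrite !mxE mulrC.
Qed.

Lemma nzd_vin T l r (v : 'rV[S]_r) : nzd T l -> vin T (l *: v) -> vin T v.
Proof. by move=> hn hv a; apply: hn; have := hv a; rewrite mxE. Qed.

(** The homogeneous elements of degree d in the direct sum of the S(- dg a). *)
Definition hvec r (dg : 'I_r -> int) (d : int) (v : 'rV[S]_r) : Prop :=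
  forall a, homog_deg (v 0 a) (d - dg a).

Definition hcv r (dg : 'I_r -> int) (d : int) (v : 'rV[S]_r) : 'rV[S]_r :=
  \row_a hcomp (d - dg a) (v 0 a).

Lemma hvec_hcv r (dg : 'I_r -> int) d v : hvec dg d (hcv dg d v).
Proof. by move=> a; rewrite mxE; apply: hcomp_homog. Qed.

Lemma hcv_id r (dg : 'I_r -> int) d v : hvec dg d v -> hcv dg d v = v.
Proof. by move=> h; apply/rowP => a; rewrite mxE hcomp_id. Qed.

Lemma hcvB r (dg : 'I_r -> int) d v w : hcv dg d (v - w) = hcv dg d v - hcv dg d w.
Proof. by apply/rowP => a; rewrite !mxE linearB. Qed.

Lemma hcvM r q (dg : 'I_r -> int) (dh : 'I_q -> int) (A : 'M[S]_(r, q)) d v :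
  (forall a b, homog_deg (A a b) (dg a - dh b)) ->
  hcv dh d (v *m A) = hcv dg d v *m A.
Proof.
move=> hA; apply/rowP => b; rewrite !mxE linear_sum /=; apply: eq_bigr => a _.
rewrite mxE mulrC (hcompM _ _ (hA a b)) mulrC; congr (hcomp _ _ * _).
by ring.
Qed.

Lemma vin_hcv T r (dg : 'I_r -> int) d v : hseq T -> vin T v -> vin T (hcv dg d v).
Proof. by move=> hT hv a; rewrite mxE; apply: idl_hcomp. Qed.

Lemma hvecB r (dg : 'I_r -> int) d v w : hvec dg d v -> hvec dg d w -> hvec dg d (v - w).
Proof. by move=> hv hw a; rewrite !mxE; apply: homog_degB. Qed.

Lemma hvecZ r (dg : 'I_r -> int) d l v : homog_deg l 1 -> hvec dg (d - 1) v -> hvec dg d (l *: v).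
Proof.
move=> hl hv a; rewrite mxE (_ : d - dg a = 1 + (d - 1 - dg a)); last by ring.
exact: homog_degM.
Qed.

Lemma hvec_mul r q (dg : 'I_r -> int) (dh : 'I_q -> int) (A : 'M[S]_(r, q)) d v :
  (forall a b, homog_deg (A a b) (dg a - dh b)) -> hvec dg d v -> hvec dh d (v *m A).
Proof. by move=> hA hv; rewrite -(hcv_id hv) -(hcvM _ _ hA); apply: hvec_hcv. Qed.

Lemma hvec_cons T l r (dg : 'I_r -> int) d (v : 'rV[S]_r) : hseq T -> homog_deg l 1 ->
  hvec dg d v -> vin (l :: T) v ->
  exists y z : 'rV[S]_r, [/\ hvec dg (d - 1) y, vin T z & v = l *: y + z].
Proof.
move=> hT hl hv /vin_cons [y [z [hz e]]].
exists (hcv dg (d - 1) y), (hcv dg d z); split; [exact: hvec_hcv|exact: vin_hcv|].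
rewrite -(hcv_id hv) e; apply/rowP => a; rewrite !mxE linearD /= (hcompM _ _ hl).
by congr (_ * hcomp _ _ + _); ring.
Qed.

End VectorIdeals.

Section TorModulo.
Variables (K : fieldType) (N : nat).
Notation S := {mpoly K[N]}.
Variables (s : seq S) (F : graded_free_complex K N).
Hypothesis hF : resolves (idl s) F.
Implicit Types (T ls : seq S) (i : nat) (d : int).

Notation rk := (gfrank F).
Notation dg i := (@gfdeg _ _ F i).

Lemma hdiff i a b : homog_deg (gfdiff F i a b) (dg i.+1 a - dg i b).
Proof. by case: hF => -[_ h] _ _ _; apply: h. Qed.

Lemma diff_diff i (w : 'rV_(rk i.+2)) : w *m gfdiff F i.+1 *m gfdiff F i = 0.
Proof. by case: hF => _ _ _ h; apply/h; exists w. Qed.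

(* F (x) S/T, its cycles and boundaries; [vanish T i d] says that
   H_i (F (x) S/T) = Tor_i (S/s, S/T) is zero in degree d. *)
Definition cyc T i : 'rV[S]_(rk i) -> Prop :=
  match i with
  | 0 => fun _ => True
  | i'.+1 => fun u => vin T (u *m gfdiff F i')
  end.

Definition bnd T i (u : 'rV[S]_(rk i)) : Prop :=
  exists w, vin T (u - w *m gfdiff F i).

Definition vanish T i d : Prop :=
  forall u, hvec (dg i) d u -> cyc T u -> bnd T u.

Lemma bnd_homog T i d u : hseq T -> hvec (dg i) d u -> bnd T u ->
  exists2 w, hvec (dg i.+1) d w & vin T (u - w *m gfdiff F i).
Proof.
move=> hT hu [w hw]; exists (hcv (dg i.+1) d w); first exact: hvec_hcv.
rewrite -(hcvM _ _ (@hdiff i)) -{1}(hcv_id hu) -hcvB.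
exact: vin_hcv.
Qed.

Lemma vanish_step T l i d : hseq T -> homog_deg l 1 -> nzd T l ->
  vanish T i.+1 d ->
  (forall v, hvec (dg i) (d - 1) v -> cyc T v -> bnd T (l *: v) -> bnd T v) ->
  vanish (l :: T) i.+1 d.
Proof.
move=> hT hl nl hv hinj u hu /= hc.
have hud := hvec_mul (@hdiff i) hu.
have [v [z [hv1 hz e]]] := hvec_cons hT hl hud hc.
have cv : cyc T v.
  case: i {hv hinj} u hu hc hud v z hv1 hz e => [//|i] u hu hc hud v z hv1 hz e /=.
  apply: (nzd_vin nl); rewrite scalemxAl.
  have -> : l *: v = u *m gfdiff F i.+1 - z by rewrite e addrK.
  by rewrite mulmxBl diff_diff sub0r; apply/vinN/vinM.
have hb : bnd T (l *: v) by exists u; rewrite e opprD addrA subrr sub0r; apply: vinN.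
have [w hw1 hw2] := bnd_homog hT hv1 (hinj v hv1 cv hb).
have [||y hy] := hv (u - l *: w).
- by apply: hvecB => //; apply: hvecZ.
- rewrite /= mulmxBl e -scalemxAl addrAC -scalerBr.
  by apply: vinD => //; apply: vinZ.
exists y; rewrite -(subrK (l *: w) (u - y *m _)).
by apply: vinD; [apply: vin_consr; rewrite addrAC|apply: vin_consl].
Qed.

Lemma vanish_step0 T l d : vanish T 0 d -> vanish (l :: T) 0 d.
Proof.
by move=> h u hu _; have [w hw] := h u hu I; exists w; apply: vin_consr.
Qed.

(** The same sequence one place further: a class of H_i in degree d is killed by l, since H_i
    vanishes in degree d + 1, so it comes from H_(i+1) modulo l. *)
Lemma nonvanish_step T l i d : hseq T -> homog_deg l 1 -> nzd T l ->
  vanish T i (d + 1) -> vanish (l :: T) i.+1 (d + 1) -> vanish T i d.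
Proof.
move=> hT hl nl h1 h2 v hv cv.
have hlv : hvec (dg i) (d + 1) (l *: v) by apply: hvecZ => //; rewrite addrK.
have clv : cyc T (l *: v).
  by case: (i) v cv {hv hlv h1} => [//|j] v /= cv; rewrite -scalemxAl; apply: vinZ.
have [w hw1 hw2] := bnd_homog hT hlv (h1 _ hlv clv).
have [|z hz] := h2 w hw1.
  rewrite /= -(subKr (l *: v) (w *m _)); apply: vinB; first exact: vin_consl.
  exact: vin_consr.
have [y [x [hx e]]] := vin_cons hz.
exists y; apply: (nzd_vin nl); rewrite scalerBr scalemxAl.
have -> : l *: y = w - z *m gfdiff F i.+1 - x by rewrite e addrK.
rewrite !mulmxBl diff_diff subr0 opprB addrCA addrC.
by apply: vinD => //; apply: vinM.
Qed.

(** The augmentation identifies H_0 of F modulo T with S/(T + s). *)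
Lemma bnd0 T u : bnd T u <-> idl (T ++ s) ((u *m gfaug F) 0 0).
Proof.
have [_ hs hk _] := hF.
have sT p : idl T p -> idl (T ++ s) p by apply: idl_subseq => x; rewrite mem_cat => ->.
have ss p : idl s p -> idl (T ++ s) p by apply: idl_subseq => x; rewrite mem_cat orbC => ->.
have augB (v w : 'rV[S]_(rk 0)) : ((v - w) *m gfaug F) 0 0 = (v *m gfaug F) 0 0 - (w *m gfaug F) 0 0.
  by rewrite mulmxBl !mxE.
split=> [[w hw]|].
  rewrite -(subrK ((w *m gfdiff F 0 *m gfaug F) 0 0) ((u *m _) 0 0)) -augB.
  apply: idlD; first by apply: sT; apply: vinM.
  by apply/ss/hk; exists w.
suff h p : idl (T ++ s) p -> exists2 v : 'rV[S]_(rk 0), vin T v & idl s (p - (v *m gfaug F) 0 0).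
  move=> /h [v hv hp]; rewrite -augB in hp; have [w hw] := (hk _).1 hp.
  by exists w; rewrite -hw subKr.
elim: T p {sT ss} => [|g T IH] p /=.
  by exists 0; [apply: vin0|rewrite mul0mx mxE subr0].
move=> [a /IH [v hv hp]]; have [x hx] := hs a.
exists (g *: x + v); first by apply: vinD; [apply: vin_consl|apply: vin_consr].
rewrite mulmxDl -scalemxAl !mxE.
rewrite !mxE in hx hp; set A := \sum_j _ in hx *; set B := \sum_j _ in hp *.
rewrite (_ : _ - _ = g * (a - A) + (p - a * g - B)); last by ring.
by apply: idlD => //; apply: idlM.
Qed.

(** [vanish_step] asks that the new form act injectively on H_i: on H_0 = S/(T + s) this is
    regularity there, on the higher H_i it follows from vanishing. *)
Lemma vanish_regseq ls T : hseq T -> (forall l, l \in ls -> homog_deg l 1) ->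
  regseq T ls -> regseq (T ++ s) ls ->
  (forall i d, vanish T i.+1 d) -> forall i d, vanish (catrev ls T) i.+1 d.
Proof.
elim: ls T => [//|l ls IH] T hT hl /= [n1 r1] [n2 r2] h.
have hl1 : homog_deg l 1 by apply: hl; rewrite mem_head.
apply: IH => //; first exact: hseq_cons hl1 hT.
  by move=> x hx; apply: hl; rewrite inE hx orbT.
move=> i d; apply: vanish_step => // v hv cv.
case: i v hv cv => [|i] v hv cv hb; last exact: h hv cv.
apply/bnd0/n2; move/bnd0: hb; rewrite -scalemxAl mxE.
by [].
Qed.

(** F is exact in positive degrees, so modulo [ls] only H_0 survives; it is the Artinian quotient by
    [ls] and [s], with top degree t. *)
Lemma vanish_regseq_top ls (t : nat) : hseq s -> (forall l, l \in ls -> homog_deg l 1) ->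
  regseq [::] ls -> regseq s ls -> top (catrev ls s) t ->
  (forall i d, i%:Z + t%:Z < d -> vanish (catrev ls [::]) i d) /\
  ~ vanish (catrev ls [::]) 0 t%:Z.
Proof.
move=> hsh hl r1 r2 [ht [p hp hn]]; have [[haug _] hs hk hex] := hF.
have e : catrev ls s = catrev ls [::] ++ s by rewrite !catrevE cats0.
have hdeg u d : hvec (dg 0) d u -> homog_deg ((u *m gfaug F) 0 0) d.
  move=> hu; rewrite mxE; apply: homog_deg_sum => a _.
  by rewrite -(subrK (dg 0 a) d); apply: homog_degM.
split=> [[|i] d hd|].
- by move=> u /hdeg hu _; apply/bnd0; rewrite -e; apply: ht hu; rewrite add0r in hd.
- apply: vanish_regseq => // j d' u hu cu; have [w hw] : exists w, u = w *m gfdiff F j.+1.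
    by apply/hex/rowP => a; rewrite [RHS]mxE; apply: cu.
  by exists w; rewrite -hw subrr; apply: vin0.
move=> h; have [u hu] := hs p.
pose u' := hcv (dg 0) t%:Z u.
have hu' : idl s (p - (u' *m gfaug F) 0 0).
  have := idl_hcomp t%:Z hsh hu; rewrite linearB /= hcomp_id //.
  suff -> : hcomp t (( u *m gfaug F) 0 0) = (u' *m gfaug F) 0 0 by [].
  rewrite !mxE linear_sum /=; apply: eq_bigr => a _.
  by rewrite mulrC (hcompM _ _ (haug a)) mulrC mxE.
have /bnd0 := h u' (@hvec_hcv K N _ (dg 0) t%:Z u) I; rewrite -e => h'; apply: hn.
rewrite -(subrK ((u' *m gfaug F) 0 0) p); apply: idlD => //.
by apply: idl_subseq hu' => x hx; rewrite catrevE mem_cat hx orbT.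
Qed.

(** Multiplication by a form sends the top class of H_e, in degree e + t, into a degree where H_e
    vanishes; so it lifts to a class of H_(e+1) in degree e + t + 1. *)
Lemma vanish_tail ls T (e t : nat) : hseq T -> (forall l, l \in ls -> homog_deg l 1) ->
  regseq T ls -> (forall i d, i%:Z + t%:Z < d -> vanish T i d) ->
  ~ vanish T e (e%:Z + t%:Z) ->
  (forall i d, i%:Z + t%:Z < d -> vanish (catrev ls T) i d) /\
  ~ vanish (catrev ls T) (size ls + e) ((size ls + e)%:Z + t%:Z).
Proof.
elim: ls T e => [//|l ls IH] T e hT hl /= [n1 r1] h1 h2.
have hl1 : homog_deg l 1 by apply: hl; rewrite mem_head.
rewrite !addSnnS; apply: IH => //; first exact: hseq_cons hl1 hT.
- by move=> x hx; apply: hl; rewrite inE hx orbT.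
- case=> [|i] d hd; first by apply/vanish_step0/h1.
  apply: vanish_step => //; first exact: h1.
  by move=> v hv cv _; apply: h1 hv cv; lia.
- have -> : e.+1%:Z + t%:Z = e%:Z + t%:Z + 1 by lia.
  by move=> h; apply: h2; apply: nonvanish_step h => //; apply: h1; lia.
Qed.

Definition cst r (u : 'rV[S]_r) : 'rV[K]_r := map_mx (mcoeff 0%MM) u.
Definition inc r (x : 'rV[K]_r) : 'rV[S]_r := map_mx (@mpolyC N K) x.

Lemma cst_inc r (x : 'rV[K]_r) : cst (inc x) = x.
Proof. by apply/rowP => a; rewrite !mxE mcoeffC eqxx mulr1. Qed.

Lemma cstM i (u : 'rV[S]_(rk i.+1)) : cst (u *m gfdiff F i) = cst u *m diff_K F i.
Proof. exact: map_mxM. Qed.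

Lemma cstB r (u v : 'rV[S]_r) : cst (u - v) = cst u - cst v.
Proof. exact: map_mxB. Qed.

Section Residue.
Variable T : seq S.
Hypothesis hT : forall p, idl T p <-> p@_0%MM = 0.

Lemma vin_cst r (u : 'rV[S]_r) : vin T u <-> cst u = 0.
Proof.
split=> [h|h a]; first by apply/rowP => a; rewrite !mxE; apply/hT.
by apply/hT; have := congr1 (fun v : 'rV_r => v 0 a) h; rewrite !mxE.
Qed.

Lemma cyc_cst i (u : 'rV[S]_(rk i)) : cyc T u <-> (cst u <= cycles_K F i)%MS.
Proof.
case: i u => [|i] u /=; first by rewrite submx1.
rewrite vin_cst cstM; split; first by move=> h; apply/sub_kermxP.
by move/sub_kermxP.
Qed.

Lemma bnd_cst i (u : 'rV[S]_(rk i)) : bnd T u <-> (cst u <= diff_K F i)%MS.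
Proof.
split=> [[w /vin_cst]|/submxP [x hx]].
  by rewrite cstB cstM => /subr0_eq ->; apply: submxMl.
by exists (inc x); apply/vin_cst; rewrite cstB cstM cst_inc hx subrr.
Qed.

Lemma hvec_cst i d (u : 'rV[S]_(rk i)) : hvec (dg i) d u ->
  (cst u <= degree_part F i d)%MS.
Proof.
move=> hu; suff -> : cst u = cst u *m degree_part F i d by apply: submxMl.
apply/rowP => a; rewrite mul_mx_diag !mxE; case: eqP => [|/eqP ne]; first by rewrite mulr1.
rewrite mulr0; apply: homog_deg_const (hu a).
by apply: contra ne; rewrite subr_eq0 eq_sym.
Qed.

Lemma hvec_inc i d (x : 'rV[K]_(rk i)) : (x <= degree_part F i d)%MS ->
  hvec (dg i) d (inc x).
Proof.
move=> /submxP [y ->] a; rewrite mxE mul_mx_diag !mxE.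
case: eqP => [->|_]; first by rewrite subrr; apply: homog_degC.
by rewrite mulr0 mpolyC0; apply: homog_deg0.
Qed.

Lemma diff_sub_cycles i : (diff_K F i <= cycles_K F i)%MS.
Proof.
case: i => [|i] /=; first exact: submx1.
apply/sub_kermxP; rewrite -map_mxM.
suff -> : gfdiff F i.+1 *m gfdiff F i = 0 by rewrite map_mx0.
by apply/row_matrixP => a; rewrite row0 rowE mulmxA diff_diff.
Qed.

Lemma vanish_homology i d : vanish T i d <-> homology_dim F i d = 0%N.
Proof.
rewrite /homology_dim; split=> [h|/eqP].
  apply/eqP; rewrite subn_eq0; apply: mxrankS; rewrite sub_capmx capmxSr andbT.
  apply/row_subP => a; set x := row a _.
  have hx : (x <= cycles_K F i :&: degree_part F i d)%MS := row_sub _ _.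
  move: hx; rewrite sub_capmx => /andP [h1 h2].
  have [] := h _ (hvec_inc h2).
    by apply/cyc_cst; rewrite cst_inc.
  by move=> w hw; rewrite -(cst_inc x); apply/bnd_cst; exists w.
(* The difference of ranks is truncated, so it gives only an inequality; the inclusion of boundaries
   in cycles turns it into equality of the two spaces. *)
rewrite subn_eq0 => hr u hu /cyc_cst cu; apply/bnd_cst.
have hs : (diff_K F i :&: degree_part F i d <= cycles_K F i :&: degree_part F i d)%MS.
  by apply: capmxS => //; apply: diff_sub_cycles.
have := mxrank_leqif_sup hs; rewrite /leqif eqn_leq hr (mxrankS hs) => -[_ /esym he].
have : (cst u <= cycles_K F i :&: degree_part F i d)%MS by rewrite sub_capmx cu hvec_cst.
by move=> /submx_trans /(_ he); rewrite sub_capmx => /andP [].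
Qed.

End Residue.

End TorModulo.

Lemma resolves_iff (K : fieldType) (N : nat) (J J' : {mpoly K[N]} -> Prop)
    (F : graded_free_complex K N) :
  (forall p, J p <-> J' p) -> resolves J F -> resolves J' F.
Proof.
move=> hJ [h1 h2 h3 h4]; split=> // [p|u]; last by rewrite -h3 hJ.
by have [u /hJ] := h2 p; exists u.
Qed.

(* Modulo [ls] a resolution of S/s becomes one of the Artinian reduction, whose
   top class sits in degree t; killing each of the further linear forms [ks],
   until K is left, raises both the homological and the internal degree of that
   class by one. *)
Lemma regularity_regseq (K : fieldType) (N : nat) (J : {mpoly K[N]} -> Prop)
    (s ls ks : seq {mpoly K[N]}) (t : nat) :
  (forall p, J p <-> idl s p) -> (exists F : graded_free_complex K N, resolves (idl s) F) ->
  hseq s -> (forall l, l \in ls ++ ks -> homog_deg l 1) ->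
  regseq [::] (ls ++ ks) -> (forall k, idl (ls ++ ks) 'X_k) ->
  good s ls t -> regularity J t.
Proof.
move=> hJ [F0 hF0] hs hl hr hall [r2 ht].
have hres F : resolves J F -> resolves (idl s) F by apply: resolves_iff.
have [r1 r3] := (regseq_cat _ _ _).1 hr.
have hl1 l : l \in ls -> homog_deg l 1 by move=> h; apply: hl; rewrite mem_cat h.
have hl2 l : l \in ks -> homog_deg l 1 by move=> h; apply: hl; rewrite mem_cat h orbT.
have hT1 : hseq (catrev ls [::]).
  by apply: hseq_catrev => // l /hl1; exists 1.
pose T := catrev ks (catrev ls [::]).
have eT : T =i ls ++ ks.
  by move=> x; rewrite /T !catrevE cats0 !mem_cat !mem_rev orbC.
have hT p : idl T p <-> p@_0%MM = 0.
  rewrite (equi_mem eT); split=> [|h]; last exact: idl_max.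
  by apply: idl_const => g /hl; apply: homog_deg_const.
have key F : resolves (idl s) F ->
    (forall i (d : int), i%:Z + t%:Z < d -> vanish F T i d) /\
    ~ vanish F T (size ks) ((size ks)%:Z + t%:Z).
  move=> hF; have [v1 v2] := vanish_regseq_top hF hs hl1 r1 r2 ht.
  have [] := @vanish_tail _ _ s F hF ks _ 0 t hT1 hl2 r3 v1; first by rewrite add0r.
  by rewrite addn0.
split.
  exists (size ks), (homology_dim F0 (size ks) ((size ks)%:Z + t%:Z)); split.
    by exists F0 => //; apply: resolves_iff hF0 => p; rewrite hJ.
  have [_ h] := key F0 hF0; move=> /(vanish_homology hF0 hT).
  exact: h.
move=> i j b [F hF ->] hb; rewrite leNgt; apply/negP => hj; apply: hb.
apply/(vanish_homology (hres _ hF) hT).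
by have [h _] := key F (hres _ hF); apply: h; rewrite ltrD2l.
Qed.

(** * Existence of graded free resolutions *)

Section Noetherian.
Variables (K : fieldType) (N : nat).
Notation S := {mpoly K[N]}.

(** Dickson's lemma, by induction on the number k of exponents compared. Take a finite set that
    works for k exponents and let c bound the next exponent on it: monomials with exponent at least
    c are covered, and the finitely many slices below c are covered by induction. *)
Lemma dickson (k : nat) (Q : 'X_{1..N} -> Prop) :
  exists2 ms : seq 'X_{1..N}, (forall m, m \in ms -> Q m) &
    forall m, Q m -> exists2 m', m' \in ms & forall i : 'I_N, (i < k)%N -> (m' i <= m i)%N.
Proof.
elim: k Q => [|k IH] Q.
  have [[m hm]|h] := classic (exists m, Q m); last first.
    by exists [::] => // m hm; case: h; exists m.
  exists [:: m] => [m'|m' _]; first by rewrite inE => /eqP ->.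
  by exists m => //; rewrite inE.
have [hk|hk] := ltnP k N; last first.
  have [ms h1 h2] := IH Q; exists ms => // m /h2 [m' hm' h]; exists m' => // i hi.
  by apply: h; have := ltn_ord i; lia.
pose o := Ordinal hk.
have small (c : nat) : exists2 ms : seq 'X_{1..N}, (forall m, m \in ms -> Q m) &
    forall m, Q m -> (m o < c)%N ->
    exists2 m', m' \in ms & forall i : 'I_N, (i < k.+1)%N -> (m' i <= m i)%N.
  elim: c => [|c [ms h1 h2]]; first by exists [::].
  have [ms' h1' h2'] := IH (fun m => Q m /\ m o = c).
  exists (ms ++ ms') => [m|m hm].
    by rewrite mem_cat => /orP [/h1|/h1' []].
  rewrite ltnS leq_eqVlt => /orP [/eqP hc|hc].
    have [m' hm' h] := h2' m (conj hm hc); exists m'; first by rewrite mem_cat hm' orbT.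
    move=> i; rewrite ltnS leq_eqVlt => /orP [/eqP hi|]; last exact: h.
    have -> : i = o by apply: val_inj.
    by have [_ ->] := h1' _ hm'; rewrite hc.
  have [m' hm' h] := h2 m hm hc; exists m' => //.
  by rewrite mem_cat hm'.
have [ms h1 h2] := IH Q.
have [ms' h1' h2'] := small (\max_(m <- ms) m o).
exists (ms ++ ms') => [m|m hm].
  by rewrite mem_cat => /orP [/h1|/h1'].
have [hc|hc] := ltnP (m o) (\max_(m <- ms) m o).
  by have [m' hm' h] := h2' m hm hc; exists m' => //; rewrite mem_cat hm' orbT.
have [m' hm' h] := h2 m hm; exists m'; first by rewrite mem_cat hm'.
move=> i; rewrite ltnS leq_eqVlt => /orP [/eqP hi|]; last exact: h.
have -> : i = o by apply: val_inj.
by apply: leq_trans hc; apply: (@leq_bigmax_seq _ ms xpredT (fun m : 'X_{1..N} => m o) m' hm').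
Qed.

(** Hilbert's basis theorem through leading monomials: elements whose leading monomials dominate all
    others by Dickson's lemma generate, since subtracting a multiple lowers the leading monomial. *)
Lemma ideal_fg (P : S -> Prop) :
  (forall p q, P p -> P q -> P (p - q)) -> (forall a p, P p -> P (a * p)) ->
  exists2 s, (forall g, g \in s -> P g) & forall p, P p -> idl s p.
Proof.
move=> PB PM.
have [ms h1 h2] := dickson N (fun m => exists p, [/\ P p, p != 0 & mlead p = m]).
have [s hs hms] : exists2 s : seq S, (forall g, g \in s -> P g /\ g != 0) &
    forall m, m \in ms -> exists2 g, g \in s & mlead g = m.
  elim: ms h1 {h2} => [|m ms IH] h1; first by exists [::].
  have [|s hs hms] := IH; first by move=> m' hm'; apply: h1; rewrite inE hm' orbT.
  have [p [hp p0 hl]] := h1 m (mem_head _ _).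
  exists (p :: s) => [g|m']; first by rewrite inE => /orP [/eqP ->|/hs].
  rewrite inE => /orP [/eqP ->|/hms [g hg <-]]; first by exists p => //; rewrite mem_head.
  by exists g => //; rewrite inE hg orbT.
exists s => [g /hs []//|p].
have [m hm] : exists m, m = mlead p by exists (mlead p).
elim/(well_founded_ind (@ltom_wf N)): m p hm => m IH p hm hp.
have [->|p0] := eqVneq p 0; first exact: idl0.
have [m' /hms [g hg e] hle] := h2 m (ex_intro _ p (And3 hp p0 (esym hm))).
have [Pg g0] := hs g hg.
have hle' : (mlead g <= m)%MM by apply/mnm_lepP => i; rewrite e; apply: hle.
pose c := mleadc p / mleadc g; pose u : S := c *: 'X_[m - mlead g].
have c0 : c != 0 by rewrite mulf_neq0 ?invr_eq0 ?mleadc_eq0.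
have lu : mlead u = (m - mlead g)%MM by rewrite mleadZ ?mleadXm.
have u0 : u != 0 by rewrite -mleadc_eq0 lu mcoeffZ mcoeffX eqxx mulr1.
have lq : mlead (u * g) = m by rewrite mleadM // lu submK.
have cq : (u * g)@_m = mleadc p.
  by rewrite -lq mleadM // mleadcM lu mcoeffZ mcoeffX eqxx mulr1 divfK // mleadc_eq0.
pose q := u * g; rewrite -/q in lq cq.
have Pq : P (p - q) by apply: PB => //; apply: PM.
have qs : idl s q by apply: idlM; apply: idl_mem.
rewrite -(subrK q p); apply: idlD => //.
have [e0|ne0] := eqVneq (p - q) 0; first by rewrite e0; apply: idl0.
apply: (IH (mlead (p - q))) => //.
have := mleadB_le p q; rewrite -hm lq joinxx le_eqVlt => /orP [/eqP e1|//].
by move: ne0; rewrite -mleadc_eq0 e1 mcoeffB cq -hm subrr eqxx.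
Qed.

Fixpoint span r (bs : seq 'rV[S]_r) (u : 'rV[S]_r) : Prop :=
  if bs is b :: bs' then exists c, span bs' (u - c *: b) else u = 0.

Lemma span_mx r (bs : seq 'rV[S]_r) u : span bs u <->
  exists w, u = w *m (\matrix_(i < size bs) bs`_i).
Proof.
elim: bs u => [|b bs IH] u /=.
  split=> [->|[w ->]]; first by exists 0; rewrite mul0mx.
  by apply/rowP => j; rewrite !mxE big_ord0.
have e (w : 'rV[S]_(size bs).+1) : w *m (\matrix_i (b :: bs)`_i) =
    w 0 ord0 *: b + (\row_i w 0 (lift ord0 i)) *m (\matrix_(i < size bs) bs`_i).
  apply/rowP => j; rewrite !mxE big_ord_recl !mxE; congr (_ + _).
  by apply: eq_bigr => i _; rewrite !mxE.
split=> [[c /IH [w hw]]|[w ->]].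
  exists (\row_i if unlift ord0 i is Some j then w 0 j else c); rewrite e mxE unlift_none.
  apply/eqP; rewrite addrC -subr_eq hw; apply/eqP; congr (_ *m _).
  by apply/rowP => j; rewrite !mxE liftK.
by exists (w 0 ord0); apply/IH; eexists; rewrite e addrAC subrr add0r.
Qed.

Lemma span0 r (bs : seq 'rV[S]_r) : span bs 0.
Proof. by elim: bs => //= b bs IH; exists 0; rewrite scale0r subr0. Qed.

Lemma spanD r (bs : seq 'rV[S]_r) u v : span bs u -> span bs v -> span bs (u + v).
Proof.
elim: bs u v => [|b bs IH] u v /=; first by move=> -> ->; rewrite addr0.
move=> [c hc] [d hd]; exists (c + d).
have -> : u + v - (c + d) *: b = (u - c *: b) + (v - d *: b).
  by rewrite scalerDl opprD addrACA.
exact: IH hc hd.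
Qed.

Lemma spanZ r (bs : seq 'rV[S]_r) c u : span bs u -> span bs (c *: u).
Proof.
elim: bs u => [|b bs IH] u /=; first by move=> ->; rewrite scaler0.
by move=> [d hd]; exists (c * d); rewrite -scalerA -scalerBr; apply: IH.
Qed.

Lemma span_mem r (bs : seq 'rV[S]_r) b : b \in bs -> span bs b.
Proof.
elim: bs => //= a bs IH; rewrite inE => /orP [/eqP ->|/IH h].
  by exists 1; rewrite scale1r subrr; apply: span0.
by exists 0; rewrite scale0r subr0.
Qed.

Lemma span_sub r (bs cs : seq 'rV[S]_r) u :
  (forall b, b \in bs -> span cs b) -> span bs u -> span cs u.
Proof.
elim: bs u => [|b bs IH] u h /=; first by move=> ->; apply: span0.
move=> [c hc]; rewrite -(subrK (c *: b) u); apply: spanD.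
  by apply: IH hc => x hx; apply: h; rewrite inE hx orbT.
by apply/spanZ/h; rewrite mem_head.
Qed.

(** Induction on the number k of last coordinates that may be nonzero: the values of the first of
    these form a finitely generated ideal, and lifts of its generators reduce k. *)
Lemma module_fg r (M : 'rV[S]_r -> Prop) :
  M 0 -> (forall u v, M u -> M v -> M (u - v)) -> (forall a u, M u -> M (a *: u)) ->
  exists2 bs, (forall b, b \in bs -> M b) & forall u, M u -> span bs u.
Proof.
move=> M0 MB MZ.
suff H (k : nat) : (k <= r)%N -> exists2 bs, (forall b, b \in bs -> M b) &
    forall u, M u -> (forall a : 'I_r, (a < r - k)%N -> u 0 a = 0) -> span bs u.
  have [bs h1 h2] := H r (leqnn r); exists bs => // u hu; apply: h2 => // a.
  by rewrite subnn.
elim: k => [|k IH] hk.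
  exists [::] => // u _ hu /=; apply/rowP => a; rewrite mxE; apply: hu.
  by rewrite subn0.
have [bs h1 h2] := IH (ltnW hk).
have ho : (r - k.+1 < r)%N by lia.
pose o := Ordinal ho.
pose Mk u := M u /\ forall a : 'I_r, (a < o)%N -> u 0 a = 0.
have [s hs hs'] : exists2 s, (forall g, g \in s -> exists2 u, Mk u & u 0 o = g) &
    forall p, (exists2 u, Mk u & u 0 o = p) -> idl s p.
  apply: ideal_fg => [p q [u [u1 u2] <-] [v [v1 v2] <-]|a p [u [u1 u2] <-]].
    exists (u - v); last by rewrite !mxE.
    by split; [apply: MB|move=> a ha; rewrite !mxE u2 // v2 // subrr].
  exists (a *: u); last by rewrite mxE.
  by split; [apply: MZ|move=> b hb; rewrite mxE u2 // mulr0].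
have [cs hc hcs] : exists2 cs, (forall b, b \in cs -> Mk b) &
    forall p, idl s p -> exists2 u, span cs u /\ Mk u & u 0 o = p.
  elim: s hs {hs'} => [|g s IHs] hs.
    exists [::] => // p /= ->; exists 0; last by rewrite mxE.
    by split=> //; split=> // a _; rewrite mxE.
  have [|cs hc hcs] := IHs; first by move=> x hx; apply: hs; rewrite inE hx orbT.
  have [v hv e] := hs g (mem_head _ _).
  exists (v :: cs) => [b|p [a ha]]; first by rewrite inE => /orP [/eqP ->|/hc].
  have [w [w1 [w2 w3]] ew] := hcs _ ha; have [v1 v2] := hv.
  exists (a *: v - - w); last by rewrite !mxE opprK e ew addrC subrK.
  split; first by exists a; rewrite opprK addrAC subrr add0r.
  split; last by move=> b hb; rewrite !mxE v2 // w3 // mulr0 !oppr0 addr0.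
  by apply: MB; [apply: MZ|rewrite -scaleN1r; apply: MZ].
exists (cs ++ bs) => [b|u hu hu0].
  by rewrite mem_cat => /orP [/hc []|/h1].
have [v [v1 [v2 v3]] ev] := hcs (u 0 o) (hs' _ (ex_intro2 _ _ u (conj hu hu0) erefl)).
rewrite -(subrK v u); apply: spanD; last first.
  by apply: span_sub v1 => b hb; apply: span_mem; rewrite mem_cat hb.
apply: (@span_sub _ bs) => [b hb|]; first by apply: span_mem; rewrite mem_cat hb orbT.
apply: h2; first exact: MB.
move=> a ha; rewrite !mxE; have [ho'|ne] := eqVneq a o; first by rewrite ho' ev subrr.
have hao : (a < o)%N.
  by have : (a : nat) != o by []; rewrite /=; lia.
by rewrite hu0 // v3 // subrr.
Qed.

Lemma hcomp_shift_sum (p : S) (e J : nat) : (msize p + e <= J)%N ->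
  p = \sum_(j < J) hcomp (j%:Z - e%:Z) p.
Proof.
move=> hJ; rewrite [in LHS](mpolyE p) [in RHS](mpolyE p).
under [RHS]eq_bigr do rewrite linear_sum.
rewrite exchange_big /= big_seq [in RHS]big_seq; apply: eq_bigr => m /msize_mdeg_lt hm.
have ho : (mdeg m + e < J)%N by lia.
rewrite (bigD1 (Ordinal ho)) //= big1 => [|j hj].
  by rewrite linearZ /= hcompX addr0; case: eqP => //; lia.
rewrite linearZ /= hcompX; case: eqP => [h|]; last by rewrite scaler0.
by case/eqP: hj; apply: val_inj => /=; lia.
Qed.

Lemma span_hcv r (dg : 'I_r -> int) (b : 'rV[S]_r) :
  exists ds : seq int, span [seq hcv dg d b | d <- ds] b.
Proof.
pose c := (\sum_a `|dg a|)%N; pose M := (\sum_a msize (b 0%R a))%N.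
have hc a : (`|dg a| <= c)%N by rewrite /c (bigD1 a) //= leq_addr.
have hM a : (msize (b 0%R a) <= M)%N by rewrite /M (bigD1 a) //= leq_addr.
(* Nonzero components of b occur only in degrees d with - c <= d < M + c; the index is j = d + c. *)
pose J := (M + (c + c))%N.
exists [seq j%:Z - c%:Z | j <- iota 0 J].
have {2}-> : b = \sum_(j < J) hcv dg (j%:Z - c%:Z) b.
  apply/rowP => a; rewrite summxE; have hca := hc a; have hMa := hM a.
  rewrite {1}(@hcomp_shift_sum (b 0 a) (absz (c%:Z + dg a)) J); last by rewrite /J; lia.
  by apply: eq_bigr => j _; rewrite mxE; congr hcomp; lia.
elim/big_ind: _ => [||j _]; [exact: span0|exact: spanD|].
apply/span_mem/map_f/mapP; exists (j : nat) => //.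
by rewrite mem_iota /= add0n.
Qed.

Lemma graded_module_fg r (dg : 'I_r -> int) (M : 'rV[S]_r -> Prop) :
  M 0 -> (forall u v, M u -> M v -> M (u - v)) -> (forall a u, M u -> M (a *: u)) ->
  (forall d u, M u -> M (hcv dg d u)) ->
  exists2 bs, (forall b, b \in bs -> M b /\ exists d, hvec dg d b) &
    forall u, M u -> span bs u.
Proof.
move=> M0 MB MZ MH; have [bs h1 h2] := module_fg M0 MB MZ.
suff [cs hc hcs] : exists2 cs, (forall b, b \in cs -> M b /\ exists d, hvec dg d b) &
    forall b, b \in bs -> span cs b.
  by exists cs => // u /h2; apply: span_sub.
elim: bs h1 {h2} => [|b bs IH] h1; first by exists [::].
have [|cs hc hcs] := IH; first by move=> x hx; apply: h1; rewrite inE hx orbT.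
have [ds hds] := span_hcv dg b.
exists ([seq hcv dg d b | d <- ds] ++ cs) => x.
  rewrite mem_cat => /orP [/mapP [d _ ->]|/hc //]; split; last by exists d; apply: hvec_hcv.
  by apply/MH/h1; rewrite mem_head.
rewrite inE => /orP [/eqP ->|/hcs hx].
  by apply: span_sub hds => y hy; apply: span_mem; rewrite mem_cat hy.
by apply: span_sub hx => y hy; apply: span_mem; rewrite mem_cat hy orbT.
Qed.

(* One differential of a resolution; [extension] is the next one. *)
Record stage := Stage {
  st0 : nat; st1 : nat; sd0 : 'I_st0 -> int; sd1 : 'I_st1 -> int;
  sA : 'M[S]_(st1, st0);
  _ : forall a b, homog_deg (sA a b) (sd1 a - sd0 b) }.

Record extension (x : stage) := Extension {
  ext_rk : nat; ext_deg : 'I_ext_rk -> int; ext_mx : 'M[S]_(ext_rk, st1 x);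
  ext_homog : forall a b, homog_deg (ext_mx a b) (ext_deg a - sd1 b);
  ext_exact : forall u : 'rV[S]_(st1 x), u *m sA x = 0 <-> exists w, u = w *m ext_mx }.

(** The kernel of a graded matrix is a graded submodule, and its finitely many homogeneous
    generators are the rows of the next matrix. The existential over [True] only wraps the record as
    a proposition from which [extend] chooses. *)
Lemma extension_ex x : exists e : extension x, True.
Proof.
case: x => r0 r1 d0 d1 A hA.
have [||||bs h1 h2] := @graded_module_fg r1 d1 (fun u => u *m A = 0).
- exact: mul0mx.
- by move=> u v hu hv; rewrite mulmxBl hu hv subrr.
- by move=> a u hu; rewrite -scalemxAl hu scaler0.
- move=> d u hu; rewrite -(hcvM _ _ hA) hu; apply/rowP => a.
  by rewrite !mxE linear0.
have /fin_all_exists [dg hdg] (i : 'I_(size bs)) : exists d, hvec d1 d bs`_i.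
  by have [] := h1 bs`_i (mem_nth _ (ltn_ord i)).
unshelve eexists; last by [].
apply: (@Extension (Stage hA) (size bs) dg (\matrix_(i < size bs) bs`_i)) => /= [a b|u].
  by rewrite mxE; apply: hdg.
split=> [/h2 /span_mx //|/span_mx]; elim: bs u h1 {h2 dg hdg} => [|b bs IH] u h1 /=.
  by move=> ->; rewrite mul0mx.
move=> [c /IH hc]; rewrite -(subrK (c *: b) u) mulmxDl hc ?add0r.
  by rewrite -scalemxAl; have [-> _] := h1 b (mem_head _ _); rewrite scaler0.
by move=> x hx; apply: h1; rewrite inE hx orbT.
Qed.

Definition extend x : extension x :=
  proj1_sig (constructive_indefinite_description _ (extension_ex x)).

Definition next x : stage := Stage (@ext_homog x (extend x)).

Lemma idl_span s p : idl s p <-> span [seq const_mx g | g <- s] (const_mx p : 'rV[S]_1).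
Proof.
elim: s p => [|g s IH] p /=.
  split=> [->|/rowP /(_ 0)]; last by rewrite !mxE.
  by apply/rowP => j; rewrite !mxE.
have e a : const_mx p - a *: const_mx g = const_mx (p - a * g) :> 'rV[S]_1.
  by apply/rowP => j; rewrite !mxE.
by split=> -[a ha]; exists a; move: ha; rewrite e IH.
Qed.

(** Start with F_0 = S, augmented by 1, and one basis element of F_1 for each generator; the later
    stages are chosen recursively, without a bound on the length. *)
Lemma resolution_ex (s : seq S) : hseq s ->
  exists F : graded_free_complex K N, resolves (idl s) F.
Proof.
move=> hs; pose bs := [seq const_mx g : 'rV[S]_1 | g <- s].
have /fin_all_exists [dg hdg] (i : 'I_(size bs)) : exists d, homog_deg (bs`_i 0 0) d.
  have : bs`_i \in bs by apply: mem_nth.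
  by move=> /mapP [g /hs [d hd] ->]; exists d; rewrite mxE.
pose A := \matrix_(i < size bs) bs`_i.
have hA a b : homog_deg (A a b) (dg a - (fun _ : 'I_1 => 0) b).
  by rewrite mxE subr0 [b]ord1; apply: hdg.
pose st := fix st i := if i is j.+1 then next (st j) else Stage hA.
have hst i : forall a b, homog_deg (sA (st i) a b) (sd1 a - sd0 b) by case: (st i).
exists (@GradedFreeComplex K N (fun i => st0 (st i)) (fun i => @sd0 (st i))
  (fun i => sA (st i)) (const_mx 1)).
have aug (u : 'rV[S]_1) : (u *m const_mx 1 : 'rV[S]_1) 0 0 = u 0 0.
  by rewrite mxE big_ord1 mxE mulr1.
split=> [|p|u|i u] /=.
- split=> [a|i a b] /=; last exact: (hst i).
  by rewrite mxE; apply: homog_degC.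
- by exists (const_mx p); rewrite aug mxE subrr; apply: idl0.
- rewrite aug idl_span -/bs span_mx.
  have -> : const_mx (u 0 0) = u by apply/rowP => j; rewrite mxE [j]ord1.
  by [].
- exact: (ext_exact (extend (st i))).
Qed.

End Noetherian.

(** * Binomial edge ideals of labelled graphs *)

Lemma set2_eq (T : finType) (a b u v : T) : [set u; v] = [set a; b] ->
  (u = a /\ v = b) \/ (u = b /\ v = a).
Proof.
move=> e; have hu : u \in [set a; b] by rewrite -e set21.
have hv : v \in [set a; b] by rewrite -e set22.
have ha : a \in [set u; v] by rewrite e set21.
have hb : b \in [set u; v] by rewrite e set22.
move: hu hv ha hb; rewrite !inE.
by do 4![case/orP => /eqP ?]; subst; auto.
Qed.

Section BinomialEdgeIdealOfWord.
Variables (K : fieldType) (V : finType) (G : pregraph V).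
Variables (v0 : V) (s : seq V) (w : seq letter).
Let vt i := nth v0 s i.
Hypothesis edge_wedge : forall u v, adj G u v ->
  exists2 e, e \in wedges 0 w & [set u; v] = [set vt e.1; vt e.2].
Hypothesis wedge_edge : forall e, e \in wedges 0 w -> adj G (vt e.1) (vt e.2).

Definition xpos (i : nat) : 'I_#|{: V + V}| := enum_rank (inl (vt i) : V + V)%type.
Definition ypos (i : nat) : 'I_#|{: V + V}| := enum_rank (inr (vt i) : V + V)%type.

Lemma beiE p : all isNEC w ->
  binomial_edge_ideal (K := K) G p <-> idl (gens K xpos ypos 0 w) p.
Proof.
move=> hw; rewrite gens_wedges //; split=> [[c ->]|].
  elim/big_ind: _ => [|*|[u v] /= /edge_wedge [[i j] he /= /set2_eq h]];
    [exact: idl0|exact: idlD|].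
  have hij : idl [seq fm K xpos ypos e.1 e.2 | e <- wedges 0 w] (fm K xpos ypos i j).
    by apply/idl_mem/(map_f (fun e => fm K xpos ypos e.1 e.2) he).
  apply: idlM; case: h => [[-> ->]|[-> ->]]; first exact: hij.
  by rewrite -opprB; apply/idlN/hij.
elim/idl_least => [|q r [c ->] [d ->]|a q [c ->]|g /mapP [[i j] he ->]].
- by exists (fun=> 0); rewrite big1 // => e _; rewrite mul0r.
- by exists (fun e => c e + d e); rewrite -big_split; apply: eq_bigr => e _; rewrite mulrDl.
- by exists (fun e => a * c e); rewrite mulr_sumr; apply: eq_bigr => e _; rewrite mulrA.
exists (fun e => (e == (vt i, vt j))%:R); rewrite (bigD1 (vt i, vt j)) /=; last exact: wedge_edge he.
by rewrite eqxx mul1r big1 ?addr0 // => e /andP [_ /negPf ->]; rewrite mul0r.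
Qed.

End BinomialEdgeIdealOfWord.

Lemma isNEC_words bs : all isNEC (words bs).
Proof.
elim: bs => [//|b bs IH]; rewrite /words /= all_cat IH andbT.
by case: b => [m|] //=; rewrite all_cat /= andbT; elim: (m - 2)%N.
Qed.

Lemma regularity_words (K : fieldType) (V : finType) (G : pregraph V)
    (v0 : V) (s : seq V) (m : nat) (bs : seq block) :
  uniq s -> (forall v, v \in s) -> (wsize (words (BK m :: bs))).+1 = size s ->
  all large bs -> ends_clique bs ->
  (forall u v, adj G u v ->
    exists2 e, e \in wedges 0 (words (BK m :: bs)) & [set u; v] = [set nth v0 s e.1; nth v0 s e.2]) ->
  (forall e, e \in wedges 0 (words (BK m :: bs)) -> adj G (nth v0 s e.1) (nth v0 s e.2)) ->
  regularity (binomial_edge_ideal (K := K) G) (Posz (values (BK m :: bs))).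
Proof.
move=> us hs hn hbs he h1 h2; set w := words _ in hn h1 h2.
pose n := size s; set x := xpos v0 s; set y := ypos v0 s.
have x_inj i j : (i < n)%N -> (j < n)%N -> x i = x j -> i = j.
  by move=> hi hj /enum_rank_inj [] /eqP; rewrite nth_uniq // => /eqP.
have y_inj i j : (i < n)%N -> (j < n)%N -> y i = y j -> i = j.
  by move=> hi hj /enum_rank_inj [] /eqP; rewrite nth_uniq // => /eqP.
have xy i j : (i < n)%N -> (j < n)%N -> x i <> y j by move=> _ _ /enum_rank_inj.
have full k : exists2 i, (i < n)%N & k = x i \/ k = y i.
  rewrite -(enum_valK k); case: (enum_val k) => v; exists (index v s); rewrite ?index_mem //.
    by left; rewrite /x /xpos nth_index.
  by right; rewrite /y /ypos nth_index.
apply: (@regularity_regseq _ _ _ (gens K x y 0 w) (ls K x y 0 (wsize w)) (ks K y (wsize w))).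
- by move=> p; apply: beiE => //; apply: isNEC_words.
- by apply: resolution_ex; apply: hseq_gens.
- exact: hseq_gens.
- exact: homog_ls_ks.
- exact: (regseq_ls_ks K x_inj y_inj xy hn).
- exact: (idl_ls_ks K full hn).
- exact: (goodw_words K x_inj y_inj xy full hbs he hn).
Qed.

(** * Blocks *)

Section Connectivity.
Variable V : finType.
Implicit Types (G H : pregraph V) (u v w x y : V).

Lemma adj_sym H : ssrbool.symmetric (adj H).
Proof. by move=> u v; rewrite /adj setUC. Qed.

Lemma adj_connect_sym H : connect_sym (adj H).
Proof. by apply: sym_connect_sym; apply: adj_sym. Qed.

Lemma simple_adj H u v : simple_graph H -> adj H u v ->
  [/\ u \in verts H, v \in verts H & u != v].
Proof.
move=> /forall_inP h /h /andP []; rewrite cards2 subUset !sub1set.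
by move=> hc /andP [-> ->]; split=> //; case: (u =P v) hc.
Qed.

Lemma adj_closed H : simple_graph H -> closed (adj H) (mem (verts H)).
Proof.
move=> hs; apply: intro_closed; first exact: adj_connect_sym.
by move=> u v huv hu; have [] := simple_adj hs huv.
Qed.

(** The empty graph qualifies, as it must for the result of deleting the only vertex of a graph. *)
Definition conn H := forall u v, u \in verts H -> v \in verts H -> connect (adj H) u v.

Lemma num_components_le1 H : simple_graph H -> (num_components H <= 1)%N -> conn H.
Proof.
move=> hs /card_le1P h u v hu hv.
have hr x : x \in verts H -> fingraph.root (adj H) x \in [predI roots (adj H) & mem (verts H)].
  move=> hx; apply/andP; split; first exact: (roots_root (@adj_connect_sym H)).
  by rewrite /= -(closed_connect (adj_closed hs) (connect_root _ x)).
have := h _ (hr u hu) (fingraph.root (adj H) v); rewrite hr // => /esym.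
rewrite inE => /eqP e; rewrite -(root_connect (@adj_connect_sym H)) /=.
by rewrite e.
Qed.

Lemma conn_num_components H : conn H -> (num_components H <= 1)%N.
Proof.
move=> hc; apply/card_le1P => x; rewrite inE => /andP [/eqP rx hx] y.
rewrite !inE; apply/idP/eqP => [/andP [/eqP ry hy]|->]; last by rewrite /in_mem /= /roots rx eqxx.
rewrite -rx -ry; apply/eqP; rewrite (root_connect (@adj_connect_sym H)).
exact: hc.
Qed.

Lemma connected_graphP H : simple_graph H ->
  reflect (conn H /\ exists v, v \in verts H) (connected_graph H).
Proof.
move=> hs; apply: (iffP eqP) => [h|[hc [v hv]]].
  split; first by apply: num_components_le1 => //; rewrite h.
  rewrite /num_components /n_comp_mem in h.
  have /card_gt0P [v] : (0 < #|predI (roots (adj H)) (mem (verts H))|)%N by rewrite h.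
  by rewrite inE => /andP [_ hv]; exists v.
apply/eqP; rewrite eqn_leq conn_num_components //.
apply/card_gt0P; exists (fingraph.root (adj H) v); rewrite inE; apply/andP.
split; first exact: (roots_root (@adj_connect_sym H)).
by rewrite /= -(closed_connect (adj_closed hs) (connect_root _ v)).
Qed.

Lemma simple_del H w : simple_graph H -> simple_graph (del_vertex H w).
Proof.
move=> /forall_inP h; apply/forall_inP => A; rewrite inE => /andP [/h /andP [-> hA] hw].
apply/subsetP => x hx; rewrite !inE (subsetP hA) // andbT.
by apply: contraNneq hw => <-.
Qed.

Lemma del_id H w : simple_graph H -> w \notin verts H -> del_vertex H w = H.
Proof.
move=> /forall_inP h hw; case: H h hw => vs es h hw; congr (_, _).
  by apply/setP => x; rewrite !inE; case: eqP => // ->; apply/esym/negbTE.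
apply/setP => A; rewrite !inE andb_idr // => /h /andP [_ /subsetP hA].
by apply: contra hw => /hA.
Qed.

Lemma nonseparableP H : simple_graph H ->
  reflect [/\ conn H, exists v, v \in verts H & forall w, conn (del_vertex H w)]
          (nonseparable H).
Proof.
move=> hs; apply: (iffP andP) => [[/(connected_graphP hs) [hc hn] /forallP hcut]|[hc hn hd]].
  split=> // w; have [hw|hw] := boolP (w \in verts H); last by rewrite del_id.
  apply: num_components_le1; first exact: simple_del.
  have := hcut w; rewrite /cut_vertex hw /= -leqNgt => h.
  exact: leq_trans h (conn_num_components hc).
split; first exact/(connected_graphP hs).
apply/forallP => w; rewrite /cut_vertex; apply/negP => /andP [_ h].
have : (num_components (del_vertex H w) <= 1)%N by apply: conn_num_components.
have /connected_graphP /eqP e : conn H /\ exists v, v \in verts H by [].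
by rewrite e // in h; rewrite leqNgt h.
Qed.

Definition gU G H : pregraph V := (verts G :|: verts H, edges G :|: edges H).

Lemma adj_gU G H u v : adj (gU G H) u v = adj G u v || adj H u v.
Proof. by rewrite /adj inE. Qed.

Lemma simple_gU G H : simple_graph G -> simple_graph H -> simple_graph (gU G H).
Proof.
move=> /forall_inP hg /forall_inP hh; apply/forall_inP => A; rewrite inE.
by case/orP => [/hg|/hh] /andP [-> h]; apply: subset_trans h _; rewrite ?subsetUl ?subsetUr.
Qed.

Lemma conn_gU G H x : conn G -> conn H -> x \in verts G -> x \in verts H -> conn (gU G H).
Proof.
move=> hg hh xg xh.
have cg u v : connect (adj G) u v -> connect (adj (gU G H)) u v.
  by apply: connect_sub => a b h; apply: connect1; rewrite adj_gU h.
have ch u v : connect (adj H) u v -> connect (adj (gU G H)) u v.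
  by apply: connect_sub => a b h; apply: connect1; rewrite adj_gU h orbT.
have hx u : u \in verts (gU G H) -> connect (adj (gU G H)) u x.
  by rewrite inE => /orP [hu|hu]; [apply/cg/hg|apply/ch/hh].
move=> u v /hx hu /hx hv; apply: connect_trans hu _.
by rewrite adj_connect_sym.
Qed.

Lemma del_gU G H w : del_vertex (gU G H) w = gU (del_vertex G w) (del_vertex H w).
Proof.
congr (_, _); apply/setP => x; rewrite !inE; first by rewrite andb_orr.
by rewrite andb_orl.
Qed.

Lemma verts_del H w x : (x \in verts (del_vertex H w)) = (x != w) && (x \in verts H).
Proof. by rewrite !inE. Qed.

Lemma conn_gU2 G H x y w : conn (del_vertex G w) -> conn (del_vertex H w) -> x != y ->
  x \in verts G -> x \in verts H -> y \in verts G -> y \in verts H ->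
  conn (del_vertex (gU G H) w).
Proof.
move=> hg hh ne xg xh yg yh; rewrite del_gU.
have [e|nx] := eqVneq x w.
  by apply: (conn_gU (x := y)) => //; rewrite verts_del ?yg ?yh andbT -e eq_sym.
by apply: (conn_gU (x := x)) => //; rewrite verts_del ?xg ?xh nx.
Qed.

Definition gvertex v : pregraph V := ([set v], set0).
Definition gedge u v : pregraph V := ([set u; v], [set [set u; v]]).

Lemma simple_gvertex v : simple_graph (gvertex v).
Proof. by apply/forall_inP => A; rewrite inE. Qed.

Lemma simple_gedge u v : u != v -> simple_graph (gedge u v).
Proof. by move=> ne; apply/forall_inP => A; rewrite inE => /eqP ->; rewrite cards2 ne subxx. Qed.

Lemma nonseparable_gvertex v : nonseparable (gvertex v).
Proof.
apply/(nonseparableP (simple_gvertex v)); split.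
- by move=> x y; rewrite !inE => /eqP -> /eqP ->; apply: connect0.
- by exists v; rewrite inE.
- by move=> w x y; rewrite !inE => /andP [_ /eqP ->] /andP [_ /eqP ->]; apply: connect0.
Qed.

Lemma nonseparable_gedge u v : u != v -> nonseparable (gedge u v).
Proof.
move=> ne; apply/(nonseparableP (simple_gedge ne)).
have huv : adj (gedge u v) u v by rewrite /adj inE.
have hc : conn (gedge u v).
  move=> x y; rewrite !inE => /orP [] /eqP -> /orP [] /eqP ->; try exact: connect0.
    exact: connect1.
  by apply: connect1; rewrite adj_sym.
split=> //; first by exists u; rewrite !inE eqxx.
move=> w; have [hw|hw] := boolP (w \in verts (gedge u v)); last first.
  by rewrite del_id //; apply: simple_gedge.
move=> x y; rewrite !verts_del => /andP [xw hx] /andP [yw hy].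
move: hw hx hy xw yw; rewrite !inE => /orP [] /eqP -> /orP [] /eqP -> /orP [] /eqP ->;
  by rewrite ?eqxx // => _ _; apply: connect0.
Qed.

Lemma subgraph_trans G H1 H2 : subgraph H1 H2 -> subgraph H2 G -> subgraph H1 G.
Proof.
move=> /and3P [h1 h2 h3] /and3P [_ h4 h5]; apply/and3P.
by split=> //; [apply: subset_trans h4|apply: subset_trans h5].
Qed.

Lemma subgraph_gU G H1 H2 : subgraph H1 G -> subgraph H2 G -> subgraph (gU H1 H2) G.
Proof.
move=> /and3P [h1 h2 h3] /and3P [h1' h4 h5]; apply/and3P; split; first exact: simple_gU.
  by rewrite subUset h2.
by rewrite subUset h3.
Qed.

Lemma subgraph_gUl H1 H2 : simple_graph H1 -> subgraph H1 (gU H1 H2).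
Proof. by move=> h; apply/and3P; rewrite !subsetUl. Qed.

Lemma subgraph_gUr H1 H2 : simple_graph H2 -> subgraph H2 (gU H1 H2).
Proof. by move=> h; apply/and3P; rewrite !subsetUr. Qed.

Lemma block_sub G H : is_block G H -> subgraph H G.
Proof. by case/and3P. Qed.

Lemma block_simple G H : is_block G H -> simple_graph H.
Proof. by case/and3P => /and3P []. Qed.

Lemma block_nonseparable G H : is_block G H ->
  [/\ conn H, exists v, v \in verts H & forall w, conn (del_vertex H w)].
Proof. by move=> hb; apply/nonseparableP; [apply: block_simple hb|case/and3P: hb]. Qed.

Lemma block_max G H H' : is_block G H -> subgraph H' G -> nonseparable H' ->
  subgraph H H' -> H' = H.
Proof. by case/and3P => _ _ /forallP h h1 h2 h3; apply/eqP/(implyP (h H')); rewrite h1 h2. Qed.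

(** Among the nonseparable subgraphs containing H, one with the largest number of vertices plus
    edges is maximal. *)
Lemma block_ex G H : subgraph H G -> nonseparable H ->
  exists2 H', is_block G H' & subgraph H H'.
Proof.
pose P H' := [&& subgraph H' G, nonseparable H' & subgraph H H'].
pose sz (H' : pregraph V) := (#|verts H'| + #|edges H'|)%N.
move=> h1 h2; have hP : P H.
  by rewrite /P h1 h2 /subgraph !subxx !andbT; case/and3P: h1.
case: (arg_maxnP sz hP) => H' /and3P [h1' h2' h3'] hmax.
exists H' => //; apply/and3P; split=> //; apply/forallP => H''; apply/implyP => /and3P [h1'' h2'' h3''].
have hP'' : P H'' by rewrite /P h1'' h2'' (subgraph_trans h3').
have := hmax _ hP''; case/and3P: h3'' => _ hv he; rewrite /sz => hle.
have hv' := subset_leq_card hv; have he' := subset_leq_card he.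
case: H' H'' hv he hle hv' he' {h1' h2' h3' hmax h1'' h2'' hP''} => [v1 e1] [v2 e2] /= hv he hle hv' he'.
have ev : v1 == v2 by rewrite eqEcard hv; move: hle hv' he'; rewrite /verts /edges /=; lia.
have ee : e1 == e2 by rewrite eqEcard he; move: hle hv' he'; rewrite /verts /edges /=; lia.
by rewrite (eqP ev) (eqP ee).
Qed.

Lemma block_edge G u v : simple_graph G -> adj G u v ->
  exists2 H, is_block G H & adj H u v.
Proof.
move=> hs huv; have [hu hv ne] := simple_adj hs huv.
have [||H hb /and3P [_ _ h]] := @block_ex G (gedge u v).
- apply/and3P; split; first exact: simple_gedge.
    by rewrite subUset !sub1set hu.
  by rewrite sub1set.
- exact: nonseparable_gedge.
by exists H => //; apply: (subsetP h); rewrite inE.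
Qed.

Lemma block_vertex G v : v \in verts G -> exists2 H, is_block G H & v \in verts H.
Proof.
move=> hv; have [||H hb /and3P [_ h _]] := @block_ex G (gvertex v).
- by apply/and3P; split; [exact: simple_gvertex|rewrite sub1set|rewrite sub0set].
- exact: nonseparable_gvertex.
by exists H => //; apply: (subsetP h); rewrite inE.
Qed.

Lemma block_adjE G H u v : is_block G H -> adj H u v -> adj G u v.
Proof. by move=> /block_sub /and3P [_ _ /subsetP h] /h. Qed.

(** One of the two common vertices survives any deletion, so the union of the blocks is nonseparable
    and by maximality equals both. *)
Lemma block_share G H1 H2 x y : is_block G H1 -> is_block G H2 -> x != y ->
  x \in verts H1 -> x \in verts H2 -> y \in verts H1 -> y \in verts H2 -> H1 = H2.
Proof.
move=> b1 b2 ne x1 x2 y1 y2; have [c1 _ d1] := block_nonseparable b1.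
have [c2 _ d2] := block_nonseparable b2.
have s1 := block_simple b1; have s2 := block_simple b2.
have hs : subgraph (gU H1 H2) G by apply: subgraph_gU; apply: block_sub.
have hn : nonseparable (gU H1 H2).
  apply/nonseparableP; first by case/and3P: hs.
  split; first exact: (conn_gU (x := x)).
    by exists x; rewrite inE x1.
  by move=> w; apply: (@conn_gU2 _ _ x y).
have e1 := block_max b1 hs hn (subgraph_gUl H2 s1).
by have e2 := block_max b2 hs hn (subgraph_gUr H1 s2); rewrite -e1 {1}e2.
Qed.

End Connectivity.

Lemma card2_ex (V : finType) (A : {set V}) x : (2 <= #|A|)%N -> exists2 y, y \in A & y != x.
Proof.
move=> h; have /card_gt0P [y] : (0 < #|A :\ x|)%N by have := cardsD1 x A; lia.
by rewrite !inE => /andP [ne hy]; exists y.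
Qed.

(** * Complete graphs and 4-cycles as blocks *)

Section Types.
Variable V : finType.
Implicit Types (G H : pregraph V) (u v w x y : V).

Lemma completeP H m : is_complete H m ->
  #|verts H| = m /\ forall x y, x \in verts H -> y \in verts H -> x != y -> adj H x y.
Proof.
case/existsP => f /and3P [/dinjectiveP finj /eqP fim /forall_inP fadj].
split; first by rewrite -fim card_in_imset // cardsT card_ord.
move=> x y; rewrite -fim => /imsetP [i _ ->] /imsetP [j _ ->] ne.
have /forall_inP h := fadj i (in_setT _); rewrite -(eqP (h j (in_setT _))).
have nij : i != j by apply: contraNneq ne => ->.
by rewrite /adj inE cards2 nij.
Qed.

Lemma adj_cycle4 (i j : 'I_4) : adj (cycle_graph 4) i j = (j == ordS i) || (i == ordS j).
Proof.
apply/imsetP/orP => [[k _ /set2_eq [[-> ->]|[-> ->]]]|[/eqP ->|/eqP ->]].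
- by left.
- by right.
- by exists i.
- by exists j => //; rewrite setUC.
Qed.

Lemma C4P H : is_C4 H -> exists f : 'I_4 -> V,
  [/\ injective f, forall x, x \in verts H <-> exists i, x = f i &
      forall i j, adj H (f i) (f j) = (j == ordS i) || (i == ordS j)].
Proof.
case/existsP => f /and3P [/dinjectiveP finj /eqP fim /forall_inP fadj].
exists f; split.
- by move=> i j; apply: finj; rewrite inE.
- by move=> x; rewrite -fim; split=> [/imsetP [i _ ->]|[i ->]]; [exists i|apply: imset_f; rewrite inE].
- move=> i j; have /forall_inP h := fadj i (in_setT _).
  by rewrite -(eqP (h j (in_setT _))) adj_cycle4.
Qed.

Lemma ordS4_sub (i a b : 'I_4) : (i - b == ordS (i - a)) || (i - a == ordS (i - b)) =
  (b == ordS a) || (a == ordS b).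
Proof.
by case: i => [[|[|[|[|]]]] ?] //; case: a => [[|[|[|[|]]]] ?] //;
  case: b => [[|[|[|[|]]]] ?].
Qed.

Lemma ordS4_add (i a b : 'I_4) : (i + b == ordS (i + a)) || (i + a == ordS (i + b)) =
  (b == ordS a) || (a == ordS b).
Proof.
by case: i => [[|[|[|[|]]]] ?] //; case: a => [[|[|[|[|]]]] ?] //;
  case: b => [[|[|[|[|]]]] ?].
Qed.

Lemma ord4P (a : 'I_4) : [|| a == 0, a == 1, a == 2 | a == 3].
Proof. by case: a => [[|[|[|[|]]]] ?]. Qed.

(** A symmetry of the cycle on Z/4 moves 0 to p and 3 to q: a -> i + a or, if q follows p, the
    reflection a -> i - a, as i - 3 = i + 1. The labels 1 and 2 are then the long way round. *)
Lemma C4_label H p q : simple_graph H -> is_C4 H -> adj H p q ->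
  exists d c, [/\ uniq [:: p; d; c; q], forall x, (x \in verts H) = (x \in [:: p; d; c; q]),
    [/\ adj H p d, adj H d c & adj H c q] &
    forall x y, adj H x y -> [set x; y] \in [:: [set p; d]; [set d; c]; [set c; q]; [set p; q]]].
Proof.
move=> hs /C4P [f [finj fv fadj]] hpq.
have [/fv [i ei] /fv [j ej] ne] := simple_adj hs hpq.
have key (g : 'I_4 -> 'I_4) (k : 'I_4 -> 'I_4) : cancel g k -> cancel k g ->
    (forall a b, adj H (f (g a)) (f (g b)) = (b == ordS a) || (a == ordS b)) ->
    p = f (g 0) -> q = f (g 3) ->
  exists d c, [/\ uniq [:: p; d; c; q], forall x, (x \in verts H) = (x \in [:: p; d; c; q]),
    [/\ adj H p d, adj H d c & adj H c q] &
    forall x y, adj H x y -> [set x; y] \in [:: [set p; d]; [set d; c]; [set c; q]; [set p; q]]].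
  move=> gk kg hg ep eq; exists (f (g 1)), (f (g 2)).
  have hv x : (x \in verts H) = (x \in [:: p; f (g 1); f (g 2); q]).
    apply/idP/idP => [/fv [a ->]|].
      rewrite -(kg a) ep eq !inE !(inj_eq finj) !(inj_eq (can_inj gk)).
      exact: ord4P.
    rewrite !inE ep eq => hx; apply/fv.
    by case/or4P: hx => /eqP ->; eexists.
  split=> //.
  - rewrite ep eq /= !inE !(inj_eq finj) !(inj_eq (can_inj gk)).
    by [].
  - by rewrite ep eq !hg.
  - move=> x y hxy; have [/fv [a ea] /fv [b eb] _] := simple_adj hs hxy.
    move: hxy; rewrite ea eb -(kg a) -(kg b) hg ep eq; move: (k a) (k b) => a' b'.
    rewrite !inE.
    case/or4P: (ord4P a') => /eqP ->; case/or4P: (ord4P b') => /eqP -> //= _;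
    by rewrite ?eqxx ?orbT // setUC ?eqxx ?orbT.
have : (j == ordS i) || (i == ordS j) by rewrite -fadj -ei -ej.
move=> /orP [/eqP e|/eqP e].
  apply: (key (fun a => i - a) (fun a => i - a)).
  - by move=> a; rewrite opprB addrCA subrr addr0.
  - by move=> a; rewrite opprB addrCA subrr addr0.
  - by move=> a b; rewrite fadj ordS4_sub.
  - by rewrite ei subr0.
  - by rewrite ej e; congr f; case: (i) => [[|[|[|[|]]]] ?] //; apply: val_inj.
apply: (key (fun a => i + a) (fun a => a - i)).
- by move=> a; rewrite addrC addKr.
- by move=> a; rewrite addrC subrK.
- by move=> a b; rewrite fadj ordS4_add.
- by rewrite ei addr0.
- by rewrite ej e; congr f; case: (j) => [[|[|[|[|]]]] ?] //; apply: val_inj.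
Qed.

End Types.

(** * Matching the edges of a graph with a word *)

Section Labelling.
Variables (V : finType) (v0 : V).
Implicit Types (u v a b c d : V) (s t : seq V) (w : seq letter) (E : V -> V -> Prop).

Lemma cl_shift q p w : cl (q + p) w = [seq (q + j)%N | j <- cl p w].
Proof.
elim: w p => [|[] w IH] p //=; first by rewrite addnS.
by rewrite -addnS IH.
Qed.

Lemma wedges_shift q p w :
  wedges (q + p) w = [seq ((q + e.1)%N, (q + e.2)%N) | e <- wedges p w].
Proof.
elim: w p => [|[] w IH] p //=; rewrite -?addnS ?IH //.
by rewrite map_cat cl_shift -!map_comp.
Qed.

Lemma wedges_shift0 q w :
  wedges q w = [seq ((q + e.1)%N, (q + e.2)%N) | e <- wedges 0 w].
Proof. by rewrite -wedges_shift addn0. Qed.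

Definition labels E w s :=
  [/\ size s = (wsize w).+1,
      forall u v, E u v -> exists2 e, e \in wedges 0 w & [set u; v] = [set nth v0 s e.1; nth v0 s e.2]
    & forall e, e \in wedges 0 w -> E (nth v0 s e.1) (nth v0 s e.2)].

Lemma nth_shift t s q i : size t = q -> nth v0 (t ++ s) (q + i) = nth v0 s i.
Proof. by move=> <-; rewrite nth_cat ltnNge leq_addr /= addKn. Qed.

Lemma labels_C4 E E' w a d c b s : labels E w (b :: s) ->
  (forall u v, E u v -> E' u v) ->
  (forall u v, E' u v -> E u v \/
     [set u; v] \in [:: [set a; d]; [set d; c]; [set c; b]; [set a; b]]) ->
  E' a d -> E' d c -> E' c b -> E' a b ->
  labels E' (LC :: w) [:: a, d, c, b & s].
Proof.
move=> [h1 h2 h3] hE hE' e1 e2 e3 e4.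
have sh i : nth v0 [:: a, d, c, b & s] (3 + i) = nth v0 (b :: s) i.
  exact: (@nth_shift [:: a; d; c]).
split; first by move: h1; rewrite /=; lia.
  move=> u v /hE' [/h2 [e he ->]|].
    exists ((3 + e.1)%N, (3 + e.2)%N); last by rewrite !sh.
    rewrite /= !inE wedges_shift0 !orbA; apply/orP; right.
    exact: (map_f (fun e : nat * nat => ((3 + e.1)%N, (3 + e.2)%N)) he).
  rewrite !inE => /or4P [] /eqP ->; [exists (0, 1)|exists (1, 2)|exists (2, 3)|exists (0, 3)];
    by rewrite // !inE.
move=> e; rewrite -[LC :: w]/([:: LC] ++ w) /= !inE.
case/orP => [/eqP -> //|]; case/orP => [/eqP -> //|]; case/orP => [/eqP -> //|].
case/orP => [/eqP -> //|]; rewrite wedges_shift0 => /mapP [e' he' ->].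
by rewrite !sh; apply: hE; apply: h3.
Qed.

Lemma cl_clique r p w : cl p (nseq r LE ++ LN :: w) = iota p r.+2.
Proof. by elim: r p => //= r IH p; rewrite IH. Qed.

Lemma wedges_clique r p w e : (e \in wedges p (nseq r LE ++ LN :: w)) =
  (p <= e.1 < e.2)%N && (e.2 <= p + r.+1)%N || (e \in wedges (p + r.+1) w).
Proof.
elim: r p => [|r IH] p /=.
  rewrite inE addn1; congr (_ || _); case: e => i j /=; rewrite xpair_eqE.
  by apply/idP/idP => [/andP [/eqP -> /eqP ->]|h]; [|apply/andP; split; apply/eqP]; lia.
rewrite mem_cat IH cl_clique (_ : p.+1 + r.+1 = p + r.+2)%N; last by lia.
rewrite orbA; congr (_ || _); case: e {IH} => i j; rewrite -[(i, j).1]/i -[(i, j).2]/j.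
apply/idP/idP => [/orP [h|h]|h].
- have [x hx [-> ->]] := mapP h.
  by move: hx; rewrite mem_iota /=; lia.
- by lia.
have [ei|ne] := eqVneq i p; last by apply/orP; right; lia.
by apply/orP; left; rewrite ei; apply: map_f; rewrite mem_iota; lia.
Qed.

(** The list [t] holds the vertices of the clique other than the entry a and the exit b, whence m -
    2 letters [LE] for K_m. *)
Lemma labels_clique E E' w a t b s : labels E w (b :: s) -> uniq (a :: rcons t b) ->
  (forall u v, E u v -> E' u v) ->
  (forall u v, E' u v -> E u v \/ [/\ u != v, u \in a :: rcons t b & v \in a :: rcons t b]) ->
  (forall u v, u \in a :: rcons t b -> v \in a :: rcons t b -> u != v -> E' u v) ->
  labels E' (nseq (size t) LE ++ LN :: w) (a :: t ++ b :: s).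
Proof.
move=> [h1 h2 h3] us hE hE' hK.
have sh i : nth v0 (a :: t ++ b :: s) ((size t).+1 + i) = nth v0 (b :: s) i.
  exact: (@nth_shift (a :: t)).
have nt i : (i <= (size t).+1)%N -> nth v0 (a :: t ++ b :: s) i = nth v0 (a :: rcons t b) i.
  move=> hi; rewrite -cat_rcons -cat_cons nth_cat /= size_rcons.
  by rewrite ltnS hi.
have sz : size (a :: rcons t b) = (size t).+2 by rewrite /= size_rcons.
split.
- have e : wsize (nseq (size t) LE) = size t by elim: (t) => //= ? ? ->.
  by move: h1; rewrite /= size_cat wsize_cat e /=; lia.
- move=> u v /hE' [/h2 [e he ->]|[ne hu hv]].
    exists (((size t).+1 + e.1)%N, ((size t).+1 + e.2)%N); last by rewrite !sh.
    rewrite wedges_clique add0n wedges_shift0.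
    by rewrite (map_f (fun e : nat * nat => (((size t).+1 + e.1)%N, ((size t).+1 + e.2)%N)) he) orbT.
  have key x y : x \in a :: rcons t b -> y \in a :: rcons t b -> (index x (a :: rcons t b) < index y (a :: rcons t b))%N ->
      exists2 e, e \in wedges 0 (nseq (size t) LE ++ LN :: w) &
        [set x; y] = [set nth v0 (a :: t ++ b :: s) e.1; nth v0 (a :: t ++ b :: s) e.2].
    move=> hx hy hxy; exists (index x (a :: rcons t b), index y (a :: rcons t b)).
      rewrite wedges_clique; apply/orP; left; apply/andP; split; first exact: hxy.
      by rewrite add0n -ltnS -sz index_mem.
    have iy : (index y (a :: rcons t b) <= (size t).+1)%N by rewrite -ltnS -sz index_mem.
    have ix : (index x (a :: rcons t b) <= (size t).+1)%N by rewrite -ltnS -sz index_mem.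
    by rewrite !nt // !nth_index.
  case: (ltngtP (index u (a :: rcons t b)) (index v (a :: rcons t b))) => [h|h|h].
  + exact: key.
  + by rewrite setUC; apply: key.
  + by move: ne; rewrite -(nth_index v0 hu) h nth_index // eqxx.
move=> e; rewrite wedges_clique add0n => /orP [/andP [/andP [_ h12] h2']|].
  have e1 : (e.1 <= (size t).+1)%N by lia.
  rewrite !nt //; apply: hK; rewrite ?mem_nth ?sz //.
  by rewrite nth_uniq ?sz //; apply/eqP; lia.
rewrite wedges_shift0 => /mapP [e' he' ->].
by have := hE _ _ (h3 _ he'); rewrite -!sh.
Qed.

End Labelling.

(** * Graphs whose block graph is a path *)

Section BlockPath.
Variables (V : finType) (G : pregraph V) (l : nat) (B : nat -> pregraph V).
Hypotheses (hG : simple_graph G) (hVG : verts G = [set: V]).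
Hypothesis hl : (3 <= l)%N.
Hypothesis hB : block_path G l B.
Implicit Types (u v w x y : V) (i j k : nat).

Lemma Bblock i : (1 <= i <= l)%N -> is_block G (B i).
Proof. by case: hB => h _ _ _; apply: h. Qed.

Lemma Binj i j : (1 <= i <= l)%N -> (1 <= j <= l)%N -> B i = B j -> i = j.
Proof. by case: hB => _ h _ _; apply: h. Qed.

Lemma Bsimple i : (1 <= i <= l)%N -> simple_graph (B i).
Proof. by move=> hi; apply: block_simple (Bblock hi). Qed.

Lemma Bshare i j x y : (1 <= i <= l)%N -> (1 <= j <= l)%N -> x != y ->
  x \in verts (B i) -> x \in verts (B j) -> y \in verts (B i) -> y \in verts (B j) -> i = j.
Proof.
move=> hi hj ne x1 x2 y1 y2; apply: Binj => //.
exact: block_share (Bblock hi) (Bblock hj) ne x1 x2 y1 y2.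
Qed.

Lemma Bcut i j v : (1 <= i <= l)%N -> (1 <= j <= l)%N -> i != j -> cut_vertex G v ->
  v \in verts (B i) -> v \in verts (B j) -> (j == i.+1) || (i == j.+1).
Proof.
move=> hi hj ne hc vi vj; case: hB => _ inj _ <- //; rewrite /block_adj; apply/andP; split.
  by apply: contraNneq ne => /inj ->.
by apply/existsP; exists v; rewrite hc vi.
Qed.

Lemma link_ex i : (1 <= i < l)%N ->
  exists v, [/\ cut_vertex G v, v \in verts (B i) & v \in verts (B i.+1)].
Proof.
move=> hi; have : block_adj G (B i) (B i.+1) by case: hB => _ _ _ ->; rewrite ?eqxx //; lia.
by case/andP => _ /existsP [v /and3P h]; exists v.
Qed.

Lemma verts_inh : exists v : V, true.
Proof.
by have [|v _] := @link_ex 1; [lia|exists v].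
Qed.

Definition link i : V :=
  if [pick v | [&& cut_vertex G v, v \in verts (B i) & v \in verts (B i.+1)]] is Some v
  then v else xchoose verts_inh.

Lemma linkP i : (1 <= i < l)%N ->
  [/\ cut_vertex G (link i), link i \in verts (B i) & link i \in verts (B i.+1)].
Proof.
move=> /link_ex [v hv]; rewrite /link; case: pickP => [x /and3P //|/(_ v)].
by case: hv => -> -> ->.
Qed.

(** A repeated link would be a cut vertex common to B_a and B_(b+1) with a < b, which are not
    adjacent in the block graph. *)
Lemma link_inj i j : (1 <= i < l)%N -> (1 <= j < l)%N -> link i = link j -> i = j.
Proof.
suff H a b : (1 <= a < l)%N -> (1 <= b < l)%N -> (a < b)%N -> link a <> link b.
  by move=> hi hj e; case: (ltngtP i j) => // h; [case: (H i j hi hj h)|case: (H j i hj hi h)].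
move=> ha hb hab e; have [c1 a1 _] := linkP ha; have [_ _ b2] := linkP hb.
have hne : a != b.+1 by apply/eqP; lia.
rewrite -e in b2; have := @Bcut a b.+1 (link a) ltac:(lia) ltac:(lia) hne c1 a1 b2.
by case/orP => /eqP; lia.
Qed.

Fixpoint chain a k : pregraph V := if k is k'.+1 then gU (B a) (chain a.+1 k') else B a.

Lemma gUA (H1 H2 H3 : pregraph V) : gU H1 (gU H2 H3) = gU (gU H1 H2) H3.
Proof. by rewrite /gU /= !setUA. Qed.

Lemma chain_split a m k : chain a (m + k.+1) = gU (chain a m) (chain (a + m).+1 k).
Proof.
elim: m a => [|m IH] a; first by rewrite add0n addn0.
by rewrite addSn /= IH gUA addSnnS.
Qed.

Lemma chain_sub a m k : (m <= k)%N ->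
  {subset verts (B (a + m)) <= verts (chain a k)} /\ edges (B (a + m)) \subset edges (chain a k).
Proof.
elim: k a m => [|k IH] a [|m] //=; rewrite ?addn0 => h.
- by split.
- by split=> [x hx|]; [rewrite inE hx|apply: subsetUl].
have [h1 h2] := IH a.+1 m h; rewrite addnS -addSn; split.
  by move=> x /h1 hx; rewrite inE hx orbT.
by apply: subset_trans h2 _; apply: subsetUr.
Qed.

Lemma chain_subgraph a k : (1 <= a)%N -> (a + k <= l)%N -> subgraph (chain a k) G.
Proof.
elim: k a => [|k IH] a ha hk /=; first by apply/block_sub/Bblock; lia.
apply: subgraph_gU; last by apply: IH; lia.
by apply/block_sub/Bblock; lia.
Qed.

Lemma chain_conn a k : (1 <= a)%N -> (a + k <= l)%N -> conn (chain a k).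
Proof.
elim: k a => [|k IH] a ha hk /=.
  by have [] := @block_nonseparable _ G (B a) (@Bblock a ltac:(lia)).
have [|_ l1 l2] := @linkP a; first lia.
have [c _ _] := @block_nonseparable _ G (B a) (@Bblock a ltac:(lia)).
apply: (conn_gU (x := link a)) => //; first by apply: IH; lia.
by have [h _] := @chain_sub a.+1 0 k isT; apply: h; rewrite addn0.
Qed.

Lemma chain_del_conn a k w : (1 <= a)%N -> (a + k <= l)%N ->
  (forall j, (a <= j < a + k)%N -> link j != w) -> conn (del_vertex (chain a k) w).
Proof.
elim: k a => [|k IH] a ha hk hw /=.
  by have [_ _] := @block_nonseparable _ G (B a) (@Bblock a ltac:(lia)); apply.
have [|_ l1 l2] := @linkP a; first lia.
have [_ _ c] := @block_nonseparable _ G (B a) (@Bblock a ltac:(lia)).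
rewrite del_gU; apply: (conn_gU (x := link a)) => //.
- by apply: IH; [|lia|move=> j hj; apply: hw; lia].
- by rewrite verts_del l1 hw //; lia.
- have [h _] := @chain_sub a.+1 0 k isT.
  by rewrite verts_del h ?addn0 // hw //; lia.
Qed.

(* Otherwise the union of B_i, ..., B_j, closed into a ring by v, would be
   nonseparable: deleting a vertex breaks at most one of its links. *)
Lemma far_disjoint i j v : (1 <= i)%N -> (i.+2 <= j <= l)%N ->
  v \in verts (B i) -> v \in verts (B j) -> False.
Proof.
move=> hi hj vi vj.
(* Links are cut vertices, and a cut vertex common to B_i and B_j would make these two blocks
   adjacent. *)
have hv k : (i <= k < j)%N -> link k != v.
  move=> hk; apply/eqP => e; have [|hc _ _] := @linkP k; first lia.
  have hne : i != j by apply/eqP; lia.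
  rewrite e in hc; have := @Bcut i j v ltac:(lia) ltac:(lia) hne hc vi vj.
  by case/orP => /eqP; lia.
have hij : (i + (j - i) = j)%N by lia.
pose H := chain i (j - i).
have hs : subgraph H G by apply: chain_subgraph; lia.
have vH x m : (i <= m <= j)%N -> x \in verts (B m) -> x \in verts H.
  move=> hm hx; have [h _] := @chain_sub i (m - i) (j - i) ltac:(lia).
  by apply: h; rewrite subnKC //; lia.
have hn : nonseparable H.
  apply/nonseparableP; first by case/and3P: hs.
  split; [by apply: chain_conn; lia|by exists v; apply: (vH _ i) => //; lia|move=> w].
  (* If w is the link between B_c and B_(c+1), the two halves of the chain stay connected through v,
     their other meeting point. *)
  have [/hasP [c]|/hasPn hw] := boolP (has (fun c => link c == w) (iota i (j - i))); last first.
    apply: chain_del_conn => //; first lia.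
    by move=> m hm; apply: hw; rewrite mem_iota; lia.
  rewrite mem_iota => hc /eqP ec.
  have hw m : (i <= m < j)%N -> m != c -> link m != w.
    move=> hm; apply: contraNneq => em; apply/eqP/link_inj; try lia.
    by rewrite em ec.
  have -> : H = gU (chain i (c - i)) (chain c.+1 (j - c.+1)).
    rewrite /H (_ : j - i = c - i + (j - c.+1).+1)%N; last lia.
    by rewrite chain_split (_ : i + (c - i) = c)%N //; lia.
  rewrite del_gU; apply: (conn_gU (x := v)).
  - apply: chain_del_conn => //; first lia.
    by move=> m hm; apply: hw; [lia|apply/eqP; lia].
  - apply: chain_del_conn => //; first lia.
    by move=> m hm; apply: hw; [lia|apply/eqP; lia].
  - rewrite verts_del -ec eq_sym hv /=; last lia.
    by have [h _] := @chain_sub i 0 (c - i) isT; apply: h; rewrite addn0.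
  - rewrite verts_del -ec eq_sym hv /=; last lia.
    have [h _] := @chain_sub c.+1 (j - c.+1) (j - c.+1) (leqnn _); apply: h.
    by rewrite subnKC //; lia.
have sub m : (i <= m <= j)%N -> B m = H.
  move=> hm; apply/esym; apply: (block_max (Bblock _) hs hn); first lia.
  apply/and3P; split; first by apply: Bsimple; lia.
    by apply/subsetP => x; apply: vH.
  have [_ h] := @chain_sub i (m - i) (j - i) ltac:(lia).
  by rewrite subnKC in h; [exact: h|lia].
have : i = i.+1 by apply: Binj; [lia|lia|rewrite !sub //; lia].
by lia.
Qed.

Hypothesis hty : forall i, (1 <= i <= l)%N -> (is_C4 (B i) /\ (1 < i < l)%N) \/
  exists m, [/\ (2 <= m)%N, ((1 < i)%N -> (3 <= m)%N) & is_complete (B i) m].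
Hypothesis hC4 : forall H, is_block G H -> is_C4 H ->
  exists u v, [/\ [set w in verts H | cut_vertex G w] = [set u; v], u != v & adj G u v].

Lemma C4_mid i : (1 <= i <= l)%N -> is_C4 (B i) -> (1 < i < l)%N.
Proof.
move=> hi /C4P [f [finj fv fadj]]; case: (hty hi) => [[]//|[m [_ _ /completeP [_ h]]]].
have : adj (B i) (f 0) (f 2).
  by apply: h; [apply/fv; eexists|apply/fv; eexists|rewrite (inj_eq finj)].
by rewrite fadj.
Qed.

Lemma nonC4 i : (1 <= i <= l)%N -> ~~ is_C4 (B i) ->
  [/\ (2 <= #|verts (B i)|)%N, ((1 < i)%N -> (3 <= #|verts (B i)|)%N) &
      forall x y, x \in verts (B i) -> y \in verts (B i) -> x != y -> adj (B i) x y].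
Proof.
by move=> hi hn; case: (hty hi) => [[h]|[m [h1 h2 /completeP [-> h3]]]]; first by rewrite h in hn.
Qed.

Lemma edge_in_block u v : adj G u v -> exists2 i, (1 <= i <= l)%N & adj (B i) u v.
Proof.
move=> /(block_edge hG) [H hH huv]; case: hB => _ _ h _; have [i hi e] := h H hH.
by exists i => //; rewrite -e.
Qed.

Lemma vertex_in_block v : exists2 i, (1 <= i <= l)%N & v \in verts (B i).
Proof.
have [|H hH hv] := @block_vertex _ G v; first by rewrite hVG inE.
by case: hB => _ _ h _; have [i hi e] := h H hH; exists i => //; rewrite -e.
Qed.

Lemma BadjG i u v : (1 <= i <= l)%N -> u \in verts (B i) -> v \in verts (B i) ->
  adj G u v -> adj (B i) u v.
Proof.
move=> hi hu hv /edge_in_block [j hj huv].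
have [hu' hv' ne] := simple_adj (Bsimple hj) huv.
by rewrite (Bshare hi hj ne hu hu' hv hv').
Qed.

Lemma Bcard i : (1 <= i <= l)%N -> (2 <= #|verts (B i)|)%N.
Proof.
move=> hi; have [h|h] := boolP (is_C4 (B i)); last by case: (nonC4 hi h).
have [_ h1 h2] := @linkP i ltac:(have := C4_mid hi h; lia).
have [|_ h3 h4] := @linkP i.-1; first by have := C4_mid hi h; lia.
have hm := C4_mid hi h; rewrite prednK in h4; last by lia.
apply/card_gt1P; exists (link i.-1), (link i); split=> //.
by apply/eqP => /link_inj; lia.
Qed.

Definition other i v : V := odflt v [pick x in verts (B i) | x != v].

Lemma otherP i v : (1 <= i <= l)%N -> other i v \in verts (B i) /\ other i v != v.
Proof.
move=> hi; rewrite /other; case: pickP => [x /andP []//|h].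
by have [y hy ne] := card2_ex v (Bcard hi); have := h y; rewrite hy ne.
Qed.

(* The cut vertices in order, extended by a vertex at either end. *)
Definition pt i : V :=
  if i == 0%N then other 1 (link 1) else if i == l then other l (link l.-1) else link i.

Lemma ptP i : (1 <= i <= l)%N ->
  [/\ pt i.-1 \in verts (B i), pt i \in verts (B i) & pt i.-1 != pt i].
Proof.
case: i => [|i] // hi; rewrite [i.+1.-1]/= /pt (_ : (i.+1 == 0)%N = false) //.
have [-> |i0] := eqVneq i 0%N.
  have -> : (1 == l)%N = false by apply/eqP; lia.
  have [|h1 h2] := @otherP 1 (link 1); first lia.
  by have [|_ h3 _] := @linkP 1; first lia.
have -> : (i == l)%N = false by apply/eqP; lia.
have [|_ h1 h2] := @linkP i; first by move/eqP: i0; lia.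
case: (eqVneq i.+1 l) => [e|ne].
  have [|h3 h4] := @otherP l (link l.-1); first lia.
  rewrite e in h2 *; split=> //; rewrite eq_sym (_ : i = l.-1) //; lia.
have [|_ h3 _] := @linkP i.+1; first by move/eqP: ne; lia.
split=> //; apply/eqP => /link_inj; move/eqP: i0; move/eqP: ne; lia.
Qed.

(** Blocks that are not consecutive are disjoint, and consecutive ones cannot share a second vertex
    besides their link. *)
Lemma pt_int i j x : (1 <= i < j)%N -> (j <= l)%N ->
  x \in verts (B i) -> x \in verts (B j) -> x = pt i.
Proof.
move=> hi hj xi xj; have [e|ne] := eqVneq j i.+1; last first.
  by case: (@far_disjoint i j x) => //; [lia|move/eqP: ne; lia].
rewrite e in xj; have [|_ h1 h2] := @linkP i; first lia.
have -> : pt i = link i.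
  by rewrite /pt; do 2![case: eqP => [?|_]; first lia].
apply/eqP/negP => /negP ne; have := @Bshare i i.+1 x (link i) ltac:(lia) ltac:(lia) ne xi xj h1 h2.
by lia.
Qed.

(** Both links are cut vertices of G in this block, so they are the two adjacent ones that the
    hypothesis on 4-cycles provides. *)
Lemma C4_edge i : (1 <= i <= l)%N -> is_C4 (B i) -> adj (B i) (pt i.-1) (pt i).
Proof.
move=> hi h; have hm := C4_mid hi h; have [h1 h2 ne] := ptP hi.
have [u [v [e _ huv]]] := hC4 (Bblock hi) h.
have hc k : (1 <= k < l)%N -> pt k = link k.
  by move=> hk; rewrite /pt; do 2![case: eqP => [?|_]; first lia].
have in1 : pt i.-1 \in [set u; v].
  rewrite -e inE h1 hc; last lia.
  by have [] := @linkP i.-1; first lia.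
have in2 : pt i \in [set u; v].
  rewrite -e inE h2 hc; last lia.
  by have [] := @linkP i; first lia.
apply: BadjG => //; move: in1 in2 ne; rewrite !inE.
by case/orP => /eqP -> /orP [] /eqP ->; rewrite ?eqxx // adj_sym.
Qed.

Definition ty i : block := if is_C4 (B i) then BC else BK #|verts (B i)|.

Lemma words_cons b bs : words (b :: bs) = bword b ++ words bs.
Proof. by []. Qed.

(** Words grow at the front, so the last r blocks are labelled by induction on r. The next block
    meets them only in its exit point, which keeps the list duplicate-free. *)
Lemma labelled r : (r <= l)%N -> exists s,
  [/\ uniq (pt (l - r) :: s),
      forall x, x \in pt (l - r) :: s <->
        x = pt (l - r) \/ exists2 j, (l - r < j <= l)%N & x \in verts (B j)
    & labels (pt 0) (fun u v => exists2 j, (l - r < j <= l)%N & adj (B j) u v)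
        (words (map ty (iota (l - r).+1 r))) (pt (l - r) :: s)].
Proof.
elim: r => [|r IH] hr.
  exists [::]; rewrite subn0; split=> // [x|].
    rewrite inE; split=> [/eqP ->|[->//|[j hj]]]; [by left|lia].
  by split=> // u v [j hj]; lia.
have [s [us ms ls]] := IH (ltnW hr).
pose i := (l - r)%N; rewrite -/i in us ms ls.
have hi : (1 <= i <= l)%N by lia.
have -> : (l - r.+1 = i.-1)%N by lia.
have hi1 : i.-1.+1 = i by lia.
have hil : (i <= i <= l)%N by rewrite leqnn; case/andP: hi.
rewrite hi1 -[iota i r.+1]/(i :: iota i.+1 r) map_cons words_cons.
have [pa pb pne] := ptP hi; set a := pt i.-1 in pa pne *; set b := pt i in pb pne us ms ls *.
have disj x : x \in verts (B i) -> x != b -> x \notin b :: s.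
  move=> hx ne; apply/negP => /ms [e|[j hj hxj]]; first by rewrite e eqxx in ne.
  by move: ne; rewrite (@pt_int i j x _ _ hx hxj) ?eqxx //; lia.
have ex1 (Q : nat -> Prop) : (exists2 j, (i <= j <= l)%N & Q j) <->
    Q i \/ exists2 j, (i < j <= l)%N & Q j.
  split=> [[j hj q]|[q|[j hj q]]].
  - by have [<-|/eqP ne] := eqVneq j i; [left|right; exists j => //; lia].
  - by exists i => //; lia.
  - by exists j => //; lia.
have bs_in : b \in b :: s by rewrite mem_head.
have mem x t : (forall y, (y \in a :: rcons t b) = (y \in verts (B i))) ->
    x \in a :: t ++ b :: s <-> x = a \/ exists2 j, (i <= j <= l)%N & x \in verts (B j).
  move=> ht; have -> : (x \in a :: t ++ b :: s) = (x \in a :: rcons t b) || (x \in b :: s).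
    by rewrite !(inE, mem_cat, mem_rcons); do !case: (_ == _); rewrite ?orbT.
  rewrite ht (ex1 (fun j => x \in verts (B j))); split.
    case/orP => [h|/ms [->|h]]; by [right; left|right; right].
  case=> [->|[h|h]]; [by rewrite pa|by rewrite h|].
  by apply/orP; right; apply/ms; right.
have uni t : uniq (a :: rcons t b) -> {subset a :: rcons t b <= verts (B i)} ->
    uniq (a :: t ++ b :: s).
  rewrite -rcons_cons rcons_uniq => /andP [hb ut] ht.
  rewrite -cat_cons cat_uniq ut us andbT andTb; apply/hasPn => x hx; apply/negP => hx'.
  have : x \notin b :: s.
    apply: disj; first by apply: ht; rewrite mem_rcons in_cons hx' orbT.
    by apply: contraNneq hb => <-.
  by rewrite hx.
rewrite /ty; case: ifP => [h4|/negbT hK] /=.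
  have [d [c [udc vdc [e1 e2 e3] ee]]] := C4_label (Bsimple hi) h4 (C4_edge hi h4).
  have hv y : (y \in a :: rcons [:: d; c] b) = (y \in verts (B i)) by rewrite vdc.
  exists [:: d, c, b & s]; split.
  - by apply: (uni [:: d; c]) => // y; rewrite hv.
  - by move=> x; exact (mem x [:: d; c] hv).
  apply: (labels_C4 ls).
  - by move=> u v h; apply/(ex1 (fun j => adj (B j) u v)); right.
  - move=> u v /(ex1 (fun j => adj (B j) u v)) [h|h]; last by left.
    by right; apply: ee.
  - by exists i.
  - by exists i.
  - by exists i.
  - by exists i; last exact: C4_edge.
have [c2 _ hadj] := nonC4 hi hK.
pose t := enum (verts (B i) :\ a :\ b).
have st : size t = (#|verts (B i)| - 2)%N.
  have := cardsD1 a (verts (B i)); have := cardsD1 b (verts (B i) :\ a).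
  by rewrite /t -cardE !inE pa pb eq_sym pne /=; lia.
have hv y : (y \in a :: rcons t b) = (y \in verts (B i)).
  rewrite in_cons mem_rcons in_cons mem_enum !inE.
  case: (eqVneq y a) => [->|_]; first by rewrite pa.
  by case: (eqVneq y b) => [->|_]; first by rewrite pb.
have ut : uniq (a :: rcons t b).
  rewrite /= rcons_uniq mem_rcons in_cons !mem_enum !inE enum_uniq !eqxx /= andbF.
  by rewrite (negPf pne).
exists (t ++ b :: s); split.
- by apply: uni => // y; rewrite hv.
- by move=> x; apply: mem.
rewrite -st -catA; apply: (labels_clique ls ut).
- by move=> u v h; apply/(ex1 (fun j => adj (B j) u v)); right.
- move=> u v /(ex1 (fun j => adj (B j) u v)) [h|h]; last by left.
  by right; have [hu hv' ne] := simple_adj (Bsimple hi) h; rewrite !hv.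
- by move=> u v; rewrite !hv => hu hv' ne; exists i; last exact: hadj.
Qed.

Lemma last_type : ends_clique (map ty (iota 2 l.-1)).
Proof.
have -> : (l.-1 = l.-2 + 1)%N by lia.
rewrite iotaD map_cat /ends_clique last_cat /= (_ : 2 + l.-2 = l)%N; last by lia.
rewrite /ty; case: ifP => // h; have := @C4_mid l ltac:(lia) h; lia.
Qed.

Lemma regularity_block_path (K : fieldType) :
  regularity (binomial_edge_ideal (K := K) G) (Posz (values (map ty (iota 1 l)))).
Proof.
have [s [us ms [h1 h2 h3]]] := labelled (leqnn l); rewrite subnn in us ms h1 h2 h3.
have e : map ty (iota 1 l) = BK #|verts (B 1)| :: map ty (iota 2 l.-1).
  rewrite -[in LHS](prednK (_ : 0 < l)%N); last by lia.
  rewrite /= /ty; case: ifP => // h; have := @C4_mid 1 ltac:(lia) h; lia.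
rewrite e in h1 h2 h3 *; apply: (@regularity_words K V G (pt 0) (pt 0 :: s) _ _ us _ (esym h1)).
- move=> v; apply/ms; right; have [i hi hv] := vertex_in_block v; by exists i.
- rewrite all_map; apply/allP => i; rewrite mem_iota => hi; rewrite /= /ty; case: ifP => // /negbT h.
  have [||_ h' _] := @nonC4 i => //; first lia.
  by apply: h'; lia.
- exact: last_type.
- by move=> u v /edge_in_block [i hi huv]; apply: h2; exists i.
- by move=> x /h3 [i hi /(block_adjE (Bblock hi))].
Qed.

(** * Maximal cliques and the counts of blocks *)

Lemma near_blocks i j x : (1 <= i <= l)%N -> (1 <= j <= l)%N ->
  x \in verts (B i) -> x \in verts (B j) -> (i <= j.+1)%N && (j <= i.+1)%N.
Proof.
move=> hi hj xi xj; apply/andP; split; rewrite leqNgt; apply/negP => h.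
  by apply: (@far_disjoint j i x) => //; lia.
by apply: (@far_disjoint i j x) => //; lia.
Qed.

(** The blocks of the three edges meet pairwise, so their indices differ by at most 1 pairwise;
    hence two of them coincide, and that block contains all three vertices. *)
Lemma triangle_in_block i u v w : (1 <= i <= l)%N -> adj (B i) u v ->
  adj G u w -> adj G v w -> w \in verts (B i).
Proof.
move=> hi huv /edge_in_block [k hk huw] /edge_in_block [j hj hvw].
have [ui vi nuv] := simple_adj (Bsimple hi) huv.
have [uk wk nuw] := simple_adj (Bsimple hk) huw.
have [vj wj nvw] := simple_adj (Bsimple hj) hvw.
have [e|/eqP nij] := eqVneq i j; first by rewrite e.
have [e|/eqP nik] := eqVneq i k; first by rewrite e.
have [e|/eqP njk] := eqVneq j k.
  by case: nij; apply: (Bshare hi hj nuv) => //; rewrite e.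
have nij' := near_blocks hi hj vi vj; have nik' := near_blocks hi hk ui uk.
have njk' := near_blocks hj hk wj wk; clear - nij nik njk nij' nik' njk'; lia.
Qed.

Lemma cliqueP (C : {set V}) :
  reflect (forall u v, u \in C -> v \in C -> u != v -> adj G u v) (clique G C).
Proof.
rewrite /clique hVG subsetT; apply: (iffP forall_inP) => [h u v hu hv ne|h u hu].
  by have /forall_inP h' := h u hu; apply: (implyP (h' v hv)).
by apply/forall_inP => v hv; apply/implyP; apply: h.
Qed.

Lemma clique_in_block C u v : clique G C -> u \in C -> v \in C -> u != v ->
  exists i, [/\ (1 <= i <= l)%N, adj (B i) u v & C \subset verts (B i)].
Proof.
move=> /cliqueP hC hu hv ne; have [i hi huv] := edge_in_block (hC u v hu hv ne).
exists i; split=> //; apply/subsetP => w hw.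
have [ui vi _] := simple_adj (Bsimple hi) huv.
have [->//|nwu] := eqVneq w u; have [->//|nwv] := eqVneq w v.
by apply: (triangle_in_block hi huv); apply: hC; rewrite // eq_sym.
Qed.

Lemma C4_triangle_free i u v w : is_C4 (B i) -> adj (B i) u v -> adj (B i) u w ->
  adj (B i) v w -> simple_graph (B i) -> False.
Proof.
move=> /C4P [f [finj fv fadj]] huv huw hvw hs.
have [/fv [a ea] /fv [b eb] _] := simple_adj hs huv.
have [_ /fv [c ec] _] := simple_adj hs huw.
move: huv huw hvw; rewrite ea eb ec !fadj.
by case: a {ea} => [[|[|[|[|]]]] ?] //; case: b {eb} => [[|[|[|[|]]]] ?] //;
  case: c {ec} => [[|[|[|[|]]]] ?].
Qed.

Lemma neighbour i v : (1 <= i <= l)%N -> v \in verts (B i) -> exists2 u, u != v & adj G u v.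
Proof.
move=> hi hv; have hb := Bblock hi.
suff [u huv] : exists u, adj (B i) u v.
  by have [_ _ ne] := simple_adj (Bsimple hi) huv; exists u => //; apply: block_adjE huv.
have [h|h] := boolP (is_C4 (B i)); last first.
  have [hc _ ha] := nonC4 hi h; have [u hu ne] := card2_ex v hc.
  by exists u; apply: ha.
have [f [finj fv fadj]] := C4P h; have /fv [a ->] := hv.
by exists (f (ordS a)); rewrite fadj eqxx orbT.
Qed.

(** A single vertex is never a maximal clique, because it has a neighbour. A clique with two
    vertices lies inside one block: in a C4, which has no triangle, it is one of the excluded edges,
    and in a complete block maximality makes it the whole block. *)
Lemma maximal_cliquesE C :
  (maximal_clique G C && ~~ [exists H, [&& is_block G H, is_C4 H & C \in edges H]]) <->
  exists i, [/\ (1 <= i <= l)%N, ~~ is_C4 (B i) & C = verts (B i)].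
Proof.
split=> [/andP [/maxsetP [hC hmax] hnC4]|[i [hi h4 ->]]]; last first.
  have [hc _ ha] := nonC4 hi h4.
  have hcl : clique G (verts (B i)).
    by apply/cliqueP => u v hu hv ne; apply: (block_adjE (Bblock hi)); apply: ha.
  have /card_gt1P [u [v [hu hv ne]]] := hc.
  have same j : (1 <= j <= l)%N -> u \in verts (B j) -> v \in verts (B j) -> j = i.
    by move=> hj uj vj; apply: (Bshare hj hi ne).
  apply/andP; split.
    apply/maxsetP; split=> // C' hC' hsub.
    have hu' := subsetP hsub _ hu; have hv' := subsetP hsub _ hv.
    have [j [hj huv hj']] := clique_in_block hC' hu' hv' ne.
    have [uj vj _] := simple_adj (Bsimple hj) huv.
    by apply/eqP; rewrite eqEsubset hsub andbT -(same j hj uj vj).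
  apply/negP => /existsP [H /and3P [hH hH4 hE]]; case: hB => _ _ h _.
  have [j hj e] := h H hH; rewrite e in hE hH4.
  have /forall_inP /(_ _ hE) /andP [_ /subsetP hsub] := Bsimple hj.
  by move: h4; rewrite -(same j hj (hsub _ hu) (hsub _ hv)) hH4.
have [v hv] : exists v, v \in C.
  have [v _] := verts_inh; have [e0|[w hw]] := set_0Vmem C; last by exists w.
  have hv1 : clique G [set v].
    by apply/cliqueP => x y; rewrite !inE => /eqP -> /eqP ->; rewrite eqxx.
  have s0 : C \subset [set v] by rewrite e0 sub0set.
  by have /setP /(_ v) := hmax [set v] hv1 s0; rewrite e0 !inE eqxx.
have [u hu ne] : exists2 u, u \in C & u != v.
  have [i hi vi] := vertex_in_block v; have [u ne huv] := neighbour hi vi.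
  have [h|/pred0Pn [w /andP [nw hw]]] := boolP (pred0b [pred w | (w != v) && (w \in C)]); last by exists w.
  have eC w : w \in C -> w = v.
    by move=> hw; apply/eqP; move/pred0P: h => /(_ w) /=; rewrite hw andbT => /negbFE.
  have hc : clique G [set u; v].
    apply/cliqueP => x y; rewrite !inE => /orP [] /eqP -> /orP [] /eqP -> //;
      by rewrite ?eqxx // adj_sym.
  have sC : C \subset [set u; v] by apply/subsetP => w /eC ->; rewrite !inE eqxx orbT.
  have uC : u \in C by rewrite -(hmax _ hc sC) !inE eqxx.
  by rewrite (eC u uC) eqxx in ne.
have [i [hi huv hsub]] := clique_in_block hC hu hv ne.
have hCadj := cliqueP _ hC.
have h4 : ~~ is_C4 (B i).
  apply: contra hnC4 => h4; apply/existsP; exists (B i); rewrite (Bblock hi) h4 /=.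
  suff -> : C = [set u; v] by [].
  apply/setP => w; rewrite !inE; apply/idP/orP => [hw|[] /eqP -> //].
  have [e|nwu] := eqVneq w u; first by left.
  have [e|nwv] := eqVneq w v; first by right.
  case: (@C4_triangle_free i u v w) => //; last exact: Bsimple.
  - by apply: BadjG; rewrite ?(subsetP hsub) // hCadj // eq_sym.
  - by apply: BadjG; rewrite ?(subsetP hsub) // hCadj // eq_sym.
exists i; split=> //; apply/esym/hmax => //; apply/cliqueP => x y hx hy nxy.
have [_ _ ha] := nonC4 hi h4.
by apply: (block_adjE (Bblock hi)); apply: ha.
Qed.

Lemma c4E : c4 G = #|[set i : 'I_l | is_C4 (B i.+1)]|.
Proof.
rewrite /c4 -(@card_in_imset _ _ (fun i : 'I_l => B i.+1)); last first.
  by move=> i j _ _ /Binj e; apply: val_inj; have := ltn_ord i; have := ltn_ord j => hj hi; case: (e hi hj).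
apply: eq_card => H; apply/idP/imsetP => [|[i hi ->]]; rewrite inE.
  case/andP => hH h4; case: hB => _ _ h _; have [[|i] hi e] := h H hH; first by lia.
  have hi' : (i < l)%N by lia.
  by exists (Ordinal hi'); rewrite ?inE -e.
by rewrite inE in hi; rewrite hi andbT; apply: Bblock; have := ltn_ord i; lia.
Qed.

Lemma c'E : c' G = #|[set i : 'I_l | ~~ is_C4 (B i.+1)]|.
Proof.
rewrite /c' -(@card_in_imset _ _ (fun i : 'I_l => verts (B i.+1))); last first.
  move=> i j _ _ e; apply: val_inj; have hi := ltn_ord i; have hj := ltn_ord j.
  have /card_gt1P [u [v [hu hv ne]]] : (1 < #|verts (B i.+1)|)%N by apply: Bcard; lia.
  suff [] : i.+1 = j.+1 by [].
  by apply: (@Bshare i.+1 j.+1 u v) => //; rewrite -e.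
apply: eq_card => C; apply/idP/imsetP => [|[i hi ->]]; rewrite inE.
  move=> /maximal_cliquesE [[|i] [hi h4 ->]]; first by lia.
  have hi' : (i < l)%N by lia.
  by exists (Ordinal hi'); rewrite ?inE.
apply/maximal_cliquesE; exists i.+1; rewrite inE in hi; split=> //.
by have := ltn_ord i; lia.
Qed.

Lemma values_types : values (map ty (iota 1 l)) = (2 * c4 G + c' G)%N.
Proof.
have cE (P : pred 'I_l) : #|[set i | P i]| = (\sum_(i < l) P i)%N.
  rewrite -sum1_card big_mkcond /=; apply: eq_bigr => i _.
  by rewrite inE; case: (P i).
rewrite c4E c'E !cE.
transitivity (\sum_(i < l) (2 * is_C4 (B i.+1) + ~~ is_C4 (B i.+1)))%N; last first.
  by rewrite big_split big_distrr.
rewrite /values -map_comp -[1%N]addn0 iotaDl -map_comp sumnE big_map.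
rewrite -[in iota 0 l](subn0 l) -/(index_iota 0 l) big_mkord; apply: eq_bigr => i _.
by rewrite /= /ty add1n; case: (is_C4 _).
Qed.

End BlockPath.

Theorem theorem4p3 (K : fieldType) (V : finType) (G : pregraph V)
    (l m1 ml : nat) (B : nat -> pregraph V) :
  simple_graph G -> verts G = [set: V] ->
  ~ decomposable G ->
  (3 <= l)%N -> block_path G l B ->
  (2 <= m1)%N -> is_complete (B 1) m1 ->
  (3 <= ml)%N -> is_complete (B l) ml ->
  is_C4 (B 2) -> is_C4 (B l.-1) ->
  (forall i : nat, (3 <= i <= l - 2)%N ->
     is_C4 (B i) \/ exists2 m : nat, (3 <= m)%N & is_complete (B i) m) ->
  (forall H : pregraph V, is_block G H -> is_C4 H ->
     exists u v : V, [/\ [set w in verts H | cut_vertex G w] = [set u; v],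
                         u != v & adj G u v]) ->
  regularity (binomial_edge_ideal (K := K) G) (Posz (2 * c4 G + c' G)).
Proof.
move=> hG hVG _ hl hB hm1 h1 hml hml' h2 hl1 hmid hC4.
have hty i : (1 <= i <= l)%N -> (is_C4 (B i) /\ (1 < i < l)%N) \/
    exists m, [/\ (2 <= m)%N, ((1 < i)%N -> (3 <= m)%N) & is_complete (B i) m].
  move=> hi; have [->|/eqP n1] := eqVneq i 1%N; first by right; exists m1.
  have [->|/eqP nl] := eqVneq i l; first by right; exists ml; split=> //; lia.
  have [->|/eqP n2] := eqVneq i 2; first by left; split=> //; lia.
  have [->|/eqP nl1] := eqVneq i l.-1; first by left; split=> //; lia.
  case: (hmid i) => [|h|[m hm h]]; first lia; first by left; split=> //; lia.
  by right; exists m; split=> //; lia.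
rewrite -(values_types hG hVG hl hB hty).
exact: (regularity_block_path hG hVG hl hB hty hC4).
Qed.
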